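(* Assume (G1), (G2), (SP1) and (SP2). Then as $n\to\infty$, $$\frac{U_n(\rho)}{\sqrt{\mathrm{Var}(U_n(\rho))}}\to N(0,1)\quad\text{and}\quad \mathrm{SNR}\cdot(\hat\rho^*-\rho)=\frac{\mathbb E[Q_n(a)]}{\sqrt{\mathrm{Var}(U_n(\rho))}}(\hat\rho^*-\rho)\to N(0,1)\qquad\text{in law}.$$
   Context: Asymptotic framework: $n\to\infty$ and all parameters may depend on $n$; $a_n\asymp b_n$ means $c_0\le a_n/b_n\le c_1$ for constants $c_1>c_0>0$ and all large $n$. $(x,y)$ is the inner product, $\|x\|_1$ the $\ell^1$ norm, $x_{\max}$ the largest entry. The $p_1$ model: a directed network on nodes $\{1,\dots,n\}$ has adjacency matrix $A\in\{0,1\}^{n\times n}$ with $A_{ii}=0$. The pairs $(A_{ij},A_{ji})$, $1\le i<j\le n$, are independent, and for parameters $\theta=(\rho,\gamma,\alpha_1,\beta_1,\dots,\alpha_n,\beta_n)$ with $\sum_i\alpha_i=\sum_i\beta_i=0$, for $a,b\in\{0,1\}$, $i\ne j$: $\mathbb P(A_{ij}=a,A_{ji}=b)=K_{ij}\exp(a(\gamma+\alpha_i+\beta_j)+b(\gamma+\alpha_j+\beta_i)+ab\rho)$, $K_{ij}=[1+e^{\gamma+\alpha_i+\beta_j}+e^{\gamma+\alpha_j+\beta_i}+e^{2\gamma+\alpha_i+\beta_j+\alpha_j+\beta_i+\rho}]^{-1}$. Let $\mu_i=e^{\gamma/2+\alpha_i}$, $\nu_i=e^{\gamma/2+\beta_i}$,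 $\eta_i=\mu_i\nu_i$. Let $\tilde J_n$ be the all-ones matrix minus identity, $\circ$ entrywise product; $A^{11}=A\circ A'$, $A^{00}=(\tilde J_n-A)\circ(\tilde J_n-A')$, $A^{10}=A\circ(\tilde J_n-A')$, $A^{01}=(A^{10})'$. $Q_n(a)=\sum_{i,j,k,\ell\,(\mathrm{dist})}A^{11}_{ij}A^{00}_{jk}A^{01}_{k\ell}A^{00}_{\ell i}$, $Q_n(b)=\sum_{i,j,k,\ell\,(\mathrm{dist})}A^{10}_{ij}A^{10}_{jk}A^{00}_{k\ell}A^{10}_{\ell i}$ (sums over distinct indices); $U_n(\rho)=Q_n(a)-e^\rho Q_n(b)$; $\mathrm{SNR}=\mathbb E[Q_n(a)]/\sqrt{\mathrm{Var}(U_n(\rho))}$. With $H(x;t)=x$ if $|x|\le t$ and $\mathrm{sign}(x)t$ otherwise, $\hat\rho^*=H(\log(Q_n(a)/Q_n(b));2\log n)$. $\tilde\rho=\log(\|\eta\|_1^2/[(\mu,\eta)(\nu,\eta)])$. Conditions: (G1) $\mu_{\max}\to0$, $\nu_{\max}\to0$, $e^{\rho/2}\eta_{\max}\to0$. (G2) $e^{\rho/2}\|\eta\|_1\to\infty$ and $\|\eta\|_1\to\infty$. (SP1) $\mu_{\max}^2\nu_{\max}^2/[(\mu,\eta)(\nu,\eta)]\to0$. Case (L): $e^\rho\ge Ce^{\tilde\rho}$ for a constant $C>0$. (SP2) In Case (L) (and only there), $\|\mu\|_1\asymp\|\nu\|_1$. *)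

(* Defs.v *)
From HB Require Import structures.
From mathcomp Require Import all_boot all_order all_algebra.
From mathcomp Require Import all_classical all_reals all_analysis.
Set Implicit Arguments. Unset Strict Implicit. Unset Printing Implicit Defensive.
Import Order.TTheory GRing.Theory Num.Theory.
Import numFieldNormedType.Exports.
Local Open Scope classical_set_scope.
Local Open Scope ring_scope.

Definition adj (n : nat) := {ffun 'I_n * 'I_n -> bool}.

Section p1_model.
Variables (R : realType) (n : nat).
Variables (rho gamma : R) (alpha beta : 'I_n -> R).

Definition b2R (b : bool) : R := if b then 1 else 0.

(** P(A_ij = a, A_ji = b) in the p1 model, i <> j *)
Definition p1_lin (i j : 'I_n) : R := gamma + alpha i + beta j.
Definition p1_K (i j : 'I_n) : R :=
  (1 + expR (p1_lin i j) + expR (p1_lin j i)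
     + expR (p1_lin i j + p1_lin j i + rho))^-1.
Definition p1_pair (a b : bool) (i j : 'I_n) : R :=
  p1_K i j * expR (b2R a * p1_lin i j + b2R b * p1_lin j i + b2R a * b2R b * rho).

(** probability mass function of A: dyads (A_ij,A_ji), i<j, independent;
    A_ii = 0 almost surely *)
Definition p1_pmf (A : adj n) : R :=
  b2R [forall i : 'I_n, ~~ A (i, i)] *
  \prod_(i : 'I_n) \prod_(j : 'I_n | (i < j)%N) p1_pair (A (i, j)) (A (j, i)) i j.

Definition p1_E (X : adj n -> R) : R := \sum_(A : adj n) p1_pmf A * X A.
Definition p1_Var (X : adj n -> R) : R := p1_E (fun A => X A ^+ 2) - (p1_E X) ^+ 2.
Definition p1_Prob (P : adj n -> bool) : R := p1_E (fun A => b2R (P A)).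

Definition mu_ (i : 'I_n) : R := expR (gamma / 2 + alpha i).
Definition nu_ (i : 'I_n) : R := expR (gamma / 2 + beta i).
Definition eta_ (i : 'I_n) : R := mu_ i * nu_ i.
Definition vmax (x : 'I_n -> R) : R := \big[Num.max/0]_(i : 'I_n) x i.
Definition l1norm (x : 'I_n -> R) : R := \sum_(i : 'I_n) `|x i|.
Definition inner (x y : 'I_n -> R) : R := \sum_(i : 'I_n) x i * y i.
Definition rho_tilde : R :=
  ln (l1norm eta_ ^+ 2 / (inner mu_ eta_ * inner nu_ eta_)).
End p1_model.

Section statistics.
Variables (R : realType) (n : nat).

Definition Jt (i j : 'I_n) : bool := i != j.
Definition A11 (A : adj n) (i j : 'I_n) : R := b2R R [&& Jt i j, A (i, j) & A (j, i)].
Definition A00 (A : adj n) (i j : 'I_n) : R :=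
  b2R R [&& Jt i j, ~~ A (i, j) & ~~ A (j, i)].
Definition A10 (A : adj n) (i j : 'I_n) : R :=
  b2R R [&& Jt i j, A (i, j) & ~~ A (j, i)].
Definition A01 (A : adj n) (i j : 'I_n) : R := A10 A j i.

Definition distinct4 (i j k l : 'I_n) : bool :=
  [&& i != j, i != k, i != l, j != k, j != l & k != l].

Definition Qa (A : adj n) : R :=
  \sum_(i : 'I_n) \sum_(j : 'I_n) \sum_(k : 'I_n) \sum_(l : 'I_n | distinct4 i j k l)
     A11 A i j * A00 A j k * A01 A k l * A00 A l i.
Definition Qb (A : adj n) : R :=
  \sum_(i : 'I_n) \sum_(j : 'I_n) \sum_(k : 'I_n) \sum_(l : 'I_n | distinct4 i j k l)
     A10 A i j * A10 A j k * A00 A k l * A10 A l i.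

Definition Ustat (rho : R) (A : adj n) : R := Qa A - expR rho * Qb A.

Definition Htrunc (x t : R) : R := if `|x| <= t then x else Num.sg x * t.

(** hat rho^* = H(log(Qa/Qb); 2 log n), with log(c/0) = +oo, log(0/c) = -oo
    for c > 0, and the (probability-vanishing) case Qa = Qb = 0 mapped to 0. *)
Definition rho_hat_star (A : adj n) : R :=
  let t := 2 * ln (n%:R : R) in
  if (Qa A == 0) && (Qb A == 0) then 0
  else if Qb A == 0 then t
  else if Qa A == 0 then - t
  else Htrunc (ln (Qa A / Qb A)) t.
End statistics.

(** convergence in law to N(0,1) of X_n (a random variable on the finite
    probability space (adj n, pmf n)): E[f(X_n)] -> E[f(Z)], Z ~ N(0,1), for
    every bounded continuous f. *)
Definition conv_law_std_normal (R : realType) (pmf : forall n, adj n -> R)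
    (X : forall n, adj n -> R) : Prop :=
  forall f : R -> R, continuous f -> (exists M : R, forall x, `|f x| <= M) ->
    (fun n => (\sum_(A : adj n) pmf n A * f (X n A))%:E) @ \oo -->
      (\int[lebesgue_measure]_x (f x * normal_pdf 0 1 x)%:E)%E.

Definition asymp_eq (R : realType) (a b : nat -> R) : Prop :=
  exists c0 c1 : R, 0 < c0 /\ c0 < c1 /\
    \forall n \near \oo, c0 <= a n / b n <= c1.

(* Main.v *)
(** Expand the indicator of every edge of a four-cycle as its mean plus a centered
    variable. Since E[Q_n(a)] = e^rho E[Q_n(b)], the constant terms of U_n(rho) cancel,
    and what is left is a linear part, namely a sum over pairs i < j of centered
    functions of the dyad (A_ij, A_ji), plus a remainder made of the products of at
    least two centered variables and of the linear terms carried by A^00. Orthogonality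
    bounds the second moment of the remainder by d * V, where d is a common bound for
    the quantities that (G1), (G2) and (SP1) make small, and V is comparable to the
    variance of the linear part. The lower bound on that variance is the delicate point:
    the coefficients of A^10 coming from Q_n(a) and Q_n(b) have opposite signs and may
    cancel at individual pairs, but not in the weighted sum of their squares.
    (SP1) makes every dyad negligible with respect to V, so that Stein's method gives
    the characteristic function of the normalized linear part. The law of U_n(rho)
    follows by Slutsky's lemma, and that of the estimator by linearizing the logarithm,
    Q_n(b) being concentrated around its mean and the truncation level being inactive. *)

Require Import Defs.
From HB Require Import structures.
From mathcomp Require Import all_boot all_order all_algebra.
From mathcomp Require Import all_classical all_reals all_analysis.
From mathcomp Require Import measurable_realfun.
From mathcomp Require Import ring lra.
Import Order.TTheory GRing.Theory Num.Theory.
Import numFieldNormedType.Exports.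
Local Open Scope classical_set_scope.
Local Open Scope ring_scope.

(** * Characteristic function criterion for convergence to the normal law *)

(** The analysis takes place at a single [n]: one number [d] bounds all that the hypotheses make
    small, errors are explicit multiples of [d], and limits are taken only at the end.
    Characteristic functions fit this scheme because the Gaussian one and that of the linear part
    both obey F' = - s F: the former exactly, by Stein's identity for the normal density, the latter
    up to a multiple of the largest dyad term. The lower bound on the variance is an exact
    computation. With the normalizing factors set to 1 and the sums unrestricted, the coefficient of
    A^10 at (i, j) is e^rho (2 m^2 - W), where m = ||eta||_1 and W = (m + X_i)(m + Y_j); it vanishes
    where W = 2 m^2. Its square is a combination of terms that factor over i and j, so its weighted
    sum has a closed form, which two Cauchy-Schwarz inequalities compare with the scale. The
    diagonal i = j carries no dyad and must be removed from that sum; (SP1) is used there too,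
    through a bound on the sum of eta_i^3. *)

Section Calculus.
Variable R : realType.

Lemma is_derive_continuous (f df : R -> R) :
  (forall z : R, is_derive z 1 f (df z)) -> continuous f.
Proof.
by move=> fd z; apply/differentiable_continuous/derivable1_diffP; have [] := fd z.
Qed.

Lemma MVT_between (f df : R -> R) (x y : R) :
  (forall z : R, is_derive z 1 f (df z)) ->
  exists2 c, `|c - x| <= `|y - x| & f y - f x = df c * (y - x).
Proof.
move=> fd; have cf := is_derive_continuous _ _ fd.
have [xy|/ltW yx] := leP x y.
  have [|c] := @MVT_segment R f df x y xy (fun z _ => fd z).
    exact: continuous_subspaceT.
  rewrite in_itv /= => /andP[xc cy] e; exists c => //.
  by rewrite !ger0_norm ?subr_ge0// lerD2r.
have [|c] := @MVT_segment R f df y x yx (fun z _ => fd z).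
  exact: continuous_subspaceT.
rewrite in_itv /= => /andP[yc cx] e; exists c.
  by rewrite !ler0_norm ?subr_le0// lerN2 lerD2r.
by rewrite -[LHS]opprB e; ring.
Qed.

Lemma norm_sinB_le (x y : R) : `|sin y - sin x| <= `|y - x|.
Proof.
have [c _ ->] := MVT_between (@sin R) (@cos R) x y (fun z => is_derive_sin z).
by rewrite normrM ler_piMl// cos_max.
Qed.

Lemma norm_cosB_le (x y : R) : `|cos y - cos x| <= `|y - x|.
Proof.
have [c _ ->] := MVT_between (@cos R) (fun z => - sin z) x y (fun z => is_derive_cos z).
by rewrite normrM ler_piMl// normrN sin_max.
Qed.

Lemma sin_taylor1 (x h : R) : `|sin (x + h) - sin x - h * cos x| <= h ^+ 2.
Proof.
have [c + e] := MVT_between (@sin R) (@cos R) x (x + h) (fun z => is_derive_sin z).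
rewrite e (addrC x h) addrK => ch.
rewrite (mulrC h) -mulrBl normrM -[h ^+ 2]real_normK ?num_real// expr2 ler_wpM2r//.
exact: le_trans (norm_cosB_le _ _) ch.
Qed.

Lemma cos_taylor1 (x h : R) : `|cos (x + h) - cos x + h * sin x| <= h ^+ 2.
Proof.
have [c + e] := MVT_between (@cos R) (fun z => - sin z) x (x + h) (fun z => is_derive_cos z).
rewrite e (addrC x h) addrK => ch.
rewrite (mulrC h) -mulrDl normrM -[h ^+ 2]real_normK ?num_real// expr2 ler_wpM2r// addrC.
by apply: le_trans ch; rewrite distrC; exact: norm_sinB_le.
Qed.

(** Differentiates a mean of cos (s X) or sin (s X) in [s] with no theorem on exchanging limits: the
    pointwise Taylor bound integrates to a remainder K h^2, where K is the second moment of X. *)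
Lemma is_derive_quadratic (F : R -> R) (s D K : R) :
  (forall h, `|F (s + h) - F s - h * D| <= K * h ^+ 2) -> is_derive s 1 F D.
Proof.
move=> FD.
have K0 : 0 <= K.
  by have := FD 1; rewrite expr1n mulr1; apply: le_trans.
have cvg : h^-1 *: (F (h *: 1 + s) - F s) @[h --> 0^'] --> D.
  apply/cvgrPdist_le => e e0.
  have d0 : 0 < e / (K + 1) by rewrite divr_gt0// ltr_wpDl.
  exists (e / (K + 1)) => //= h /=; rewrite sub0r normrN => hd h0.
  have -> : h *: 1 + s = s + h by rewrite /GRing.scale /= mulr1 addrC.
  rewrite distrC /GRing.scale /=.
  have -> : h^-1 * (F (s + h) - F s) - D = h^-1 * (F (s + h) - F s - h * D).
    by rewrite [RHS]mulrBr mulrA mulVf// mul1r.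
  rewrite normrM normfV ler_pdivrMl ?normr_gt0//.
  apply: (le_trans (FD h)); rewrite -[h ^+ 2]real_normK ?num_real// expr2 mulrCA.
  rewrite ler_wpM2l//; apply: (@le_trans _ _ ((K + 1) * (e / (K + 1)))).
    by apply: ler_pM => //; [rewrite lerDl|exact: ltW].
  by rewrite mulrCA divff ?mulr1// gt_eqF// ltr_wpDl.
apply: DeriveDef; first by apply/cvg_ex; exists D.
exact/cvg_lim.
Qed.

(* e^{s^2/2} F(s) has derivative e^{s^2/2} (D s + s F s). *)
Lemma gaussian_ode (F D : R -> R) (t K : R) :
  (forall s : R, is_derive s 1 F (D s)) ->
  (forall s, `|s| <= `|t| -> `|D s + s * F s| <= K) ->
  `|F t - F 0 * expR (- (t ^+ 2 / 2))| <= K * `|t|.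
Proof.
move=> FD DK.
pose g (s : R) := expR (s ^+ 2 / 2) * F s.
have gd (s : R) : is_derive s 1 g (expR (s ^+ 2 / 2) * (D s + s * F s)).
  have e1 : is_derive s 1 (fun s : R => s ^+ 2 / 2) s.
    apply: (@is_derive_quadratic _ _ _ 1) => h.
    have -> : (s + h) ^+ 2 / 2 - s ^+ 2 / 2 - h * s = h ^+ 2 / 2 by field.
    by rewrite ger0_norm ?divr_ge0 ?sqr_ge0//; have := sqr_ge0 h; lra.
  have e2 := @is_derive1_comp R expR (fun s : R => s ^+ 2 / 2) s _ _ (is_derive_expR _) e1.
  have e3 := is_deriveM e2 (FD s).
  apply: (is_derive_eq e3); rewrite /GRing.scale /=; ring.
have [c] := MVT_between g _ 0 t gd; rewrite !subr0 => ct.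
rewrite /g expr0n /= mul0r expR0 mul1r => e.
have ept : 0 < expR (t ^+ 2 / 2) by exact: expR_gt0.
have -> : F t - F 0 * expR (- (t ^+ 2 / 2)) =
    expR (- (t ^+ 2 / 2)) * (expR (t ^+ 2 / 2) * F t - F 0).
  by rewrite mulrBr mulrA -expRD addNr expR0 mul1r mulrC [X in _ - X]mulrC.
rewrite e normrM [`|_ * _ * t|]normrM [`|expR (c ^+ 2 / 2) * _|]normrM.
rewrite (ger0_norm (expR_ge0 _)) (ger0_norm (expR_ge0 (c ^+ 2 / 2))) !mulrA.
apply: ler_wpM2r => //; rewrite -expRD; apply: le_trans (DK c ct).
(* The mean value point satisfies |c| <= |t|, so the factor e^((c^2 - t^2) / 2) is at most 1. *)
apply: ler_piMl => //; rewrite -expR0 ler_expR addrC subr_le0 ler_pM2r ?invr_gt0//.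
by rewrite -[c ^+ 2]real_normK ?num_real// -[t ^+ 2]real_normK ?num_real// lerXn2r ?nnegrE.
Qed.

Lemma ln1D_close (y : R) : `|y| <= 2^-1 -> `|ln (1 + y) - y| <= 2 * y ^+ 2.
Proof.
rewrite ler_norml => /andP[y1 y2].
have p : 0 < 1 + y by lra.
have u := @le_ln1Dx R y _.
(* The lower bound is the upper bound ln (1 + x) <= x applied to 1 / (1 + y) = 1 - y / (1 + y). *)
have l : y / (1 + y) <= ln (1 + y).
  have := @le_ln1Dx R (- (y / (1 + y))).
  rewrite (_ : 1 + - (y / (1 + y)) = (1 + y)^-1); last by field; rewrite gt_eqF.
  rewrite lnV ?posrE// lerN2; apply; rewrite ltrN2.
  by rewrite ltr_pdivrMr// mul1r; lra.
have e : y / (1 + y) = y - y ^+ 2 / (1 + y) by field; rewrite gt_eqF.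
have q : y ^+ 2 / (1 + y) <= 2 * y ^+ 2.
  rewrite ler_pdivrMr//; have := sqr_ge0 y; nra.
have s := sqr_ge0 y.
rewrite ler_norml; apply/andP; split; first by move: l; rewrite e; lra.
by have := u ltac:(lra); lra.
Qed.

(** Chebyshev's inequality before taking expectations. *)
Lemma b2R_lt_norm (x e : R) : 0 < e -> b2R R (e < `|x|) <= x ^+ 2 / e ^+ 2.
Proof.
move=> e0; rewrite /b2R; case: ifPn => [h|_].
  rewrite ler_pdivlMr ?exprn_gt0// mul1r -[X in _ <= X]real_normK ?num_real//.
  by rewrite lerXn2r ?nnegrE// ltW.
by apply: divr_ge0; exact: sqr_ge0.
Qed.

End Calculus.

(** * Integration against the standard normal density and Stein's identity *)

Section Gaussian.
Variable R : realType.
Local Notation leb := (@lebesgue_measure R).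
Local Notation phi := (@normal_pdf R 0 1).

Lemma phiE x : phi x = normal_peak 1 * expR (- (x ^+ 2 / 2)).
Proof.
by rewrite normal_pdfE// /normal_fun subr0 mulNr expr1n.
Qed.

Lemma phi_ge0 x : 0 <= phi x. Proof. exact: normal_pdf_ge0. Qed.

(** Integrability is borrowed from the normal density of standard deviation 2: e^(-x^2/2) =
    e^(-x^2/8) e^(-3x^2/8), and 1 + x^2 <= (8/3) e^(3x^2/8) because e^y >= 1 + y. *)
Lemma phi_tail : exists2 B : R, 0 <= B &
  forall x, (1 + x ^+ 2) * phi x <= B * normal_pdf 0 2 x.
Proof.
have n2 : (2 : R) != 0 by [].
have p2 := normal_peak_gt0 n2.
have p1 : 0 < @normal_peak R 1 by exact: normal_peak_gt0.
exists (8 / 3 * normal_peak 1 / normal_peak 2).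
  by rewrite divr_ge0 ?mulr_ge0// ltW.
move=> x; rewrite phiE normal_pdfE// /normal_fun subr0.
rewrite [X in _ <= X](_ : _ = normal_peak 1 * (8 / 3 * expR (- x ^+ 2 / (2 ^+ 2 *+ 2)))); last first.
  by field; rewrite gt_eqF.
rewrite mulrCA; apply: ler_wpM2l; first exact: ltW.
have e8 : - x ^+ 2 / (2 ^+ 2 *+ 2) = - (x ^+ 2 / 2) + 3 / 8 * x ^+ 2 by field.
rewrite e8 expRD mulrCA mulrC; apply: ler_wpM2l; first exact: expR_ge0.
have := expR_ge1Dx (3 / 8 * x ^+ 2); have := sqr_ge0 x; lra.
Qed.

Lemma integrable_phi (h : R -> R) (A : R) : measurable_fun setT h ->
  (forall x, `|h x| <= A * (1 + x ^+ 2)) ->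
  leb.-integrable setT (EFin \o (fun x => h x * phi x)).
Proof.
move=> mh hA; have [B B0 hB] := phi_tail.
have A0 : 0 <= A by have := hA 0; rewrite expr0n addr0 mulr1; apply: le_trans.
have i2 : leb.-integrable setT (EFin \o (fun x => A * B * normal_pdf 0 2 x)).
  have := @integrableZl _ _ R leb setT measurableT (A * B) _ (integrable_normal_pdf 0 2).
  by apply: eq_integrable => // x _; rewrite /= EFinM.
apply: le_integrable i2 => //.
  apply/measurable_EFinP; apply: measurable_funM => //; exact: measurable_normal_pdf.
move=> x _ /=; rewrite lee_fin normrM (ger0_norm (phi_ge0 x)).
rewrite [X in _ <= X]ger0_norm ?mulr_ge0 ?normal_pdf_ge0//.
apply: (@le_trans _ _ (A * (1 + x ^+ 2) * phi x)).
  by apply: ler_wpM2r; [exact: phi_ge0|exact: hA].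
by rewrite -!mulrA; apply: ler_wpM2l.
Qed.

Definition gint (h : R -> R) : R := (\int[leb]_x (h x * phi x))%R.

(** Wide enough for the x^2 of the Taylor remainders and the x g(x) of Stein's identity; on this
    class [gint] is linear and monotone. *)
Definition quad_growth (h : R -> R) := measurable_fun setT h /\
  exists A : R, forall x, `|h x| <= A * (1 + x ^+ 2).

Lemma quad_integrable h : quad_growth h ->
  leb.-integrable setT (EFin \o (fun x => h x * phi x)).
Proof. by move=> [mh [A hA]]; exact: integrable_phi hA. Qed.

Lemma quad_growth_bounded (h : R -> R) (A : R) : measurable_fun setT h ->
  (forall x, `|h x| <= A) -> quad_growth h.
Proof.
move=> mh hA; split => //; exists A => x; apply: (le_trans (hA x)).
have A0 : 0 <= A by apply: le_trans (hA 0).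
by rewrite ler_peMr// lerDl sqr_ge0.
Qed.

Lemma quad_growthD (f g : R -> R) : quad_growth f -> quad_growth g ->
  quad_growth (fun x => f x + g x).
Proof.
move=> [mf [A fA]] [mg [B gB]]; split; first exact: measurable_funD.
exists (A + B) => x; rewrite mulrDl; apply: (le_trans (ler_normD _ _)).
exact: lerD.
Qed.

Lemma quad_growthZ (c : R) (f : R -> R) : quad_growth f -> quad_growth (fun x => c * f x).
Proof.
move=> [mf [A fA]]; split; first exact: measurable_funM.
exists (`|c| * A) => x; rewrite normrM -mulrA; exact: ler_wpM2l.
Qed.

Lemma gintD (f g : R -> R) : quad_growth f -> quad_growth g ->
  gint (fun x => f x + g x) = gint f + gint g.
Proof.
move=> qf qg; rewrite /gint -RintegralD//; [|exact: quad_integrable..].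
by apply: eq_Rintegral => x _; rewrite mulrDl.
Qed.

Lemma gintZ (c : R) (f : R -> R) : quad_growth f -> gint (fun x => c * f x) = c * gint f.
Proof.
move=> qf; rewrite /gint -RintegralZl//; last exact: quad_integrable.
by apply: eq_Rintegral => x _; rewrite mulrA.
Qed.

Lemma gint_le (f g : R -> R) : quad_growth f -> quad_growth g -> (forall x, f x <= g x) ->
  gint f <= gint g.
Proof.
move=> qf qg fg; apply: le_Rintegral => //; [exact: quad_integrable..|].
by move=> x _; apply: ler_wpM2r; [exact: phi_ge0|exact: fg].
Qed.

Lemma gint1 : gint (fun=> 1) = 1.
Proof.
rewrite /gint /Rintegral; under eq_integral do rewrite mul1r.
by rewrite integral_normal_pdf.
Qed.

Lemma gintN (f : R -> R) : quad_growth f -> gint (fun x => - f x) = - gint f.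
Proof.
move=> qf; rewrite -mulN1r -gintZ//; congr gint; apply/funext => x.
by rewrite mulN1r.
Qed.

Lemma quad_growthN (f : R -> R) : quad_growth f -> quad_growth (fun x => - f x).
Proof.
move=> qf; rewrite (_ : (fun x => - f x) = (fun x => -1 * f x)); first exact: quad_growthZ.
by apply/funext => x; rewrite mulN1r.
Qed.

Lemma gint_norm_le (f g : R -> R) : quad_growth f -> quad_growth g -> (forall x, `|f x| <= g x) ->
  `|gint f| <= gint g.
Proof.
move=> qf qg fg; rewrite ler_norml -gintN//; apply/andP; split.
  apply: gint_le => //; first exact: quad_growthN.
  by move=> x; have := fg x; rewrite ler_norml => /andP[].
by apply: gint_le => // x; apply: le_trans (fg x); exact: ler_norm.
Qed.

Lemma is_derive_phi (x : R) : is_derive x 1 phi (- (x * phi x)).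
Proof.
have e1 : is_derive x 1 (fun s : R => - (s ^+ 2 / 2)) (- x).
  apply: (@is_derive_quadratic _ _ _ _ 1) => h.
  have -> : - ((x + h) ^+ 2 / 2) - - (x ^+ 2 / 2) - h * - x = - (h ^+ 2 / 2) by field.
  by rewrite normrN ger0_norm ?divr_ge0 ?sqr_ge0//; have := sqr_ge0 h; lra.
have e2 := @is_derive1_comp R expR _ x _ _ (is_derive_expR _) e1.
have e3 := is_deriveM (is_derive_cst (normal_peak 1) x 1) e2.
rewrite (_ : phi = cst (normal_peak 1) \* (expR \o (fun s => - (s ^+ 2 / 2)))); last first.
  by apply/funext => y; rewrite /= phiE.
by apply: (is_derive_eq e3); rewrite /GRing.scale /=; ring.
Qed.

Lemma cvg_itv_integral (h : R -> R) : leb.-integrable setT (EFin \o h) ->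
  (\int[leb]_(x in `[(- n%:R)%R, n%:R%R]) (h x)%:E)%E @[n --> \oo] --> (\int[leb]_x (h x)%:E)%E.
Proof.
move=> ih.
have mh : measurable_fun setT (EFin \o h) by have /integrableP[] := ih.
pose f_ (n : nat) (x : R) : \bar R := ((EFin \o h) \_ `[(- n%:R : R), n%:R]) x.
have mf_ n : measurable_fun setT (f_ n).
  by apply/(measurable_restrictT _ _).1 => //; exact: measurable_funTS.
have f_h x : f_ ^~ x @ \oo --> (EFin \o h) x.
  apply: cvg_near_cst; near=> n; rewrite /f_ patchE ifT// inE /= in_itv /=.
  rewrite -ler_norml; near: n; exact: nbhs_infty_ger.
have f_g x n : (`|f_ n x| <= (abse \o (EFin \o h)) x)%E.
  by rewrite /f_ patchE; case: ifPn => //= _; rewrite normr0 lee_fin.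
have [| | |_ _] := @dominated_convergence _ _ _ leb setT measurableT f_ (EFin \o h)
   (abse \o (EFin \o h)) mf_ mh.
- by apply: aeW => x _; exact: f_h.
- exact: integrable_abse.
- by apply: aeW => x n _; exact: f_g.
by under eq_fun do rewrite /f_ -integral_mkcond.
Unshelve. all: by end_near. Qed.

Lemma cvg_phi_0 : phi n%:R @[n --> \oo] --> (0 : R).
Proof.
have p1 : 0 < @normal_peak R 1 by exact: normal_peak_gt0.
apply/cvgrPdist_le => e e0; near=> n; rewrite sub0r normrN ger0_norm ?phi_ge0//.
have n2 : normal_peak 1 / e <= n%:R :> R by near: n; exact: nbhs_infty_ger.
have n1 : 2 <= n%:R :> R by near: n; exact: nbhs_infty_ger.
rewrite phiE expRN ler_pdivrMr ?expR_gt0//.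
have h := expR_ge1Dx (n%:R ^+ 2 / 2 : R).
rewrite ler_pdivrMr// in n2.
have : e * (1 + n%:R ^+ 2 / 2) <= e * expR (n%:R ^+ 2 / 2) by rewrite ler_pM2l.
have : 2 * n%:R <= n%:R ^+ 2 :> R by rewrite expr2 ler_wpM2r.
move: n2; rewrite mulrC; nra.
Unshelve. all: by end_near. Qed.

(** (g' - x g) phi is the derivative of g phi. Its integral over [-n, n] is a boundary term, which
    tends to 0 because g is bounded and phi vanishes at infinity. *)
Lemma gaussian_stein (g g' : R -> R) (A : R) :
  (forall x : R, is_derive x 1 g (g' x)) -> continuous g' ->
  (forall x, `|g x| <= A) -> (forall x, `|g' x| <= A) ->
  gint (fun x => x * g x) = gint g'.
Proof.
move=> gd cg' gA g'A.
have cg := is_derive_continuous _ _ _ gd.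
have mg : measurable_fun setT g by exact: continuous_measurable_fun.
have mg' : measurable_fun setT g' by exact: continuous_measurable_fun.
have A0 : 0 <= A by apply: le_trans (gA 0).
have q1 : quad_growth (fun x => x * g x).
  split; first exact: measurable_funM.
  exists A => x; rewrite normrM mulrC; apply: ler_pM => //.
  rewrite -[x ^+ 2]real_normK ?num_real//.
  by have := sqr_ge0 (`|x| - 1); have := sqr_ge0 `|x|; lra.
have q2 : quad_growth g' by exact: quad_growth_bounded g'A.
apply/eqP; rewrite -subr_eq0 -opprB oppr_eq0 -gintN// -gintD//; last exact: quad_growthN.
apply/eqP.
pose h x := (g' x - x * g x) * phi x.
have ih : leb.-integrable setT (EFin \o h).
  by apply: quad_integrable; apply: quad_growthD => //; exact: quad_growthN.
have dF (x : R) : is_derive x 1 (fun x => g x * phi x) (h x).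
  have e := is_deriveM (gd x) (is_derive_phi x).
  by apply: (is_derive_eq e); rewrite /h /GRing.scale /=; ring.
have ch : continuous h.
  move=> x; apply: cvgM; last exact: continuous_normal_pdf.
  by apply: cvgB; [exact: cg'|apply: cvgM; [exact: cvg_id|exact: cg]].
have FTC n : (0 < n)%N -> (\int[leb]_(x in `[(- n%:R)%R, n%:R%R]) (h x)%:E)%E =
    (g n%:R * phi n%:R - g (- n%:R) * phi (- n%:R))%:E.
  move=> n0; rewrite (@continuous_FTC2 _ h (fun x => g x * phi x))//.
  - by rewrite gtrN// ltr0n.
  - exact: continuous_subspaceT.
  - have cF := is_derive_continuous _ _ _ dF.
    split.
    + by move=> x _; have [] := dF x.
    + by apply: cvg_at_right_filter; exact: cF.
    + by apply: cvg_at_left_filter; exact: cF.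
  - by move=> x _; rewrite derive1E; have [_ ->] := dF x.
have lim0 : (\int[leb]_(x in `[(- n%:R)%R, n%:R%R]) (h x)%:E)%E @[n --> \oo] --> (0%:E : \bar R).
  apply: (@cvg_trans _ ((g n%:R * phi n%:R - g (- n%:R) * phi (- n%:R))%:E @[n --> \oo])).
    apply: near_eq_cvg; near=> n; rewrite FTC//; near: n; exact: nbhs_infty_gt.
  apply: cvg_EFin; first exact: nearW.
  apply/cvgrPdist_le => e e0.
  have := cvg_phi_0 => /cvgrPdist_le /(_ (e / (2 * A + 1))) [|N _ hN].
    by rewrite divr_gt0// ltr_wpDl// mulr_ge0.
  exists N => // n /hN /=; rewrite !sub0r !normrN (ger0_norm (phi_ge0 _)).
  rewrite ler_pdivlMr ?ltr_wpDl ?mulr_ge0// => hn.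
  have pe : phi (- n%:R) = phi n%:R by rewrite !phiE sqrrN.
  rewrite pe; apply: (le_trans (ler_normB _ _)); rewrite !normrM (ger0_norm (phi_ge0 _)).
  have p0 := phi_ge0 (n%:R : R).
  have := ler_wpM2r p0 (gA n%:R); have := ler_wpM2r p0 (gA (- n%:R)); lra.
have := cvg_unique _ (cvg_itv_integral h ih) lim0 => /= h0.
by rewrite /gint /Rintegral -/h h0.
Unshelve. all: by end_near. Qed.

End Gaussian.

(** * The characteristic function of the standard normal law *)

Section GaussianCF.
Variable R : realType.

Lemma is_derive_sinM (s x : R) : is_derive x 1 (fun x => sin (s * x)) (s * cos (s * x)).
Proof.
apply: (@is_derive_quadratic _ _ _ _ (s ^+ 2)) => h.
have := sin_taylor1 R (s * x) (s * h).
by rewrite -mulrDr exprMn [s * h]mulrC -mulrA.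
Qed.

Lemma is_derive_cosM (s x : R) : is_derive x 1 (fun x => cos (s * x)) (- (s * sin (s * x))).
Proof.
apply: (@is_derive_quadratic _ _ _ _ (s ^+ 2)) => h.
have := cos_taylor1 R (s * x) (s * h).
by rewrite -mulrDr exprMn mulrN opprK [s * h]mulrC -mulrA.
Qed.

Lemma continuous_cosM (s : R) : continuous (fun x : R => cos (s * x)).
Proof. exact: is_derive_continuous (is_derive_cosM s). Qed.

Lemma continuous_sinM (s : R) : continuous (fun x : R => sin (s * x)).
Proof. exact: is_derive_continuous (is_derive_sinM s). Qed.

Lemma quad_cosM (s : R) : quad_growth R (fun x => cos (s * x)).
Proof.
apply: (quad_growth_bounded _ _ 1); last by move=> x; exact: cos_max.
exact: continuous_measurable_fun (continuous_cosM s).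
Qed.

Lemma quad_sinM (s : R) : quad_growth R (fun x => sin (s * x)).
Proof.
apply: (quad_growth_bounded _ _ 1); last by move=> x; exact: sin_max.
exact: continuous_measurable_fun (continuous_sinM s).
Qed.

Lemma quad_sqr : quad_growth R (fun x => x ^+ 2).
Proof.
split; first exact: measurable_funX.
by exists 1 => x; rewrite mul1r ger0_norm ?sqr_ge0// lerDr.
Qed.

Lemma quad_mulX (h : R -> R) : measurable_fun setT h -> (forall x, `|h x| <= 1) ->
  quad_growth R (fun x => x * h x).
Proof.
move=> mh h1; split; first exact: measurable_funM.
exists 1 => x; rewrite mul1r normrM mulrC; apply: (@le_trans _ _ (1 * `|x|)).
  exact: ler_wpM2r.
rewrite mul1r -[x ^+ 2]real_normK ?num_real//.
by have := sqr_ge0 (`|x| - 1); have := sqr_ge0 `|x|; lra.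
Qed.

(** The derivative in s is minus the integral of x sin (s x), which Stein's identity turns into - s
    F(s); [gaussian_ode] then applies with error K = 0. *)
Lemma gint_cos (t : R) : gint R (fun x => cos (t * x)) = expR (- (t ^+ 2 / 2)).
Proof.
pose F s := gint R (fun x => cos (s * x)).
have qxs s : quad_growth R (fun x => x * sin (s * x)).
  apply: quad_mulX; last by move=> x; exact: sin_max.
  exact: continuous_measurable_fun (continuous_sinM s).
pose D s := - gint R (fun x => x * sin (s * x)).
have FD (s : R) : is_derive s 1 F (D s).
  apply: (@is_derive_quadratic _ _ _ _ (gint R (fun x => x ^+ 2))) => h.
  rewrite /F /D mulrN opprK -gintZ// -gintN//; last exact: quad_cosM.
  rewrite -gintD; [|exact: quad_cosM|exact/quad_growthN/quad_cosM].
  rewrite -gintD; last exact: quad_growthZ.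
    rewrite mulrC -gintZ; last exact: quad_sqr.
    apply: gint_norm_le.
    + apply: quad_growthD; last exact: quad_growthZ.
      by apply: quad_growthD; [exact: quad_cosM|exact/quad_growthN/quad_cosM].
    + exact/quad_growthZ/quad_sqr.
    + move=> x; have := cos_taylor1 R (s * x) (h * x).
      by rewrite -mulrDl exprMn mulrA.
  by apply: quad_growthD; [exact: quad_cosM|exact/quad_growthN/quad_cosM].
have DF s : D s + s * F s = 0.
  have -> : D s = - gint R (fun x => s * cos (s * x)).
    congr (- _); apply: (gaussian_stein R (fun x => sin (s * x)) _ (1 + `|s|)).
    - exact: is_derive_sinM.
    - by move=> x; apply: cvgM; [exact: cvg_cst|exact: continuous_cosM].
    - by move=> x; apply: (le_trans (sin_max _)); rewrite lerDl.
    - move=> x; rewrite normrM; apply: (@le_trans _ _ `|s|); last by rewrite lerDr.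
      by rewrite ler_piMr// cos_max.
  by rewrite gintZ ?addNr//; exact: quad_cosM.
have := gaussian_ode R F D t 0 FD.
rewrite mul0r (_ : F 0 = 1); last first.
  by rewrite /F -[RHS](gint1 R); congr gint; apply/funext => x; rewrite mul0r cos0.
rewrite mul1r => h; apply/eqP; rewrite -subr_eq0 -normr_le0; apply: h => s _.
by rewrite DF normr0.
Qed.

Lemma gint_sin (t : R) : gint R (fun x => sin (t * x)) = 0.
Proof.
pose F s := gint R (fun x => sin (s * x)).
have qxc s : quad_growth R (fun x => x * cos (s * x)).
  apply: quad_mulX; last by move=> x; exact: cos_max.
  exact: continuous_measurable_fun (continuous_cosM s).
pose D s := gint R (fun x => x * cos (s * x)).
have FD (s : R) : is_derive s 1 F (D s).
  apply: (@is_derive_quadratic _ _ _ _ (gint R (fun x => x ^+ 2))) => h.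
  rewrite /F /D -gintZ// -!gintN//; try exact: quad_sinM; try exact: quad_growthZ.
  rewrite -gintD; [|exact: quad_sinM|exact/quad_growthN/quad_sinM].
  rewrite -gintD; last exact/quad_growthN/quad_growthZ.
    rewrite mulrC -gintZ; last exact: quad_sqr.
    apply: gint_norm_le.
    + apply: quad_growthD; last exact/quad_growthN/quad_growthZ.
      by apply: quad_growthD; [exact: quad_sinM|exact/quad_growthN/quad_sinM].
    + exact/quad_growthZ/quad_sqr.
    + move=> x; have := sin_taylor1 R (s * x) (h * x).
      by rewrite -mulrDl exprMn mulrA.
  by apply: quad_growthD; [exact: quad_sinM|exact/quad_growthN/quad_sinM].
have DF s : D s + s * F s = 0.
  have -> : D s = gint R (fun x => - (s * sin (s * x))).
    apply: (gaussian_stein R (fun x => cos (s * x)) _ (1 + `|s|)).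
    - exact: is_derive_cosM.
    - by move=> x; apply: cvgN; apply: cvgM; [exact: cvg_cst|exact: continuous_sinM].
    - by move=> x; apply: (le_trans (cos_max _)); rewrite lerDl.
    - move=> x; rewrite normrN normrM; apply: (@le_trans _ _ `|s|); last by rewrite lerDr.
      by rewrite ler_piMr// sin_max.
  rewrite gintN; last exact/quad_growthZ/quad_sinM.
  by rewrite gintZ ?addNr//; exact: quad_sinM.
have := gaussian_ode R F D t 0 FD.
rewrite mul0r (_ : F 0 = 0); last first.
  rewrite /F (_ : (fun x => sin (0 * x)) = (fun x => 0 * sin (0 * x))).
    by rewrite gintZ ?mul0r//; exact: quad_sinM.
  by apply/funext => x; rewrite !mul0r sin0.
rewrite mul0r subr0 => h; apply/eqP; rewrite -normr_le0; apply: h => s _.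
by rewrite DF normr0.
Qed.

End GaussianCF.

(** * Approximation of bounded continuous functions by trigonometric polynomials *)

Section TrigApprox.
Variable R : realType.

(** The phase [b] accounts for sines. Frequencies are arbitrary reals, so products stay in the class
    by the product-to-sum formula, and the expectation of a member is a combination of values of the
    characteristic function. *)
Inductive trigpoly : (R -> R) -> Prop :=
| trigpoly_cos a t b : trigpoly (fun x => a * cos (t * x + b))
| trigpolyD f g : trigpoly f -> trigpoly g -> trigpoly (fun x => f x + g x).

Lemma trigpolyM f g : trigpoly f -> trigpoly g -> trigpoly (fun x => f x * g x).
Proof.
elim=> {f} [a t b|f1 f2 _ I1 _ I2] tg.
  elim: tg => {g} [a' t' b'|g1 g2 _ I1 _ I2].
    rewrite (_ : (fun x => _) = (fun x => a * a' / 2 * cos ((t + t') * x + (b + b'))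
       + a * a' / 2 * cos ((t - t') * x + (b - b')))).
      by apply: trigpolyD; exact: trigpoly_cos.
    apply/funext => x.
    have -> : (t + t') * x + (b + b') = (t * x + b) + (t' * x + b') by ring.
    have -> : (t - t') * x + (b - b') = (t * x + b) - (t' * x + b') by ring.
    by rewrite (cosD (t * x + b)) (cosB (t * x + b)); field.
  rewrite (_ : (fun x => _) = (fun x => a * cos (t * x + b) * g1 x + a * cos (t * x + b) * g2 x)).
    exact: trigpolyD.
  by apply/funext => x; rewrite mulrDr.
rewrite (_ : (fun x => _) = (fun x => f1 x * g x + f2 x * g x)).
  by apply: trigpolyD; [exact: I1|exact: I2].
by apply/funext => x; rewrite mulrDl.
Qed.

Lemma trigpoly_cst a : trigpoly (fun=> a).
Proof.
rewrite (_ : (fun=> a) = (fun x => a * cos (0 * x + 0))); first exact: trigpoly_cos.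
by apply/funext => x; rewrite mul0r addr0 cos0 mulr1.
Qed.

Lemma trigpoly_sinM t : trigpoly (fun x => sin (t * x)).
Proof.
rewrite (_ : (fun x => _) = (fun x => 1 * cos (t * x + - (pi / 2)))); first exact: trigpoly_cos.
by apply/funext => x; rewrite mul1r cosBpihalf.
Qed.

(* The Bernstein polynomial: expectation of [g] under Binomial(n, x). *)
Fixpoint bern (n : nat) (g : nat -> R) (x : R) : R :=
  if n is n'.+1 then x * bern n' (fun k => g k.+1) x + (1 - x) * bern n' g x else g 0.

Lemma bernD n g h x : bern n (fun k => g k + h k) x = bern n g x + bern n h x.
Proof. by elim: n g h => [//|n IH] g h /=; rewrite !IH; ring. Qed.

Lemma bernZ n c g x : bern n (fun k => c * g k) x = c * bern n g x.
Proof. by elim: n g => [//|n IH] g /=; rewrite !IH; ring. Qed.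

Lemma bern_cst n c x : bern n (fun=> c) x = c.
Proof. by elim: n => [//|n /= ->]; ring. Qed.

Lemma bern_le n g h x : 0 <= x <= 1 -> (forall k, (k <= n)%N -> g k <= h k) ->
  bern n g x <= bern n h x.
Proof.
move=> /andP[x0 x1]; elim: n g h => [|n IH] g h gh /=; first exact: gh.
apply: lerD; (apply: ler_wpM2l; [lra|apply: IH => k kn; apply: gh]) => //.
exact: leq_trans kn _.
Qed.

Lemma bern_id n x : bern n (fun k => k%:R) x = n%:R * x.
Proof.
elim: n => [|n /= IH]; first by rewrite /= mul0r.
rewrite (_ : (fun k => k.+1%:R) = (fun k => k%:R + 1)); last first.
  by apply/funext => k; rewrite -natr1.
by rewrite bernD bern_cst IH -natr1; ring.
Qed.

Lemma bern_sqr n x : bern n (fun k => k%:R ^+ 2) x = n%:R * x * (1 - x) + (n%:R * x) ^+ 2.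
Proof.
elim: n => [|n /= IH]; first by rewrite /= !mul0r expr0n addr0.
rewrite (_ : (fun k => k.+1%:R ^+ 2) = (fun k => (k%:R ^+ 2 + 2 * k%:R) + 1)); last first.
  by apply/funext => k; rewrite -natr1; ring.
by rewrite !bernD bern_cst bernZ bern_id IH -natr1; ring.
Qed.

(** The binomial variance, on which Bernstein's proof of the Weierstrass theorem rests. *)
Lemma bern_var n x : bern n (fun k => (k%:R - n%:R * x) ^+ 2) x = n%:R * x * (1 - x).
Proof.
rewrite (_ : (fun k => _) = (fun k => (k%:R ^+ 2 + (- 2 * (n%:R * x)) * k%:R) + (n%:R * x) ^+ 2)).
  by rewrite !bernD bern_cst bernZ bern_id bern_sqr; ring.
by apply/funext => k; ring.
Qed.

Lemma trigpoly_bern n g u : trigpoly u -> trigpoly (fun x => bern n g (u x)).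
Proof.
move=> tu; elim: n g => [|n IH] g /=; first exact: trigpoly_cst.
apply: trigpolyD; first exact: trigpolyM.
apply: trigpolyM => //; apply: trigpolyD; first exact: trigpoly_cst.
rewrite (_ : (fun x => _) = (fun x => -1 * u x)); last by apply/funext => x; rewrite mulN1r.
by apply: trigpolyM => //; exact: trigpoly_cst.
Qed.

(** Only [x] is confined to the segment: in [slutsky] the perturbed variable may leave it. *)
Lemma unif_continuous_segment (F : R -> R) (a b e : R) : continuous F -> 0 < e ->
  exists2 d, 0 < d & forall x y, a <= x <= b -> `|x - y| <= d -> `|F x - F y| <= e.
Proof.
move=> cF e0.
have /compact_near_coveringP := @segment_compact R a b.
move=> /(_ R (0 : R)^'+ (fun d x => forall y, `|x - y| <= d -> `|F x - F y| <= e)) [].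
  move=> x _.
  have /cvgrPdist_le /(_ (e / 2)) := cF x.
  move=> [|d /= d0 hd]; first by rewrite divr_gt0.
  exists ([set x' | `|x - x'| < d / 2], [set d' | d' < d / 2]).
    split => /=; first by exists (d / 2) => //=; rewrite divr_gt0.
    by apply: nbhs_right_lt; rewrite divr_gt0.
  move=> [x' d'] [/= hx' hd'] y hy.
  have h1 : `|F x - F x'| <= e / 2 by apply: hd => /=; apply: lt_trans hx' _; lra.
  have h2 : `|F x - F y| <= e / 2.
    apply: hd => /=; rewrite (_ : x - y = (x - x') + (x' - y)); last by ring.
    by apply: le_lt_trans (ler_normD _ _) _; lra.
  rewrite (_ : F x' - F y = - (F x - F x') + (F x - F y)); last by ring.
  by apply: le_trans (ler_normD _ _) _; rewrite normrN; lra.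
move=> d /= d0 hd; exists (d / 2); first by rewrite divr_gt0.
move=> x y xab; apply: (hd (d / 2)) => //=.
- by rewrite sub0r normrN gtr0_norm ?divr_gt0//; lra.
- by rewrite divr_gt0.
Qed.

(** On [-T, T] the function f factors as F(u) with u = (1 + sin (x / 2T)) / 2 in [0, 1], and a
    Bernstein polynomial of F composed with u is a trigonometric polynomial. Being an average of
    values of F, it keeps the bound M on the whole line. *)
Lemma trig_approx (f : R -> R) (M T e : R) : continuous f -> (forall x, `|f x| <= M) ->
  0 < T -> 0 < e ->
  exists p, [/\ trigpoly p, forall x, `|p x| <= M & forall x, `|x| <= T -> `|f x - p x| <= e].
Proof.
move=> cf fM T0 e0.
have M0 : 0 <= M by apply: le_trans (fM 0).
pose c : R := sin (1 / 2).
have pi2 : 1 <= pi / 2 :> R by exact: pihalf_ge1.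
have half_in (y : R) : `|y| <= 1 / 2 -> y \in `[(- (pi / 2)), pi / 2].
  by rewrite ler_norml in_itv /= => /andP[y1 y2]; apply/andP; split; lra.
have sin_le (y : R) : `|y| <= 1 / 2 -> `|sin y| <= c.
  move=> hy; have h1 : 1 / 2 \in `[(- (pi / 2)), (pi / 2 : R)].
    by apply: half_in; rewrite ger0_norm.
  have h2 : - (1 / 2) \in `[(- (pi / 2)), (pi / 2 : R)].
    by apply: half_in; rewrite normrN ger0_norm.
  move: (hy); rewrite !ler_norml /c -sinN => /andP[y1 y2].
  by apply/andP; split; rewrite leNgt ltr_sin ?(half_in _ hy)// -leNgt.
have c1 : c < 1.
  have h1 : 1 / 2 \in `[(- (pi / 2)), (pi / 2 : R)] by apply: half_in; rewrite ger0_norm.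
  have h2 : pi / 2 \in `[(- (pi / 2)), (pi / 2 : R)] by rewrite in_itv /= lexx andbT; lra.
  by rewrite /c -[X in _ < X]sin_pihalf ltr_sin//; lra.
have c0 : 0 < c by apply: sin_gt0_pihalf; apply/andP; split; lra.
(* Clamping keeps the argument of [asin] within [-c, c] with c < 1, where [asin] is continuous; for
   |x| <= T the sine stays in that range and the clamp is inactive. *)
pose cl (v : R) := Num.max (- c) (Num.min c (2 * v - 1)).
have cl_in v : - c <= cl v <= c.
  by rewrite /cl le_max lexx /= ge_max ge_min lexx /=; lra.
pose F v := f (2 * T * asin (cl v)).
have ccl : continuous cl.
  move=> v; apply: (@continuous_max R R (cst (- c)) (cst c \min (fun v => 2 * v - 1))).
    exact: cvg_cst.
  apply: (@continuous_min R R (cst c) (fun v => 2 * v - 1)); first exact: cvg_cst.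
  by apply: cvgB; [apply: cvgM; [exact: cvg_cst|exact: cvg_id]|exact: cvg_cst].
have cF : continuous F.
  move=> v; apply: (@continuous_comp _ _ _ (fun v => 2 * T * asin (cl v)) f); last exact: cf.
  apply: cvgM; first exact: cvg_cst.
  apply: (@continuous_comp _ _ _ cl (@asin R)); first exact: ccl.
  by apply: continuous_asin; have := cl_in v; lra.
have e2 : 0 < e / 2 by rewrite divr_gt0.
have [d d0 hd] := unif_continuous_segment F 0 1 (e / 2) cF e2.
(* The binomial variance is at most n / 4, so the Chebyshev part of the error is at most 2 M (n / 4)
   / (d n)^2 = M / (2 n d^2). *)
pose n := (Num.truncn (4 * M / (e * d ^+ 2))).+1.
have nM : M / (2 * n%:R * d ^+ 2) <= e / 2.
  have n0 : 0 < n%:R :> R by rewrite ltr0n.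
  have hn : 4 * M / (e * d ^+ 2) <= n%:R by exact/ltW/truncnS_gt.
  rewrite ler_pdivrMr ?mulr_gt0 ?exprn_gt0// in hn *.
  move: hn; rewrite ler_pdivrMr ?mulr_gt0 ?exprn_gt0//; nra.
pose u x := (1 + sin (x / (2 * T))) / 2.
have u01 x : 0 <= u x <= 1.
  have := sin_max (x / (2 * T)); rewrite ler_norml /u => /andP[h1 h2].
  by apply/andP; split; lra.
pose g k := F (k%:R / n%:R).
exists (fun x => bern n g (u x)); split.
- apply: trigpoly_bern.
  rewrite (_ : u = (fun x => 1 / 2 + 1 / 2 * sin (1 / (2 * T) * x))).
    apply: trigpolyD; first exact: trigpoly_cst.
    by apply: trigpolyM; [exact: trigpoly_cst|exact: trigpoly_sinM].
  by apply/funext => x; rewrite /u [1 / (2 * T) * x]mulrC mulrA mulr1; field.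
- move=> x; rewrite ler_norml -{1}(bern_cst n (- M) (u x)) -{2}(bern_cst n M (u x)).
  by apply/andP; split; apply: bern_le => // k _; have := fM (2 * T * asin (cl (k%:R / n%:R)));
    rewrite ler_norml /g /F => /andP[].
- move=> x xT.
  have n0 : 0 < n%:R :> R by rewrite ltr0n.
  have x2 : `|x / (2 * T)| <= 1 / 2.
    rewrite normrM normfV (gtr0_norm (mulr_gt0 _ T0))// ler_pdivrMr ?mulr_gt0//; lra.
  have fE : f x = F (u x).
    rewrite /F /cl /u; have := sin_le _ x2; rewrite ler_norml => /andP[s1 s2].
    rewrite (_ : 2 * (_ / 2) - 1 = sin (x / (2 * T))); last by field.
    rewrite (min_idPr _)// (max_idPr _)// sinK ?half_in//.
    by rewrite mulrC divfK// gt_eqF// mulr_gt0.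
  rewrite fE -{1}(bern_cst n (F (u x)) (u x)).
  rewrite (_ : _ - _ = bern n (fun k => F (u x) + -1 * g k) (u x)); last first.
    by rewrite bernD bernZ mulN1r.
  have [ux0 ux1] := andP (u01 x).
  (* Nodes within d of u x fall under uniform continuity; for the others the difference is at most 2
     M, and the squared distance divided by d^2 exceeds 1. *)
  have ub k : (k <= n)%N -> `|F (u x) + -1 * g k| <=
      e / 2 + 2 * M / (d ^+ 2 * n%:R ^+ 2) * (k%:R - n%:R * u x) ^+ 2.
    move=> kn; rewrite mulN1r /g.
    have dist2 : (k%:R - n%:R * u x) ^+ 2 = n%:R ^+ 2 * (u x - k%:R / n%:R) ^+ 2.
      by field; rewrite gt_eqF.
    rewrite dist2 (_ : _ * (n%:R ^+ 2 * _) = 2 * M * ((u x - k%:R / n%:R) ^+ 2 / d ^+ 2)); last first.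
      by field; rewrite !gt_eqF.
    have q0 : 0 <= (u x - k%:R / n%:R) ^+ 2 / d ^+ 2 by rewrite divr_ge0 ?sqr_ge0.
    have [le_d|gt_d] := leP `|u x - k%:R / n%:R| d.
      apply: le_trans (hd _ _ (u01 x) le_d) _.
      by rewrite lerDl mulr_ge0// mulr_ge0.
    apply: (@le_trans _ _ (2 * M)).
      apply: le_trans (ler_normB _ _) _.
      by have := fM (2 * T * asin (cl (u x))); have := fM (2 * T * asin (cl (k%:R / n%:R)));
        rewrite -/(F _) -/(F (k%:R / n%:R)); lra.
    apply: (@le_trans _ _ (2 * M * ((u x - k%:R / n%:R) ^+ 2 / d ^+ 2))).
      rewrite ler_peMr ?mulr_ge0// ler_pdivlMr ?exprn_gt0// mul1r.
      by rewrite -[X in _ <= X]real_normK ?num_real// lerXn2r ?nnegrE//; exact: ltW.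
    by rewrite lerDr ltW.
  have final : bern n (fun k => e / 2 + 2 * M / (d ^+ 2 * n%:R ^+ 2) * (k%:R - n%:R * u x) ^+ 2) (u x)
      <= e.
    rewrite bernD bern_cst bernZ bern_var.
    rewrite (_ : _ * (n%:R * _ * _) = 4 * (u x * (1 - u x)) * (M / (2 * n%:R * d ^+ 2))); last first.
      by field; rewrite !gt_eqF.
    have u4 : 4 * (u x * (1 - u x)) <= 1 by have := sqr_ge0 (2 * u x - 1); lra.
    have mn0 : 0 <= M / (2 * n%:R * d ^+ 2).
      by rewrite divr_ge0// mulr_ge0 ?sqr_ge0// mulr_ge0// ltW.
    have := ler_wpM2r mn0 u4; lra.
  apply: le_trans final; rewrite ler_norml; apply/andP; split.
    rewrite -[X in X <= _]mulN1r -bernZ; apply: bern_le; first exact: u01.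
    by move=> k kn; have := ub k kn; rewrite ler_norml => /andP[h _]; move: h; rewrite [X in _ -> X <= _]mulN1r.
  apply: bern_le; first exact: u01.
  by move=> k kn; have := ub k kn; rewrite ler_norml => /andP[].
Qed.

End TrigApprox.

(** * Convergence in law from characteristic functions, and stability under small perturbations *)

Section Criterion.
Variables (R : realType) (pmf : forall n, adj n -> R).
Hypotheses (pmf_ge0 : forall n A, 0 <= pmf n A) (pmf_sum1 : forall n, \sum_(A : adj n) pmf n A = 1).

Definition Ex n (F : adj n -> R) : R := \sum_(A : adj n) pmf n A * F A.

Lemma Ex_cst n c : Ex n (fun=> c) = c.
Proof. by rewrite /Ex -mulr_suml pmf_sum1 mul1r. Qed.

Lemma ExD n F G : Ex n (fun A => F A + G A) = Ex n F + Ex n G.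
Proof. by rewrite /Ex -big_split; apply: eq_bigr => A _; rewrite mulrDr. Qed.

Lemma ExZ n c F : Ex n (fun A => c * F A) = c * Ex n F.
Proof. by rewrite /Ex mulr_sumr; apply: eq_bigr => A _; rewrite mulrCA. Qed.

Lemma Ex_le n F G : (forall A, F A <= G A) -> Ex n F <= Ex n G.
Proof. by move=> FG; apply: ler_sum => A _; exact: ler_wpM2l. Qed.

Lemma Ex_norm n F : `|Ex n F| <= Ex n (fun A => `|F A|).
Proof.
apply: (le_trans (ler_norm_sum _ _ _)); apply: ler_sum => A _.
by rewrite normrM ger0_norm.
Qed.

Lemma ExB n F G : Ex n (fun A => F A - G A) = Ex n F - Ex n G.
Proof.
rewrite /Ex -sumrB; apply: eq_bigr => A _; ring.
Qed.

Lemma ExB_le n F G H : (forall A, `|F A - G A| <= H A) -> `|Ex n F - Ex n G| <= Ex n H.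
Proof. by move=> h; rewrite -ExB; apply: le_trans (Ex_norm _ _) _; exact: Ex_le. Qed.

Lemma gint_EFin (f : R -> R) : quad_growth R f ->
  (\int[lebesgue_measure]_x (f x * normal_pdf 0 1 x)%:E)%E = (gint R f)%:E.
Proof.
move=> qf; rewrite /gint /Rintegral fineK//.
exact: integrable_fin_num (quad_integrable R f qf).
Qed.

Lemma bounded_quad (f : R -> R) (M : R) : continuous f -> (forall x, `|f x| <= M) ->
  quad_growth R f.
Proof. by move=> cf fM; apply: quad_growth_bounded fM; exact: continuous_measurable_fun. Qed.

Lemma conv_lawP (X : forall n, adj n -> R) :
  (forall f : R -> R, continuous f -> (exists M, forall x, `|f x| <= M) ->
    forall e, 0 < e -> \forall n \near \oo, `|Ex n (fun A => f (X n A)) - gint R f| <= e) <->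
  conv_law_std_normal pmf X.
Proof.
split=> [h f cf [M fM]|h f cf [M fM] e e0].
  rewrite gint_EFin; last exact: bounded_quad fM.
  apply: cvg_EFin; first exact: nearW.
  apply/cvgrPdist_le => e e0.
  have := h f cf (ex_intro _ M fM) e e0; apply: filterS => n.
  by rewrite distrC.
have := h f cf (ex_intro _ M fM); rewrite gint_EFin; last exact: bounded_quad fM.
move=> /fine_cvgP[_] /cvgrPdist_le /(_ e e0); apply: filterS => n.
by rewrite distrC.
Qed.

Lemma trigpoly_bounded p : trigpoly R p -> continuous p /\ exists M, forall x, `|p x| <= M.
Proof.
elim=> {p} [a t b|f g _ [cf [M fM]] _ [cg [N gN]]].
  split.
    move=> x; apply: cvgM; first exact: cvg_cst.
    apply: (@continuous_comp _ _ _ (fun x => t * x + b) (@cos R)); last exact: continuous_cos.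
    by apply: cvgD; [apply: cvgM; [exact: cvg_cst|exact: cvg_id]|exact: cvg_cst].
  by exists `|a| => x; rewrite normrM ler_piMr// cos_max.
split; first by move=> x; apply: cvgD; [exact: cf|exact: cg].
by exists (M + N) => x; apply: le_trans (ler_normD _ _) _; exact: lerD.
Qed.

Section CharacteristicFunction.
Variable X : forall n, adj n -> R.
Hypothesis cvg_cos : forall t e, 0 < e -> \forall n \near \oo,
  `|Ex n (fun A => cos (t * X n A)) - expR (- (t ^+ 2 / 2))| <= e.
Hypothesis cvg_sin : forall t e, 0 < e -> \forall n \near \oo,
  `|Ex n (fun A => sin (t * X n A))| <= e.

Lemma trigpoly_cvg p : trigpoly R p -> forall e, 0 < e ->
  \forall n \near \oo, `|Ex n (fun A => p (X n A)) - gint R p| <= e.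
Proof.
elim=> {p} [a t b|f g tf If tg Ig] e e0.
  have a0 : 0 < 2 * (`|a| + 1) by rewrite mulr_gt0// ltr_wpDl.
  have d0 : 0 < e / (2 * (`|a| + 1)) by rewrite divr_gt0.
  have h1 := cvg_cos t _ d0; have h2 := cvg_sin t _ d0.
  near=> n.
  have g1 : `|Ex n (fun A => cos (t * X n A)) - expR (- (t ^+ 2 / 2))| <= e / (2 * (`|a| + 1)).
    by near: n; exact: h1.
  have g2 : `|Ex n (fun A => sin (t * X n A))| <= e / (2 * (`|a| + 1)).
    by near: n; exact: h2.
  have fE (x : R) : a * cos (t * x + b) = a * cos b * cos (t * x) + - (a * sin b) * sin (t * x).
    by rewrite cosD; ring.
  rewrite (_ : Ex n _ = a * cos b * Ex n (fun A => cos (t * X n A))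
      + - (a * sin b) * Ex n (fun A => sin (t * X n A))); last first.
    by rewrite -!ExZ -ExD; apply: eq_bigr => A _; rewrite fE.
  rewrite (_ : gint R _ = a * cos b * expR (- (t ^+ 2 / 2))); last first.
    rewrite (_ : (fun x => _) = (fun x => a * cos b * cos (t * x) + - (a * sin b) * sin (t * x))).
      rewrite gintD; [|exact/quad_growthZ/quad_cosM|exact/quad_growthZ/quad_sinM].
      by rewrite !gintZ ?gint_cos ?gint_sin ?mulr0 ?addr0//; [exact: quad_sinM|exact: quad_cosM].
    by apply/funext => x; exact: fE.
  set c := Ex n _ in g1 *; set s := Ex n _ in g2 *; set E := expR _ in g1 *.
  rewrite (_ : _ - _ = a * (cos b * (c - E) - sin b * s)); last by ring.
  rewrite normrM; apply: (@le_trans _ _ (`|a| * (2 * (e / (2 * (`|a| + 1)))))).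
    apply: ler_wpM2l => //; apply: le_trans (ler_normB _ _) _; rewrite !normrM mulr_natl mulr2n.
    by apply: lerD; rewrite -[X in _ <= X]mul1r; apply: ler_pM; rewrite ?cos_max ?sin_max.
  rewrite (_ : _ * _ = `|a| / (`|a| + 1) * e); last by field; rewrite gt_eqF// ltr_wpDl.
  apply: ler_piMl; first exact: ltW.
  by rewrite ler_pdivrMr ?ltr_wpDl// mul1r lerDl.
have e2 : 0 < e / 2 by rewrite divr_gt0.
have [cf [M fM]] := trigpoly_bounded _ tf; have [cg [N gN]] := trigpoly_bounded _ tg.
have h1 := If _ e2; have h2 := Ig _ e2.
near=> n.
rewrite ExD gintD; [|exact: bounded_quad fM|exact: bounded_quad gN].
have g1 : `|Ex n (fun A => f (X n A)) - gint R f| <= e / 2 by near: n; exact: h1.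
have g2 : `|Ex n (fun A => g (X n A)) - gint R g| <= e / 2 by near: n; exact: h2.
rewrite (_ : _ + _ - _ = (Ex n (fun A => f (X n A)) - gint R f)
  + (Ex n (fun A => g (X n A)) - gint R g)); last by ring.
by apply: le_trans (ler_normD _ _) _; lra.
Unshelve. all: by end_near. Qed.

Hypothesis sqr_le2 : \forall n \near \oo, Ex n (fun A => X n A ^+ 2) <= 2.

(** The second moments provide tightness. A trigonometric polynomial replaces [f] on [-T, T];
    outside, both are bounded by [M] and 2 M x^2 / T^2 pays for the difference, under the law of X
    as under the Gaussian. *)
Lemma conv_law_of_cf : conv_law_std_normal pmf X.
Proof.
apply/conv_lawP => f cf [M fM] e e0.
have M0 : 0 <= M by apply: le_trans (fM 0).
pose G := gint R (fun x => x ^+ 2).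
have qsqr : quad_growth R (fun x => x ^+ 2) := quad_sqr R.
have G0 : 0 <= G.
  rewrite -(_ : gint R (fun=> 0) = 0); last first.
    rewrite (_ : (fun=> 0) = (fun x : R => 0 * x ^+ 2)); last by apply/funext => x; rewrite mul0r.
    by rewrite gintZ ?mul0r.
  apply: gint_le => //; last by move=> x; exact: sqr_ge0.
  by apply: (quad_growth_bounded _ _ 0) => [|x]; rewrite ?normr0//; exact: measurable_cst.
have e5 : 0 < e / 5 by rewrite divr_gt0.
(* With T >= 1 one has T <= T^2, so both tail errors fall below e / 5. The two replacements of [f]
   cost two fifths each, the convergence for [p] the last one. *)
pose T := 1 + 2 * M * (2 + G) / (e / 5).
have T1 : 1 <= T by rewrite /T lerDl divr_ge0 ?mulr_ge0 ?addr_ge0// ltW.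
have T0 : 0 < T by lra.
have TM : 2 * M / T ^+ 2 * (2 + G) <= e / 5.
  rewrite mulrAC ler_pdivrMr ?exprn_gt0//.
  have hT : 2 * M * (2 + G) / (e / 5) <= T by rewrite /T lerDr.
  rewrite ler_pdivrMr// in hT.
  apply: (le_trans hT); rewrite mulrC; apply: ler_wpM2l; first exact: ltW.
  by rewrite expr2 ler_peMr// ltW.
have [p [tp pM fp]] := trig_approx R f M T (e / 5) cf fM T0 e5.
have [cp [N pN]] := trigpoly_bounded _ tp.
have fp_all x : `|f x - p x| <= e / 5 + 2 * M / T ^+ 2 * x ^+ 2.
  have q0 : 0 <= 2 * M / T ^+ 2 by apply: divr_ge0; [exact: mulr_ge0|exact: sqr_ge0].
  have [xT|xT] := leP `|x| T.
    by apply: (le_trans (fp x xT)); rewrite lerDl mulr_ge0// sqr_ge0.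
  apply: (@le_trans _ _ (2 * M)).
    by apply: le_trans (ler_normB _ _) _; have := fM x; have := pM x; lra.
  apply: (@le_trans _ _ (2 * M / T ^+ 2 * x ^+ 2)); last by rewrite lerDr ltW.
  rewrite mulrAC ler_pdivlMr ?exprn_gt0//; apply: ler_wpM2l; first by rewrite mulr_ge0.
  by rewrite -[X in _ <= X]real_normK ?num_real// lerXn2r ?nnegrE//; exact: ltW.
have gfp : `|gint R f - gint R p| <= e / 5 + e / 5.
  rewrite -[gint R f - _](_ : gint R (fun x => f x + -1 * p x) = _); last first.
    rewrite gintD; [|exact: bounded_quad fM|exact/quad_growthZ/(bounded_quad _ _ cp pN)].
    by rewrite gintZ ?mulN1r//; exact: bounded_quad pN.
  apply: (@le_trans _ _ (gint R (fun x => e / 5 + 2 * M / T ^+ 2 * x ^+ 2))).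
    apply: gint_norm_le.
    - by apply: quad_growthD; [exact: bounded_quad fM|exact/quad_growthZ/(bounded_quad _ _ cp pN)].
    - apply: quad_growthD; last exact: quad_growthZ.
      by apply: (quad_growth_bounded _ _ `|e / 5|) => //; exact: measurable_cst.
    - by move=> x; rewrite mulN1r.
  rewrite gintD; [|by apply: (quad_growth_bounded _ _ `|e / 5|) => //; exact: measurable_cst|exact: quad_growthZ].
  rewrite (gintZ R (2 * M / T ^+ 2))// (_ : gint R (fun=> e / 5) = e / 5); last first.
    rewrite (_ : (fun=> e / 5) = (fun x : R => e / 5 * (fun=> 1) x)); last by apply/funext => x; rewrite mulr1.
    rewrite gintZ ?gint1 ?mulr1//.
    by apply: (quad_growth_bounded _ _ 1) => [|x]; rewrite ?normr1//; exact: measurable_cst.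
  apply: lerD => //; apply: le_trans TM; apply: ler_wpM2l; last by rewrite -/G; lra.
  by apply: divr_ge0; [exact: mulr_ge0|exact: sqr_ge0].
have h1 := trigpoly_cvg _ tp _ e5.
near=> n.
have g1 : `|Ex n (fun A => p (X n A)) - gint R p| <= e / 5 by near: n; exact: h1.
have g2 : Ex n (fun A => X n A ^+ 2) <= 2 by near: n; exact: sqr_le2.
have g3 : `|Ex n (fun A => f (X n A)) - Ex n (fun A => p (X n A))| <= e / 5 + e / 5.
  apply: le_trans (ExB_le _ _ _ (fun A => e / 5 + 2 * M / T ^+ 2 * X n A ^+ 2) _) _.
    by move=> A; exact: fp_all.
  rewrite ExD Ex_cst ExZ; apply: lerD => //; apply: le_trans TM; apply: ler_wpM2l; last lra.
  by apply: divr_ge0; [exact: mulr_ge0|exact: sqr_ge0].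
rewrite (_ : _ - _ = (Ex n (fun A => f (X n A)) - Ex n (fun A => p (X n A)))
  + (Ex n (fun A => p (X n A)) - gint R p) - (gint R f - gint R p)); last by ring.
apply: le_trans (ler_normB _ _) _; apply: le_trans (lerD (ler_normD _ _) (lexx _)) _.
lra.
Unshelve. all: by end_near. Qed.

End CharacteristicFunction.

(** Closeness in probability is stated with one [e] for distance and probability together. Tightness
    is taken from the second moment of X alone, so that Y, which involves a truncated logarithm,
    requires no moment bound. *)
Lemma slutsky (X Y : forall n, adj n -> R) :
  conv_law_std_normal pmf X ->
  (\forall n \near \oo, Ex n (fun A => X n A ^+ 2) <= 2) ->
  (forall e, 0 < e -> \forall n \near \oo,
     Ex n (fun A => b2R R (e < `|Y n A - X n A|)) <= e) ->
  conv_law_std_normal pmf Y.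
Proof.
move=> /conv_lawP cX sqrX YX; apply/conv_lawP => f cf [M fM] e e0.
have M0 : 0 <= M by apply: le_trans (fM 0).
have e4 : 0 < e / 4 by rewrite divr_gt0.
pose T := 1 + 4 * M / (e / 4).
have T1 : 1 <= T by rewrite /T lerDl divr_ge0 ?mulr_ge0// ltW.
have T0 : 0 < T by lra.
have TM : 2 * M / T ^+ 2 * 2 <= e / 4.
  rewrite mulrAC ler_pdivrMr ?exprn_gt0//.
  have hT : 4 * M / (e / 4) <= T by rewrite /T lerDr.
  rewrite ler_pdivrMr// in hT.
  apply: (@le_trans _ _ (4 * M)); first by lra.
  apply: (le_trans hT); rewrite mulrC; apply: ler_wpM2l; first exact: ltW.
  by rewrite expr2 ler_peMr// ltW.
have [d d0 hd] := unif_continuous_segment R f (- T) T (e / 4) cf e4.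
have M8 : 0 < 2 * M + 1 by lra.
(* One threshold for two purposes: at most [d] for uniform continuity, and so small a probability
   that 2 M times it is below e / 4. *)
pose d' := Num.min d (e / 4 / (2 * M + 1)).
have d'0 : 0 < d' by rewrite lt_min d0 divr_gt0.
have h1 := cX f cf (ex_intro _ M fM) _ e4.
have h2 := YX _ d'0.
near=> n.
have g1 : `|Ex n (fun A => f (X n A)) - gint R f| <= e / 4 by near: n; exact: h1.
have g2 : Ex n (fun A => X n A ^+ 2) <= 2 by near: n; exact: sqrX.
have g3 : Ex n (fun A => b2R R (d' < `|Y n A - X n A|)) <= d' by near: n; exact: h2.
have g4 : `|Ex n (fun A => f (Y n A)) - Ex n (fun A => f (X n A))| <= e / 4 + e / 4 + e / 4.
  apply: le_trans (ExB_le _ _ _ (fun A => (e / 4 + 2 * M / T ^+ 2 * X n A ^+ 2)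
     + 2 * M * b2R R (d' < `|Y n A - X n A|)) _) _.
    move=> A.
    have q0 : 0 <= 2 * M / T ^+ 2 by apply: divr_ge0; [exact: mulr_ge0|exact: sqr_ge0].
    have b0 : 0 <= b2R R (d' < `|Y n A - X n A|) by rewrite /b2R; case: ifP.
    have c0 := mulr_ge0 q0 (sqr_ge0 (X n A)).
    have c1 : 0 <= 2 * M * b2R R (d' < `|Y n A - X n A|) by rewrite mulr_ge0// mulr_ge0.
    have fYX : `|f (Y n A) - f (X n A)| <= 2 * M.
      by apply: le_trans (ler_normB _ _) _; have := fM (X n A); have := fM (Y n A); lra.
    have [big|small] := ltP d' `|Y n A - X n A|.
      by rewrite /b2R mulr1; move: c0 fYX; lra.
    have [xT|xT] := leP `|X n A| T.
      have : `|f (X n A) - f (Y n A)| <= e / 4.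
        apply: hd; first by rewrite -ler_norml.
        by rewrite distrC; apply: le_trans small _; rewrite /d' ge_min lexx.
      by rewrite distrC /b2R mulr0; move: c0; lra.
    have : 2 * M <= 2 * M / T ^+ 2 * X n A ^+ 2.
      rewrite mulrAC ler_pdivlMr ?exprn_gt0//; apply: ler_wpM2l; first by rewrite mulr_ge0.
      by rewrite -[X in _ <= X]real_normK ?num_real// lerXn2r ?nnegrE//; exact: ltW.
    by rewrite /b2R mulr0; move: fYX; lra.
  rewrite !ExD Ex_cst !ExZ; apply: lerD; first apply: lerD => //.
    apply: le_trans TM; apply: ler_wpM2l => //.
    by apply: divr_ge0; [exact: mulr_ge0|exact: sqr_ge0].
  apply: (@le_trans _ _ ((2 * M + 1) * (e / 4 / (2 * M + 1)))); last first.
    by rewrite mulrC divfK// gt_eqF.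
  apply: (@le_trans _ _ (2 * M * d')); first by apply: ler_wpM2l => //; rewrite mulr_ge0.
  apply: ler_pM; rewrite ?mulr_ge0// ?(ltW d'0)//; first lra.
  by rewrite /d' ge_min lexx orbT.
rewrite (_ : _ - _ = (Ex n (fun A => f (Y n A)) - Ex n (fun A => f (X n A)))
  + (Ex n (fun A => f (X n A)) - gint R f)); last by ring.
by apply: le_trans (ler_normD _ _) _; lra.
Unshelve. all: by end_near. Qed.

End Criterion.

(** * Comparison of the orders of magnitude of the moment bounds *)

Section Arithmetic.
Variables (R : realType) (d M N m s k smu snu mu2 nu2 a2 : R).
Hypotheses (d_gt0 : 0 < d) (d_le1 : d <= 1) (k_gt0 : 0 < k) (sE : s = k * m).
Hypotheses (M_ge : 1 <= d * M) (N_ge : 1 <= d * N) (m_ge : 1 <= d * m) (s_ge : 1 <= d * s).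
Hypotheses (smu_ge0 : 0 <= smu) (snu_ge0 : 0 <= snu) (mu2_ge0 : 0 <= mu2)
  (nu2_ge0 : 0 <= nu2) (a2_ge0 : 0 <= a2).
Hypotheses (m_leM : m <= d * M) (m_leN : m <= d * N) (smu_le : smu <= d * m) (snu_le : snu <= d * m).
Hypotheses (mu2_le : mu2 <= d * M) (nu2_le : nu2 <= d * N) (a2_le : a2 <= d * s)
  (a2_snu : a2 <= k ^+ 2 * d * snu) (a2_smu : a2 <= k ^+ 2 * d * smu).

(** [v0b] and [v0] are the orders of magnitude of the variances of the linear parts of
    Q_n(b) and U_n(rho), where M, N, m, s stand for the l1 norms of mu, nu, eta and
    e^(rho/2) eta, smu and snu for (mu, eta) and (nu, eta), and k for e^(rho/2). *)
Definition v0b := M * N * (M * snu + m ^+ 2) * (N * smu + m ^+ 2).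
Definition v0 := (M * N * s) ^+ 2 + k ^+ 4 * v0b.
Let T1 := M * N * (M * snu) * m ^+ 2.
Let T2 := M * N * (N * smu) * m ^+ 2.
Let T3 := M * N * m ^+ 4.
Let T4 := M * N * (M * snu) * (N * smu).

Lemma v0bE : v0b = T1 + T2 + T3 + T4.
Proof. by rewrite /v0b /T1 /T2 /T3 /T4; ring. Qed.

Lemma ge1_of (x : R) : 1 <= d * x -> 1 <= x.
Proof.
move=> h; have x0 : 0 < x by rewrite -(pmulr_rgt0 _ d_gt0); lra.
by apply: le_trans h _; rewrite ler_piMl// ltW.
Qed.

Let M1 : 1 <= M. Proof. exact: ge1_of. Qed.
Let N1 : 1 <= N. Proof. exact: ge1_of. Qed.
Let m1 : 1 <= m. Proof. exact: ge1_of. Qed.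
Let s1 : 1 <= s. Proof. exact: ge1_of. Qed.
Let M0 : 0 <= M. Proof. exact: le_trans ler01 M1. Qed.
Let N0 : 0 <= N. Proof. exact: le_trans ler01 N1. Qed.
Let m0 : 0 <= m. Proof. exact: le_trans ler01 m1. Qed.
Let s0 : 0 <= s. Proof. exact: le_trans ler01 s1. Qed.
Let d0 : 0 <= d. Proof. exact: ltW. Qed.
Let k0 : 0 <= k. Proof. exact: ltW. Qed.

Ltac pos := repeat first [assumption | apply: mulr_ge0 | apply: addr_ge0 | apply: exprn_ge0].

Let T1_ge0 : 0 <= T1. Proof. by rewrite /T1; pos. Qed.
Let T2_ge0 : 0 <= T2. Proof. by rewrite /T2; pos. Qed.
Let T3_ge0 : 0 <= T3. Proof. by rewrite /T3; pos. Qed.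
Let T4_ge0 : 0 <= T4. Proof. by rewrite /T4; pos. Qed.

Lemma mul_d (x : R) : 0 <= x -> d * x <= x.
Proof. by move=> x0; rewrite ler_piMl. Qed.

Lemma le_scale (x c : R) : 0 <= x -> 1 <= c -> x <= c * x.
Proof. by move=> x0 c1; rewrite ler_peMl. Qed.

Lemma remA_le :
  4 * (a2 * nu2 * (M * s) ^+ 2) + 4 * (mu2 * a2 * (s * N) ^+ 2)
  + (27 * (s * s * nu2 * M ^+ 2) + 27 * (a2 * N * M * s ^+ 2)
     + 27 * (N * M * a2 * s ^+ 2) + 27 * (mu2 * s * s * N ^+ 2))
  + (256 * (s * s * N * M) + 2304 * (s * N * M * s)) <= 2676 * (d * v0).
Proof.
set P := (M * N * s) ^+ 2; have P0 : 0 <= P by exact: sqr_ge0.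
have h1 : a2 * nu2 * (M * s) ^+ 2 <= d * (k ^+ 4 * T1).
  apply: (@le_trans _ _ ((k ^+ 2 * d * snu) * (d * N) * (M * s) ^+ 2)).
    by apply: ler_wpM2r; [exact: sqr_ge0|exact: ler_pM].
  rewrite (_ : _ * _ = d * (d * (k ^+ 4 * T1))); last by rewrite sE /T1; ring.
  by apply: ler_wpM2l => //; apply: mul_d; pos.
have h2 : mu2 * a2 * (s * N) ^+ 2 <= d * (k ^+ 4 * T2).
  apply: (@le_trans _ _ ((d * M) * (k ^+ 2 * d * smu) * (s * N) ^+ 2)).
    by apply: ler_wpM2r; [exact: sqr_ge0|exact: ler_pM].
  rewrite (_ : _ * _ = d * (d * (k ^+ 4 * T2))); last by rewrite sE /T2; ring.
  by apply: ler_wpM2l => //; apply: mul_d; pos.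
have h3 : s * s * nu2 * M ^+ 2 <= d * P.
  apply: (@le_trans _ _ (s * s * (d * N) * M ^+ 2)).
    by apply: ler_wpM2r; [exact: sqr_ge0|apply: ler_wpM2l => //; pos].
  apply: le_trans (le_scale _ _ _ N1) _; first by pos.
  by rewrite le_eqVlt; apply/orP; left; apply/eqP; rewrite /P; ring.
have h4 : mu2 * s * s * N ^+ 2 <= d * P.
  apply: (@le_trans _ _ (d * M * s * s * N ^+ 2)).
    by apply: ler_wpM2r; [exact: sqr_ge0|do 2!apply: ler_wpM2r => //].
  apply: le_trans (le_scale _ _ _ M1) _; first by pos.
  by rewrite le_eqVlt; apply/orP; left; apply/eqP; rewrite /P; ring.
have h5 : a2 * N * M * s ^+ 2 <= d * (k ^+ 4 * T3).
  apply: (@le_trans _ _ (d * s * N * M * s ^+ 2)).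
    by apply: ler_wpM2r; [exact: sqr_ge0|do 2!apply: ler_wpM2r => //].
  apply: le_trans (le_scale _ _ _ s1) _; first by pos.
  by rewrite le_eqVlt; apply/orP; left; apply/eqP; rewrite /T3 sE; ring.
have h6 : s * s * N * M <= d * P.
  apply: le_trans (le_scale _ _ _ M_ge) _; first by pos.
  apply: le_trans (le_scale _ _ _ N1) _; first by pos.
  by rewrite le_eqVlt; apply/orP; left; apply/eqP; rewrite /P; ring.
rewrite (_ : N * M * a2 * s ^+ 2 = a2 * N * M * s ^+ 2); last by ring.
rewrite (_ : s * N * M * s = s * s * N * M); last by ring.
have -> : v0 = P + k ^+ 4 * T1 + k ^+ 4 * T2 + k ^+ 4 * T3 + k ^+ 4 * T4.
  by rewrite /v0 v0bE /P; ring.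
have : 0 <= d * (k ^+ 4 * T1) by pos.
have : 0 <= d * (k ^+ 4 * T2) by pos.
have : 0 <= d * (k ^+ 4 * T3) by pos.
have : 0 <= d * (k ^+ 4 * T4) by pos.
have : 0 <= d * P by pos.
rewrite !mulrDr; lra.
Qed.

Lemma remB_le :
  4 * (nu2 * mu2 * (m * m) ^+ 2)
  + (27 * (snu * m * N * M ^+ 2) + 27 * (snu * N * mu2 * m ^+ 2)
     + 27 * (nu2 * M * smu * m ^+ 2) + 27 * (M * m * smu * N ^+ 2))
  + (256 * (m * m * N * M) + 2304 * (m * N * M * m)) <= 2672 * (d * v0b).
Proof.
have h1 : nu2 * mu2 * (m * m) ^+ 2 <= d * T3.
  apply: (@le_trans _ _ ((d * N) * (d * M) * (m * m) ^+ 2)).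
    by apply: ler_wpM2r; [exact: sqr_ge0|exact: ler_pM].
  rewrite (_ : _ * _ = d * (d * T3)); last by rewrite /T3; ring.
  by apply: ler_wpM2l => //; apply: mul_d; pos.
have h2 : snu * m * N * M ^+ 2 <= d * T1.
  apply: le_trans (le_scale _ _ _ m_ge) _; first by pos.
  by rewrite le_eqVlt; apply/orP; left; apply/eqP; rewrite /T1; ring.
have h3 : snu * N * mu2 * m ^+ 2 <= d * T1.
  apply: (@le_trans _ _ (snu * N * (d * M) * m ^+ 2)).
    by apply: ler_wpM2r; [exact: sqr_ge0|apply: ler_wpM2l => //; pos].
  apply: le_trans (le_scale _ _ _ M1) _; first by pos.
  by rewrite le_eqVlt; apply/orP; left; apply/eqP; rewrite /T1; ring.
have h4 : nu2 * M * smu * m ^+ 2 <= d * T2.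
  apply: (@le_trans _ _ (d * N * M * smu * m ^+ 2)).
    by apply: ler_wpM2r; [exact: sqr_ge0|do 2!apply: ler_wpM2r => //].
  apply: le_trans (le_scale _ _ _ N1) _; first by pos.
  by rewrite le_eqVlt; apply/orP; left; apply/eqP; rewrite /T2; ring.
have h5 : M * m * smu * N ^+ 2 <= d * T2.
  apply: le_trans (le_scale _ _ _ m_ge) _; first by pos.
  by rewrite le_eqVlt; apply/orP; left; apply/eqP; rewrite /T2; ring.
have h6 : m * m * N * M <= d * T3.
  apply: le_trans (le_scale _ _ _ m_ge) _; first by pos.
  apply: le_trans (le_scale _ _ _ m1) _; first by pos.
  by rewrite le_eqVlt; apply/orP; left; apply/eqP; rewrite /T3; ring.
rewrite (_ : m * N * M * m = m * m * N * M); last by ring.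
rewrite v0bE.
have : 0 <= d * T1 by pos.
have : 0 <= d * T2 by pos.
have : 0 <= d * T3 by pos.
have : 0 <= d * T4 by pos.
rewrite !mulrDr; lra.
Qed.

Lemma mainB_le :
  snu * smu * (N * M) ^+ 2 + snu * N * (M * m) ^+ 2 + M * smu * (m * N) ^+ 2 <= v0b.
Proof.
rewrite v0bE.
have -> : snu * smu * (N * M) ^+ 2 = T4 by rewrite /T4; ring.
have -> : snu * N * (M * m) ^+ 2 = T1 by rewrite /T1; ring.
have -> : M * smu * (m * N) ^+ 2 = T2 by rewrite /T2; ring.
by move: T3_ge0; lra.
Qed.

Lemma mainA_le : s * s * (N * M) ^+ 2 + N * M * (s * s) ^+ 2 <= (M * N * s) ^+ 2 + k ^+ 4 * v0b.
Proof.
rewrite v0bE.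
have -> : s * s * (N * M) ^+ 2 = (M * N * s) ^+ 2 by ring.
have -> : N * M * (s * s) ^+ 2 = k ^+ 4 * T3 by rewrite /T3 sE; ring.
have : 0 <= k ^+ 4 * T1 by pos.
have : 0 <= k ^+ 4 * T2 by pos.
have : 0 <= k ^+ 4 * T4 by pos.
rewrite !mulrDr; lra.
Qed.

(** M N m^2 is the order of the mean of Q_n(b), so this bounds a squared coefficient of variation.
    Each of the last two factors of [v0b] gains a factor 2 d. *)
Lemma v0b_le : v0b <= 4 * d * (M * N * m ^+ 2) ^+ 2.
Proof.
have h (X y : R) : 0 <= X -> m <= d * X -> y <= d * m -> 0 <= y ->
    X * y + m ^+ 2 <= 2 * d * (X * m ^+ 2).
  move=> X0 mX ym y0.
  have e1 : X * y <= d * (X * m ^+ 2).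
    apply: (@le_trans _ _ (X * (d * m))); first by apply: ler_wpM2l.
    rewrite (_ : d * (X * m ^+ 2) = m * (X * (d * m))); last by ring.
    by apply: le_scale => //; pos.
  have e2 : m ^+ 2 <= d * (X * m ^+ 2).
    rewrite mulrA; apply: le_scale; [exact: sqr_ge0|exact: le_trans m1 mX].
  lra.
have hA := h _ _ M0 m_leM snu_le snu_ge0.
have hB := h _ _ N0 m_leN smu_le smu_ge0.
rewrite /v0b.
apply: (@le_trans _ _ (M * N * (2 * d * (M * m ^+ 2)) * (2 * d * (N * m ^+ 2)))).
  apply: ler_pM => //; try by pos.
  by apply: ler_wpM2l => //; pos.
rewrite (_ : _ * _ = d * (4 * d * (M * N * m ^+ 2) ^+ 2)); last by ring.
by apply: mul_d; pos.
Qed.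

Lemma v0_le : v0 <= 5 * d * (M * N * s ^+ 2) ^+ 2.
Proof.
have -> : 5 * d * (M * N * s ^+ 2) ^+ 2 =
   d * (M * N * s ^+ 2) ^+ 2 + k ^+ 4 * (4 * d * (M * N * m ^+ 2) ^+ 2).
  by rewrite sE; ring.
apply: lerD.
  rewrite (_ : d * _ = (d * s) * (s * (M * N * s) ^+ 2)); last by ring.
  apply: le_trans (le_scale _ _ _ s_ge); last by pos.
  by apply: le_scale => //; pos.
by apply: ler_wpM2l; [pos|exact: v0b_le].
Qed.

Lemma v0b_gt0 : 0 < v0b.
Proof.
have M_gt0 := lt_le_trans ltr01 M1; have N_gt0 := lt_le_trans ltr01 N1.
have m_gt0 := lt_le_trans ltr01 m1.
have : 0 < T3 by rewrite /T3 !mulr_gt0 ?exprn_gt0.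
by rewrite v0bE; move: T1_ge0 T2_ge0 T4_ge0; lra.
Qed.

Lemma v0_gt0 : 0 < v0.
Proof. by rewrite /v0 ltr_wpDl ?sqr_ge0// mulr_gt0 ?v0b_gt0// exprn_gt0. Qed.

Lemma v0_ge : k ^+ 4 * v0b <= v0.
Proof. by rewrite /v0 lerDr sqr_ge0. Qed.

Lemma v0_ge11 : (M * N * s) ^+ 2 <= v0.
Proof. by rewrite /v0 lerDl mulr_ge0 ?exprn_ge0// ltW// v0b_gt0. Qed.

End Arithmetic.

(** * The p1 model: independence of the dyads *)

Section Model.
Variables (R : realType) (n : nat) (rho gamma : R) (alpha beta : 'I_n -> R).

Local Notation E := (p1_E rho gamma alpha beta).
Local Notation pmf := (p1_pmf rho gamma alpha beta).
Local Notation edge := ('I_n -> 'I_n -> bool -> bool -> R).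
Local Notation pair := (p1_pair rho gamma alpha beta).

Definition upd (A : adj n) (i j : 'I_n) (a b : bool) : adj n :=
  [ffun e => if e == (i, j) then a else if e == (j, i) then b else A e].

(** Independence of the dyad {i, j}, encoded as invariance under overwriting that dyad; this avoids
    sub-algebras and conditional expectations. *)
Definition dyad_free (i j : 'I_n) (Y : adj n -> R) :=
  forall A a b, Y (upd A i j a b) = Y A.

Lemma p1_den_gt0 (i j : 'I_n) :
  0 < 1 + expR (p1_lin gamma alpha beta i j) + expR (p1_lin gamma alpha beta j i)
     + expR (p1_lin gamma alpha beta i j + p1_lin gamma alpha beta j i + rho).
Proof. by rewrite !addr_gt0 ?expR_gt0. Qed.

Lemma p1_pair_gt0 a b i j : 0 < pair a b i j.
Proof. by rewrite /p1_pair mulr_gt0 ?expR_gt0// invr_gt0 p1_den_gt0. Qed.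

Lemma p1_pairC a b i j : pair a b i j = pair b a j i.
Proof.
rewrite /p1_pair /p1_K; congr (_^-1 * expR _); last by ring.
rewrite [p1_lin _ _ _ j i + p1_lin _ _ _ i j]addrC; ring.
Qed.

Lemma p1_pair_sum1 i j :
  pair true true i j + pair true false i j + pair false true i j
  + pair false false i j = 1.
Proof.
rewrite /p1_pair /b2R -!mulrDr !mul1r !mul0r !addr0 !add0r expR0.
rewrite (_ : _ + 1 = (p1_K rho gamma alpha beta i j)^-1).
  by rewrite mulfV// /p1_K invr_eq0 gt_eqF// p1_den_gt0.
rewrite /p1_K invrK; ring.
Qed.

Lemma upd_same (A : adj n) i j : upd A i j (A (i, j)) (A (j, i)) = A.
Proof.
apply/ffunP => e; rewrite ffunE; case: eqP => [->//|_].
by case: eqP => [->|].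
Qed.

Lemma upd_upd (A : adj n) i j a b a' b' :
  upd (upd A i j a b) i j a' b' = upd A i j a' b'.
Proof. by apply/ffunP => e; rewrite !ffunE; case: eqP => // _; case: eqP. Qed.

Lemma upd_fst (A : adj n) i j a b : upd A i j a b (i, j) = a.
Proof. by rewrite ffunE eqxx. Qed.

Lemma upd_snd (A : adj n) i j a b : i != j -> upd A i j a b (j, i) = b.
Proof.
by move=> ij; rewrite ffunE xpair_eqE (negPf ij) andbF eqxx.
Qed.

(** Overwriting the dyad is a bijection between the graphs with prescribed values on {i, j} and
    those with no edge there, and F is constant along it. *)
Lemma sum_dyad (i j : 'I_n) (F : adj n -> R) (h : bool -> bool -> R) :
  i != j -> dyad_free i j F ->
  \sum_(A : adj n) F A * h (A (i, j)) (A (j, i)) =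
  (h true true + h true false + h false true + h false false) *
  \sum_(A : adj n | ~~ A (i, j) && ~~ A (j, i)) F A.
Proof.
move=> ij Ff.
rewrite (partition_big (fun A : adj n => (A (i, j), A (j, i))) predT)//=.
have K a b : \sum_(A : adj n | (A (i, j), A (j, i)) == (a, b))
     F A * h (A (i, j)) (A (j, i)) =
   h a b * \sum_(A : adj n | ~~ A (i, j) && ~~ A (j, i)) F A.
  rewrite (reindex_onto (fun A => upd A i j a b) (fun A => upd A i j false false)) /=.
    rewrite mulr_sumr; apply: eq_big => [A|A /andP[]].
      rewrite upd_fst upd_snd// eqxx /= upd_upd.
      apply/eqP/andP => [<-|[a0 b0]]; first by rewrite upd_fst upd_snd.
      by rewrite -[RHS](upd_same A i j) (negPf a0) (negPf b0).
    by rewrite upd_fst upd_snd// Ff => _ _; rewrite mulrC.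
  by move=> A; rewrite xpair_eqE => /andP[/eqP <- /eqP <-]; rewrite upd_upd upd_same.
rewrite -(pair_bigA _ (fun a b => \sum_(A : adj n | (A (i, j), A (j, i)) == (a, b))
     F A * h (A (i, j)) (A (j, i)))) /=.
rewrite !big_bool /= !K -!mulrDl; congr (_ * _); ring.
Qed.

Definition noloop (A : adj n) : R := b2R R [forall i : 'I_n, ~~ A (i, i)].

Lemma pmfE (A : adj n) : pmf A = noloop A *
  \prod_(e : 'I_n * 'I_n | (e.1 < e.2)%N) pair (A e) (A (e.2, e.1)) e.1 e.2.
Proof.
rewrite /p1_pmf pair_big_dep /=; congr (_ * _).
by apply: eq_bigr => -[i j].
Qed.

Lemma noloop_upd i j : i != j -> dyad_free i j noloop.
Proof.
move=> ij A a b; rewrite /noloop; congr b2R; apply: eq_forallb => k.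
rewrite ffunE !xpair_eqE; case: eqP => [->|] /=; first by rewrite (negPf ij).
by move=> ki; case: eqP => //= kj; case: eqP.
Qed.

Lemma dyad_freeM i j X Y : dyad_free i j X -> dyad_free i j Y ->
  dyad_free i j (fun A => X A * Y A).
Proof. by move=> hX hY A a b; rewrite hX hY. Qed.

Lemma dyad_freeD i j X Y : dyad_free i j X -> dyad_free i j Y ->
  dyad_free i j (fun A => X A + Y A).
Proof. by move=> hX hY A a b; rewrite hX hY. Qed.

Lemma dyad_free_prod i j (T : Type) (s : seq T) (P : pred T) (F : T -> adj n -> R) :
  (forall t, P t -> dyad_free i j (F t)) ->
  dyad_free i j (fun A => \prod_(t <- s | P t) F t A).
Proof. by move=> h A a b; apply: eq_bigr => t Pt; rewrite h. Qed.

Lemma dyad_free_sum i j (T : Type) (s : seq T) (P : pred T) (F : T -> adj n -> R) :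
  (forall t, P t -> dyad_free i j (F t)) ->
  dyad_free i j (fun A => \sum_(t <- s | P t) F t A).
Proof. by move=> h A a b; apply: eq_bigr => t Pt; rewrite h. Qed.

Lemma dyad_free_loc i j k l (f : bool -> bool -> R) :
  ~ (k = i /\ l = j) -> ~ (k = j /\ l = i) ->
  dyad_free i j (fun A => f (A (k, l)) (A (l, k))).
Proof.
move=> h1 h2 A a b; rewrite !ffunE !xpair_eqE.
have -> : (k == i) && (l == j) = false by apply/negP => /andP[/eqP ? /eqP ?]; apply: h1.
have -> : (k == j) && (l == i) = false by apply/negP => /andP[/eqP ? /eqP ?]; apply: h2.
have -> : (l == i) && (k == j) = false by apply/negP => /andP[/eqP ? /eqP ?]; apply: h2.
by have -> : (l == j) && (k == i) = false by apply/negP => /andP[/eqP ? /eqP ?]; apply: h1.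
Qed.

(** Dyads are switched on one at a time: replacing the point mass at the empty dyad by the law of
    the pair leaves the total unchanged, as both have mass 1. *)
Lemma p1_pmf_sum1 : \sum_(A : adj n) pmf A = 1.
Proof.
(* Dyads in [s] carry their true law, the others are forced to be empty; for [s] empty only the
   graph without edges survives. *)
pose w (s : seq ('I_n * 'I_n)) (A : adj n) (e : 'I_n * 'I_n) : R :=
  if e \in s then pair (A e) (A (e.2, e.1)) e.1 e.2
  else b2R R (~~ A e && ~~ A (e.2, e.1)).
have main s : \sum_(A : adj n) noloop A * \prod_(e : 'I_n * 'I_n | (e.1 < e.2)%N) w s A e = 1.
  elim: s => [|[i j] s IH].
    rewrite (bigD1 [ffun=> false]) //= [X in _ + X]big1 ?addr0.
      rewrite /noloop big1 ?mulr1.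
        by have -> : [forall i : 'I_n, ~~ [ffun=> false] (i, i)] by apply/forallP => i; rewrite ffunE.
      by move=> e _; rewrite /w in_nil !ffunE.
    move=> A nA; apply/eqP; apply: contraNT nA; rewrite mulf_eq0 negb_or => /andP[h1 h2].
    apply/eqP/ffunP => -[k l]; rewrite ffunE.
    have K (u v : 'I_n) : (u < v)%N -> ~~ A (u, v) && ~~ A (v, u).
      move=> uv; move: h2; rewrite prodf_seq_neq0 => /allP /(_ (u, v)).
      rewrite mem_index_enum /= uv => /(_ isT); rewrite /w in_nil /=.
      by case: (_ && _); rewrite //= /b2R eqxx.
    case: (ltngtP k l) => [/K /andP[/negPf]//|/K /andP[_ /negPf]//|].
    move/val_inj => <-; move: h1; rewrite /noloop.
    by case: forallP => [/(_ k)/negPf//|_]; rewrite /b2R eqxx.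
  (* Only a new pair with i < j alters the product; otherwise adding (i, j) to the list has no
     effect. *)
  case: (boolP ((i < j)%N && ((i, j) \notin s))) => [/andP[ij ijs]|h].
    have nij : i != j by rewrite neq_ltn ij.
    rewrite -[RHS]IH.
    pose F A := noloop A * \prod_(e : 'I_n * 'I_n | (e.1 < e.2)%N && (e != (i, j))) w s A e.
    have Ff : dyad_free i j F.
      apply: dyad_freeM; first exact: noloop_upd.
      apply: dyad_free_prod => -[k l] /= /andP[kl /eqP kle].
      rewrite /w; case: (_ \in s).
        apply: (@dyad_free_loc i j k l (fun a b => pair a b k l)) => -[? ?]; subst.
          by apply: kle.
        by move: (ltn_trans kl ij); rewrite ltnn.
      apply: (@dyad_free_loc i j k l (fun a b => b2R R (~~ a && ~~ b))) => -[? ?]; subst.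
        by apply: kle.
      by move: (ltn_trans kl ij); rewrite ltnn.
    transitivity (\sum_(A : adj n) F A * pair (A (i, j)) (A (j, i)) i j).
      apply: eq_bigr => A _; rewrite (bigD1 (i, j)) //= /F mulrAC -mulrA; congr (_ * _).
      rewrite {1}/w mem_head; congr (_ * _); apply: eq_bigr => e /andP[_ ne].
      by rewrite /w in_cons (negPf ne).
    rewrite (@sum_dyad i j F (fun a b => pair a b i j))// p1_pair_sum1 mul1r.
    transitivity (\sum_(A : adj n) F A * b2R R (~~ A (i, j) && ~~ A (j, i))).
      rewrite (@sum_dyad i j F (fun a b => b2R R (~~ a && ~~ b)))// /b2R /=.
      by rewrite !add0r mul1r.
    apply: eq_bigr => A _; rewrite [in RHS](bigD1 (i, j)) //= /F mulrAC -mulrA; congr (_ * _).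
    by rewrite {2}/w (negPf ijs).
  rewrite -[RHS]IH; apply: eq_bigr => A _; congr (_ * _); apply: eq_bigr => e lte.
  rewrite /w in_cons; case: eqP => //= ee; move: lte; rewrite ee /= => lte.
  by move: h; rewrite lte /= negbK => ->.
rewrite -[RHS](main (enum {: 'I_n * 'I_n})); apply: eq_bigr => A _; rewrite pmfE.
by congr (_ * _); apply: eq_bigr => e _; rewrite /w mem_enum.
Qed.

Lemma p1_pmf_ge0 A : 0 <= pmf A.
Proof.
rewrite /p1_pmf mulr_ge0 //; first by rewrite /b2R; case: ifP.
by apply: prodr_ge0 => i _; apply: prodr_ge0 => j _; exact/ltW/p1_pair_gt0.
Qed.

Lemma E_dyadM_lt (i j : 'I_n) f Y : (i < j)%N -> dyad_free i j Y ->
  E (fun A => f (A (i, j)) (A (j, i)) * Y A) =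
  (pair true true i j * f true true + pair true false i j * f true false
   + pair false true i j * f false true + pair false false i j * f false false) * E Y.
Proof.
move=> ij Yf; have nij : i != j by rewrite neq_ltn ij.
pose F A := noloop A *
  (\prod_(e : 'I_n * 'I_n | (e.1 < e.2)%N && (e != (i, j))) pair (A e) (A (e.2, e.1)) e.1 e.2) * Y A.
have Ff : dyad_free i j F.
  apply: dyad_freeM => //; apply: dyad_freeM; first exact: noloop_upd.
  apply: dyad_free_prod => -[k l] /= /andP[kl /eqP kle].
  apply: (@dyad_free_loc i j k l (fun a b => pair a b k l)) => -[? ?]; subst.
    by apply: kle.
  by move: (ltn_trans kl ij); rewrite ltnn.
have pE A : pmf A * Y A = F A * pair (A (i, j)) (A (j, i)) i j.
  by rewrite pmfE (bigD1 (i, j))//= /F; ring.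
rewrite /p1_E.
under eq_bigr do rewrite mulrCA pE mulrCA [_ * pair _ _ _ _]mulrC.
under [in RHS]eq_bigr do rewrite pE.
rewrite (@sum_dyad i j F (fun a b => pair a b i j * f a b))//.
by rewrite (@sum_dyad i j F (fun a b => pair a b i j))// p1_pair_sum1 mul1r.
Qed.

Lemma dyad_freeC i j Y : i != j -> dyad_free i j Y -> dyad_free j i Y.
Proof.
move=> ij h A a b; rewrite -[RHS](h A b a); congr Y.
apply/ffunP => e; rewrite !ffunE; case: eqP => [->|//].
by rewrite xpair_eqE eq_sym (negPf ij).
Qed.

(** The form in which independence is used from here on. The case j < i follows from the symmetry
    [p1_pairC] of the pair law. *)
Lemma E_dyadM (i j : 'I_n) f Y : i != j -> dyad_free i j Y ->
  E (fun A => f (A (i, j)) (A (j, i)) * Y A) =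
  (pair true true i j * f true true + pair true false i j * f true false
   + pair false true i j * f false true + pair false false i j * f false false) * E Y.
Proof.
move=> ij Yf; case: (ltngtP i j) => [lt|lt|/val_inj e].
- exact: E_dyadM_lt.
- rewrite (@E_dyadM_lt j i (fun a b => f b a))//; last exact: dyad_freeC.
  by rewrite ![pair _ _ i j]p1_pairC; congr (_ * _); ring.
- by rewrite e eqxx in ij.
Qed.

Lemma E_cst c : E (fun=> c) = c.
Proof. by rewrite /p1_E -mulr_suml p1_pmf_sum1 mul1r. Qed.

Lemma EZ c X : E (fun A => c * X A) = c * E X.
Proof. by rewrite /p1_E mulr_sumr; apply: eq_bigr => A _; rewrite mulrCA. Qed.

Lemma ED X Y : E (fun A => X A + Y A) = E X + E Y.
Proof. by rewrite /p1_E -big_split; apply: eq_bigr => A _; rewrite mulrDr. Qed.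

Lemma EN X : E (fun A => - X A) = - E X.
Proof. by rewrite /p1_E -sumrN; apply: eq_bigr => A _; rewrite mulrN. Qed.

Lemma EB X Y : E (fun A => X A - Y A) = E X - E Y.
Proof. by rewrite ED EN. Qed.

Lemma E_sum (T : Type) (s : seq T) (P : pred T) (F : T -> adj n -> R) :
  E (fun A => \sum_(t <- s | P t) F t A) = \sum_(t <- s | P t) E (F t).
Proof.
rewrite /p1_E exchange_big /=; apply: eq_bigr => A _.
by rewrite mulr_sumr.
Qed.

Lemma eq_E X Y : X =1 Y -> E X = E Y.
Proof. by move=> XY; apply: eq_bigr => A _; rewrite XY. Qed.

Lemma le_E X Y : (forall A, X A <= Y A) -> E X <= E Y.
Proof. by move=> XY; apply: ler_sum => A _; rewrite ler_wpM2l// p1_pmf_ge0. Qed.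

Lemma E_ge0 X : (forall A, 0 <= X A) -> 0 <= E X.
Proof. by move=> h; rewrite -(E_cst 0); exact: le_E. Qed.

Lemma normE_le X : `|E X| <= E (fun A => `|X A|).
Proof.
rewrite /p1_E; apply: (le_trans (ler_norm_sum _ _ _)).
by apply: ler_sum => A _; rewrite normrM ger0_norm// p1_pmf_ge0.
Qed.

(** A Schur test: a cross term survives only if [r] holds in both directions, it is at most half the
    sum of the two squares, and each index is related to at most [N] others. *)
Lemma E_sqr_sum_orth (T : finType) (P : pred T) (F : T -> adj n -> R)
    (r : rel T) (N : nat) :
  (forall t t', P t -> P t' -> ~~ r t t' -> E (fun A => F t A * F t' A) = 0) ->
  (forall t, (#|r t| <= N)%N) ->
  E (fun A => (\sum_(t | P t) F t A) ^+ 2) <= N%:R * \sum_(t | P t) E (fun A => F t A ^+ 2).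
Proof.
move=> orth cnt.
have -> : E (fun A => (\sum_(t | P t) F t A) ^+ 2) =
    \sum_(t | P t) \sum_(t' | P t') E (fun A => F t A * F t' A).
  rewrite -[RHS]/(\sum_(t | P t) _); under [RHS]eq_bigr do rewrite -E_sum.
  rewrite -E_sum; apply: eq_E => A; rewrite expr2 mulr_suml.
  by apply: eq_bigr => t _; rewrite mulr_sumr.
pose q t := E (fun A => F t A ^+ 2).
have q0 t : 0 <= q t by apply: E_ge0 => A; exact: sqr_ge0.
(* Charging the half of [q t] to [r t t'] and that of [q t'] to [r t' t] makes a bound on the rows
   of [r] sufficient for both halves. *)
apply: (@le_trans _ _ (\sum_(t | P t) \sum_(t' | P t')
   (2^-1 * q t * (r t t')%:R + 2^-1 * q t' * (r t' t)%:R))).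
  apply: ler_sum => t Pt; apply: ler_sum => t' Pt'.
  case rtt : (r t t'); last first.
    by rewrite orth ?rtt// addr_ge0// mulr_ge0// mulr_ge0// invr_ge0.
  case rtt' : (r t' t); last first.
    rewrite (@eq_E _ (fun A => F t' A * F t A)); last by move=> A; rewrite mulrC.
    by rewrite orth ?rtt'// addr_ge0// mulr_ge0// mulr_ge0// invr_ge0.
  rewrite !mulr1 -!EZ -ED; apply: le_E => A.
  have := sqr_ge0 (F t A - F t' A); lra.
have half : \sum_(t | P t) \sum_(t' | P t') 2^-1 * q t * (r t t')%:R <=
    2^-1 * (N%:R * \sum_(t | P t) q t).
  rewrite mulr_sumr mulr_sumr; apply: ler_sum => t Pt.
  have c : \sum_(t' | P t') (r t t')%:R <= N%:R :> R.
    apply: (le_trans _ (_ : (#|r t|)%:R <= _)); last by rewrite ler_nat.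
    rewrite -natr_sum ler_nat -sum1_card big_mkcond [in X in (_ <= X)%N]big_mkcond /=.
    by apply: leq_sum => t' _; rewrite unfold_in; case: (P t'); case: (r t t').
  by rewrite -mulr_sumr; have := ler_wpM2l (q0 t) c; lra.
apply: (@le_trans _ _ (2^-1 * (N%:R * \sum_(t | P t) q t) + 2^-1 * (N%:R * \sum_(t | P t) q t))).
  under eq_bigr do rewrite big_split /=.
  rewrite big_split /=; apply: lerD => //.
  by rewrite exchange_big.
by rewrite -/(q _) ; lra.
Qed.

(** * Sums over four-cycles *)

Lemma card_pair_mem (T1 T2 : finType) (P : pred T1) (a : nat) (V : seq T2) :
  (#|P| <= a)%N -> (#|fun t : T1 * T2 => P t.1 && (t.2 \in V)| <= a * size V)%N.
Proof.
move=> Pa; have -> : #|fun t : T1 * T2 => P t.1 && (t.2 \in V)| = #|predX P (mem V)|.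
  by apply: eq_card => -[x y]; rewrite !unfold_in.
by rewrite cardX leq_mul// card_size.
Qed.

Definition edge_val (x : edge) i j (A : adj n) := x i j (A (i, j)) (A (j, i)).
Local Notation loc := edge_val.
Definition emean (x : edge) i j := E (edge_val x i j).
Local Notation em := emean.
Definition ectr (x : edge) i j (A : adj n) := edge_val x i j A - emean x i j.
Local Notation xi := ectr.
Definition evar (x : edge) i j := E (fun A => ectr x i j A ^+ 2).
Local Notation ev := evar.

Lemma dyad_free_ectr x i j k l :
  ~ (k = i /\ l = j) -> ~ (k = j /\ l = i) -> dyad_free i j (ectr x k l).
Proof.
move=> h1 h2; exact: (@dyad_free_loc i j k l (fun a b => x k l a b - emean x k l)).
Qed.

Lemma dyad_free_edge x i j k l :
  ~ (k = i /\ l = j) -> ~ (k = j /\ l = i) -> dyad_free i j (edge_val x k l).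
Proof. by move=> h1 h2; exact: (@dyad_free_loc i j k l (x k l)). Qed.

Lemma E_locM x i j Y : i != j -> dyad_free i j Y ->
  E (fun A => edge_val x i j A * Y A) = emean x i j * E Y.
Proof.
move=> ij Yf; rewrite /emean (@eq_E (edge_val x i j) (fun A => edge_val x i j A * 1)).
  by rewrite /edge_val !(@E_dyadM i j (x i j))// E_cst mulr1.
by move=> A; rewrite mulr1.
Qed.

Lemma E_ectrM x i j Y : i != j -> dyad_free i j Y ->
  E (fun A => ectr x i j A * Y A) = 0.
Proof.
move=> ij Yf; rewrite /ectr.
under eq_E do rewrite mulrBl.
by rewrite EB E_locM// EZ subrr.
Qed.

Lemma E_ectr_sqrM x i j Y : i != j -> dyad_free i j Y ->
  E (fun A => ectr x i j A ^+ 2 * Y A) = evar x i j * E Y.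
Proof.
move=> ij Yf.
exact: (@E_locM (fun i j a b => (x i j a b - emean x i j) ^+ 2)).
Qed.

Definition distinct_triple (t : 'I_n * 'I_n * 'I_n) : bool :=
  let: (i, j, k) := t in [&& i != j, i != k & j != k].
Definition distinct_quad (t : 'I_n * 'I_n * 'I_n * 'I_n) : bool :=
  let: (i, j, k, l) := t in distinct4 i j k l.

Lemma notin2 (i j u : 'I_n) : u \notin [:: i; j] -> u <> i /\ u <> j.
Proof. by rewrite !inE negb_or => /andP[/eqP ? /eqP ?]. Qed.

Lemma notin3 (i j k u : 'I_n) : u \notin [:: i; j; k] -> [/\ u <> i, u <> j & u <> k].
Proof. by rewrite !inE !negb_or => /and3P[/eqP ? /eqP ? /eqP ?]. Qed.

Lemma notin4 (i j k l u : 'I_n) :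
  u \notin [:: i; j; k; l] -> [/\ u <> i, u <> j, u <> k & u <> l].
Proof. by rewrite !inE !negb_or => /and4P[/eqP ? /eqP ? /eqP ? /eqP ?]. Qed.

(** If t' has a vertex outside t, a centered factor of t' sits on a dyad that t does not meet, and
    the product has mean 0. Only tuples of vertices of t remain, here 2^2; for three and four
    vertices the counts are 3^3 and 4^4. *)
Lemma E_sqr_sum2 x (c : 'I_n -> 'I_n -> R) :
  E (fun A => (\sum_(e : 'I_n * 'I_n | e.1 != e.2) c e.1 e.2 * ectr x e.1 e.2 A) ^+ 2)
  <= 4%:R * \sum_(e : 'I_n * 'I_n | e.1 != e.2) c e.1 e.2 ^+ 2 * evar x e.1 e.2.
Proof.
pose V (t : 'I_n * 'I_n) := [:: t.1; t.2].
pose r (t t' : 'I_n * 'I_n) := (t'.1 \in V t) && (t'.2 \in V t).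
apply: le_trans (@E_sqr_sum_orth _ _ _ r 4 _ _) _.
- move=> [i j] [i' j'] /= ij /eqP ij' rtt.
  rewrite (@eq_E _ (fun A => ectr x i' j' A *
     (c i j * ectr x i j A * c i' j'))); last by move=> A; ring.
  rewrite E_ectrM//; first exact/eqP.
  apply: dyad_freeM => //; apply: dyad_freeM => //.
  move: rtt; rewrite /r /V /= negb_and => /orP[] /notin2[? ?];
    apply: dyad_free_ectr => -[? ?]; subst; congruence.
- move=> t; exact: (@card_pair_mem _ _ (mem (V t)) 2 (V t) (card_size _)).
- rewrite ler_wpM2l//; apply: ler_sum => -[i j] /= ij.
  under eq_E do rewrite exprMn.
  by rewrite EZ /evar.
Qed.

Lemma E_sqr_sum3 x y (c : 'I_n * 'I_n * 'I_n -> R) :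
  E (fun A => (\sum_(t | distinct_triple t) c t * (ectr x t.1.1 t.1.2 A * ectr y t.1.2 t.2 A)) ^+ 2)
  <= 27%:R * \sum_(t | distinct_triple t) c t ^+ 2 * (evar x t.1.1 t.1.2 * evar y t.1.2 t.2).
Proof.
pose V (t : 'I_n * 'I_n * 'I_n) := [:: t.1.1; t.1.2; t.2].
pose r (t t' : 'I_n * 'I_n * 'I_n) :=
  [&& t'.1.1 \in V t, t'.1.2 \in V t & t'.2 \in V t].
apply: le_trans (@E_sqr_sum_orth _ _ _ r 27 _ _) _.
- move=> [[i j] k] [[i' j'] k'] /and3P[/eqP ij /eqP ik /eqP jk].
  move=> /and3P[/eqP ij' /eqP ik' /eqP jk'] /=.
  rewrite /r /V /= !negb_and => /orP[|/orP[]] /notin3[? ? ?].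
  + rewrite (@eq_E _ (fun A => ectr x i' j' A *
      (c (i, j, k) * c (i', j', k') * ectr x i j A * ectr y j k A * ectr y j' k' A)));
      last by move=> A; ring.
    rewrite E_ectrM//; first exact/eqP.
    by do ![apply: dyad_freeM => //]; apply: dyad_free_ectr => -[? ?]; subst; congruence.
  + rewrite (@eq_E _ (fun A => ectr x i' j' A *
      (c (i, j, k) * c (i', j', k') * ectr x i j A * ectr y j k A * ectr y j' k' A)));
      last by move=> A; ring.
    rewrite E_ectrM//; first exact/eqP.
    by do ![apply: dyad_freeM => //]; apply: dyad_free_ectr => -[? ?]; subst; congruence.
  + rewrite (@eq_E _ (fun A => ectr y j' k' A *
      (c (i, j, k) * c (i', j', k') * ectr x i j A * ectr y j k A * ectr x i' j' A)));
      last by move=> A; ring.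
    rewrite E_ectrM//; first exact/eqP.
    by do ![apply: dyad_freeM => //]; apply: dyad_free_ectr => -[? ?]; subst; congruence.
- move=> t; have := @card_pair_mem _ _ _ _ (V t)
    (@card_pair_mem _ _ (mem (V t)) 3 (V t) (card_size _)).
  apply: leq_trans; apply: subset_leq_card.
  by apply/fintype.subsetP => x'; rewrite !unfold_in andbA.
- rewrite ler_wpM2l//; apply: ler_sum => -[[i j] k] /and3P[/eqP ij /eqP ik /eqP jk] /=.
  rewrite (@eq_E _ (fun A => c (i, j, k) ^+ 2 *
     (ectr x i j A ^+ 2 * ectr y j k A ^+ 2))); last by move=> A; ring.
  rewrite EZ E_ectr_sqrM//; first exact/eqP.
  move=> A a b; congr (_ ^+ 2); apply: dyad_free_ectr => -[? ?]; subst; congruence.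
Qed.

(** Two opposite edges cover all vertices of the cycle, so centering these two is enough for
    orthogonality; [Y] may depend freely on the other two dyads. *)
Lemma E_sqr_sum4 x y (Y : 'I_n * 'I_n * 'I_n * 'I_n -> adj n -> R) :
  (forall i j k l u v, u <> v ->
    ~ (u = j /\ v = k) -> ~ (u = k /\ v = j) -> ~ (u = l /\ v = i) -> ~ (u = i /\ v = l) ->
    dyad_free u v (Y (i, j, k, l))) ->
  E (fun A => (\sum_(t | distinct_quad t) ectr x t.1.1.1 t.1.1.2 A * ectr y t.1.2 t.2 A * Y t A) ^+ 2)
  <= 256%:R * \sum_(t | distinct_quad t) evar x t.1.1.1 t.1.1.2 * evar y t.1.2 t.2
      * E (fun A => Y t A ^+ 2).
Proof.
move=> Yf.
pose V (t : 'I_n * 'I_n * 'I_n * 'I_n) := [:: t.1.1.1; t.1.1.2; t.1.2; t.2].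
pose r (t t' : 'I_n * 'I_n * 'I_n * 'I_n) :=
  [&& t'.1.1.1 \in V t, t'.1.1.2 \in V t, t'.1.2 \in V t & t'.2 \in V t].
apply: le_trans (@E_sqr_sum_orth _ _ _ r 256 _ _) _.
- move=> [[[i j] k] l] [[[i' j'] k'] l'] /and5P[/eqP ij /eqP ik /eqP il /eqP jk].
  move=> /andP[/eqP jl /eqP kl].
  move=> /and5P[/eqP ij' /eqP ik' /eqP il' /eqP jk'] /andP[/eqP jl' /eqP kl'] /=.
  (* The missing vertex lies on exactly one of the two centered edges of t'; that edge is the factor
     pulled out. *)
  have caseA : (i' \notin V (i, j, k, l)) || (j' \notin V (i, j, k, l)) ->
     E (fun A => ectr x i j A * ectr y k l A * Y (i, j, k, l) A *
     (ectr x i' j' A * ectr y k' l' A * Y (i', j', k', l') A)) = 0.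
    move=> h; rewrite (@eq_E _ (fun A => ectr x i' j' A *
      (ectr x i j A * ectr y k l A * Y (i, j, k, l) A * ectr y k' l' A
        * Y (i', j', k', l') A))); last by move=> A; ring.
    rewrite E_ectrM//; first exact/eqP.
    case/orP: h => /notin4 /= [? ? ? ?];
      do ![apply: dyad_freeM]; (apply: dyad_free_ectr || apply: Yf);
       solve [congruence | move=> -[? ?]; subst; congruence].
  have caseB : (k' \notin V (i, j, k, l)) || (l' \notin V (i, j, k, l)) ->
     E (fun A => ectr x i j A * ectr y k l A * Y (i, j, k, l) A *
     (ectr x i' j' A * ectr y k' l' A * Y (i', j', k', l') A)) = 0.
    move=> h; rewrite (@eq_E _ (fun A => ectr y k' l' A *
      (ectr x i j A * ectr y k l A * Y (i, j, k, l) A * ectr x i' j' A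
        * Y (i', j', k', l') A))); last by move=> A; ring.
    rewrite E_ectrM//; first exact/eqP.
    case/orP: h => /notin4 /= [? ? ? ?];
      do ![apply: dyad_freeM]; (apply: dyad_free_ectr || apply: Yf);
       solve [congruence | move=> -[? ?]; subst; congruence].
  by rewrite /r /V /= !negb_and => /or4P[] h; [apply: caseA|apply: caseA|apply: caseB|apply: caseB];
    rewrite h ?orbT.
- move=> t; have := @card_pair_mem _ _ _ _ (V t) (@card_pair_mem _ _ _ _ (V t)
    (@card_pair_mem _ _ (mem (V t)) 4 (V t) (card_size _))).
  rewrite /= -!mulnA; apply: leq_trans; apply: subset_leq_card.
  by apply/fintype.subsetP => x'; rewrite !unfold_in -!andbA.
- rewrite ler_wpM2l//; apply: ler_sum => -[[[i j] k] l] /and5P[/eqP ij /eqP ik /eqP il /eqP jk].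
  move=> /andP[/eqP jl /eqP kl] /=.
  rewrite (@eq_E _ (fun A => ectr x i j A ^+ 2 *
     (ectr y k l A ^+ 2 * Y (i, j, k, l) A ^+ 2))); last by move=> A; ring.
  rewrite E_ectr_sqrM//; first last.
  + apply: dyad_freeM => A a b; congr (_ ^+ 2).
      by apply: dyad_free_ectr => -[? ?]; subst; congruence.
    by apply: Yf; solve [congruence | move=> -[? ?]; subst; congruence].
  + exact/eqP.
  rewrite E_ectr_sqrM//; first by rewrite mulrA.
  + exact/eqP.
  + move=> A a b; congr (_ ^+ 2).
    by apply: Yf; solve [congruence | move=> -[? ?]; subst; congruence].
Qed.

Definition sum4 (G : 'I_n -> 'I_n -> 'I_n -> 'I_n -> R) : R :=
  \sum_(t | distinct_quad t) G t.1.1.1 t.1.1.2 t.1.2 t.2.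

Lemma sum4_rot G : sum4 G = sum4 (fun i j k l => G j k l i).
Proof.
rewrite /sum4 (reindex (fun t : 'I_n * 'I_n * 'I_n * 'I_n =>
   (t.1.1.2, t.1.2, t.2, t.1.1.1))) /=.
  apply: eq_bigl => -[[[i j] k] l] /=; rewrite /distinct4.
  rewrite (eq_sym j i) (eq_sym k i) (eq_sym l i).
  by do 6?[case: (_ == _)].
exists (fun t => (t.2, t.1.1.1, t.1.1.2, t.1.2)) => -[[[i j] k] l] //=.
Qed.

Lemma sum4D G H : sum4 (fun i j k l => G i j k l + H i j k l) = sum4 G + sum4 H.
Proof. by rewrite /sum4 big_split. Qed.

Lemma sum4Z c G : sum4 (fun i j k l => c * G i j k l) = c * sum4 G.
Proof. by rewrite /sum4 mulr_sumr. Qed.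

Lemma eq_sum4 G H : (forall i j k l, distinct4 i j k l -> G i j k l = H i j k l) ->
  sum4 G = sum4 H.
Proof. by move=> GH; apply: eq_bigr => -[[[i j] k] l] /= h; exact: GH. Qed.

Lemma sum4_nested (G : 'I_n -> 'I_n -> 'I_n -> 'I_n -> R) :
  \sum_i \sum_j \sum_k \sum_(l | distinct4 i j k l) G i j k l = sum4 G.
Proof.
rewrite pair_big pair_big pair_big_dep /=.
by apply: eq_bigl => -[[[i j] k] l].
Qed.

Lemma sum4_pair (f : 'I_n -> 'I_n -> R) G :
  sum4 (fun i j k l => G i j k l * f i j) =
  \sum_(e : 'I_n * 'I_n | e.1 != e.2)
     (\sum_(q : 'I_n * 'I_n | distinct4 e.1 e.2 q.1 q.2) G e.1 e.2 q.1 q.2) * f e.1 e.2.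
Proof.
under [RHS]eq_bigr do rewrite mulr_suml.
rewrite pair_big_dep /= /sum4.
rewrite (reindex (fun p : ('I_n * 'I_n) * ('I_n * 'I_n) => (p.1, p.2.1, p.2.2))) /=.
  apply: eq_big => [[[i j] [k l]]|[[i j] [k l]]] //=.
  by rewrite /distinct4 /=; case: (_ == _).
by exists (fun t => (t.1.1, (t.1.2, t.2))) => [[[i j] [k l]]|[[[i j] k] l]].
Qed.

Lemma sum4_triple (f : 'I_n -> 'I_n -> 'I_n -> R) G :
  sum4 (fun i j k l => G i j k l * f i j k) =
  \sum_(t | distinct_triple t)
     (\sum_(l | distinct4 t.1.1 t.1.2 t.2 l) G t.1.1 t.1.2 t.2 l) * f t.1.1 t.1.2 t.2.
Proof.
under [RHS]eq_bigr do rewrite mulr_suml.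
rewrite pair_big_dep /= /sum4.
apply: eq_bigl => -[[[i j] k] l] /=.
by rewrite /distinct4 /=; do 6?[case: (_ == _)].
Qed.

Lemma sum4_le_prod G (f g h q : 'I_n -> R) :
  (forall i, 0 <= f i) -> (forall i, 0 <= g i) -> (forall i, 0 <= h i) ->
  (forall i, 0 <= q i) ->
  (forall i j k l, distinct4 i j k l -> G i j k l <= f i * g j * h k * q l) ->
  sum4 G <= (\sum_i f i) * (\sum_i g i) * (\sum_i h i) * (\sum_i q i).
Proof.
move=> f0 g0 h0 q0 GP.
have -> : (\sum_i f i) * (\sum_i g i) * (\sum_i h i) * (\sum_i q i) =
    \sum_(t : 'I_n * 'I_n * 'I_n * 'I_n) f t.1.1.1 * g t.1.1.2 * h t.1.2 * q t.2.
  rewrite -(pair_bigA _ (fun t l => f t.1.1 * g t.1.2 * h t.2 * q l)) /=.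
  rewrite -(pair_bigA _ (fun t k => \sum_l f t.1 * g t.2 * h k * q l)) /=.
  rewrite -(pair_bigA _ (fun i j => \sum_k \sum_l f i * g j * h k * q l)) /=.
  rewrite !mulr_suml; apply: eq_bigr => i _; rewrite [f i * _]mulr_sumr !mulr_suml.
  apply: eq_bigr => j _; rewrite [f i * g j * _]mulr_sumr mulr_suml; apply: eq_bigr => k _.
  by rewrite mulr_sumr.
rewrite /sum4 big_mkcond; apply: ler_sum => -[[[i j] k] l] _ /=.
by case: ifP => [/GP//|_]; rewrite !mulr_ge0.
Qed.

Definition cyc (x1 x2 x3 x4 : edge) (A : adj n) : R :=
  sum4 (fun i j k l => loc x1 i j A * loc x2 j k A * loc x3 k l A * loc x4 l i A).

(** Writing each factor as mean plus centered part gives sixteen terms: [cyc1] has one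
    centered factor and [cyc2] two adjacent ones, while [cyc3] gathers all the terms in
    which the factors 1 and 3 are centered; the terms left over, in which 2 and 4 are
    centered but not all four are, form [cyc4] after a rotation. *)
Definition cyc1 (x1 x2 x3 x4 : edge) (A : adj n) : R :=
  sum4 (fun i j k l => em x2 j k * em x3 k l * em x4 l i * xi x1 i j A).
Definition cyc2 (x1 x2 x3 x4 : edge) (A : adj n) : R :=
  sum4 (fun i j k l => em x3 k l * em x4 l i * (xi x1 i j A * xi x2 j k A)).
Definition cyc3 (x1 x2 x3 x4 : edge) (A : adj n) : R :=
  sum4 (fun i j k l => xi x1 i j A * xi x3 k l A * (loc x2 j k A * loc x4 l i A)).
Definition cyc4 (x1 x2 x3 x4 : edge) (A : adj n) : R :=
  sum4 (fun i j k l => xi x1 i j A * xi x3 k l A *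
   (em x2 j k * em x4 l i + xi x2 j k A * em x4 l i + em x2 j k * xi x4 l i A)).
Definition cyc_mean (x1 x2 x3 x4 : edge) : R :=
  sum4 (fun i j k l => em x1 i j * em x2 j k * em x3 k l * em x4 l i).
Local Notation cycE := cyc_mean.

Lemma cyc_decomp x1 x2 x3 x4 A :
  cyc x1 x2 x3 x4 A = cyc_mean x1 x2 x3 x4
  + (cyc1 x1 x2 x3 x4 A + cyc1 x2 x3 x4 x1 A + cyc1 x3 x4 x1 x2 A + cyc1 x4 x1 x2 x3 A)
  + (cyc2 x1 x2 x3 x4 A + cyc2 x2 x3 x4 x1 A + cyc2 x3 x4 x1 x2 A + cyc2 x4 x1 x2 x3 A)
  + (cyc3 x1 x2 x3 x4 A + cyc4 x2 x3 x4 x1 A).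
Proof.
rewrite /cyc /cyc1 /cyc2 /cyc3 /cyc4 /cyc_mean.
(* Rotations bring the factor of each edge back to its own position ij, jk, kl or li; what remains
   is the expansion of a product of four binomials. *)
rewrite [sum4 (fun i j k l => _ * xi x2 i j A)]sum4_rot.
rewrite [sum4 (fun i j k l => _ * xi x3 i j A)]sum4_rot
  [sum4 (fun i j k l => _ * xi x3 j k A)]sum4_rot.
rewrite [sum4 (fun i j k l => _ * xi x4 i j A)]sum4_rot
  [sum4 (fun i j k l => _ * xi x4 j k A)]sum4_rot
  [sum4 (fun i j k l => _ * xi x4 k l A)]sum4_rot.
rewrite [sum4 (fun i j k l => _ * (xi x2 i j A * _))]sum4_rot.
rewrite [sum4 (fun i j k l => _ * (xi x3 i j A * _))]sum4_rot
  [sum4 (fun i j k l => _ * (xi x3 j k A * _))]sum4_rot.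
rewrite [sum4 (fun i j k l => _ * (xi x4 i j A * _))]sum4_rot
  [sum4 (fun i j k l => _ * (xi x4 j k A * _))]sum4_rot
  [sum4 (fun i j k l => _ * (xi x4 k l A * _))]sum4_rot.
rewrite [sum4 (fun i j k l => xi x2 i j A * _ * _)]sum4_rot.
rewrite -!sum4D; apply: eq_sum4 => i j k l _; rewrite /ectr; ring.
Qed.

(** Bounds in product form let the sums factor. The free vertices give the sums of [u] and [v]
    inside the square, and [w] collects what the means leave at i and j, to be joined with the
    variance of the centered edge. *)
Lemma E_cyc1_sqr_le x1 x2 x3 x4 (w : 'I_n -> 'I_n -> R) (f g u v : 'I_n -> R) :
  (forall i, 0 <= f i) -> (forall i, 0 <= g i) ->
  (forall i, 0 <= u i) -> (forall i, 0 <= v i) ->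
  (forall i j, 0 <= w i j) ->
  (forall i j k l, distinct4 i j k l ->
     0 <= em x2 j k * em x3 k l * em x4 l i <= w i j * (u k * v l)) ->
  (forall i j, i != j -> ev x1 i j * w i j ^+ 2 <= f i * g j) ->
  E (fun A => cyc1 x1 x2 x3 x4 A ^+ 2)
  <= 4 * ((\sum_i f i) * (\sum_i g i) * ((\sum_i u i) * (\sum_i v i)) ^+ 2).
Proof.
move=> f0 g0 u0 v0 w0 cw vw.
rewrite (@eq_E _ (fun A => (\sum_(e : 'I_n * 'I_n | e.1 != e.2)
  (\sum_(q : 'I_n * 'I_n | distinct4 e.1 e.2 q.1 q.2)
     em x2 e.2 q.1 * em x3 q.1 q.2 * em x4 q.2 e.1) * xi x1 e.1 e.2 A) ^+ 2)); last first.
  by move=> A; rewrite /cyc1 (sum4_pair (fun i j => xi x1 i j A)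
    (fun i j k l => em x2 j k * em x3 k l * em x4 l i)).
apply: le_trans (@E_sqr_sum2 x1 (fun i j =>
  \sum_(q : 'I_n * 'I_n | distinct4 i j q.1 q.2) em x2 j q.1 * em x3 q.1 q.2 * em x4 q.2 i)) _.
rewrite ler_wpM2l//.
apply: (@le_trans _ _ (\sum_(e : 'I_n * 'I_n)
   f e.1 * g e.2 * ((\sum_i u i) * (\sum_i v i)) ^+ 2)).
  rewrite big_mkcond; apply: ler_sum => -[i j] _ /=; case: ifP => [ij|_]; last first.
    by rewrite mulr_ge0 ?sqr_ge0// !mulr_ge0.
  apply: (@le_trans _ _ ((w i j * ((\sum_i u i) * (\sum_i v i))) ^+ 2 * ev x1 i j)).
    rewrite ler_wpM2r//; first by apply: E_ge0 => A; exact: sqr_ge0.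
    have c0 : 0 <= \sum_(q : 'I_n * 'I_n | distinct4 i j q.1 q.2)
        em x2 j q.1 * em x3 q.1 q.2 * em x4 q.2 i.
      by apply: sumr_ge0 => -[k l] /= /cw/andP[].
    apply: lerXn2r; rewrite ?nnegrE//; first by rewrite !mulr_ge0// sumr_ge0.
    rewrite big_distrl /= mulr_sumr.
    rewrite (eq_bigr (fun k => \sum_l w i j * (u k * v l))); last first.
      by move=> k _; rewrite mulr_sumr mulr_sumr.
    rewrite pair_big /= big_mkcond; apply: ler_sum => -[k l] _ /=.
    by case: ifP => [/cw/andP[]//|_]; rewrite !mulr_ge0.
  rewrite exprMn mulrAC ler_wpM2r ?sqr_ge0// mulrC; exact: vw.
rewrite -(pair_bigA _ (fun i j => f i * g j * ((\sum_i u i) * (\sum_i v i)) ^+ 2)) /=.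
set S := _ ^+ 2; rewrite !mulr_suml.
by apply: ler_sum => i _; rewrite [f i * _]mulr_sumr mulr_suml.
Qed.

Lemma E_cyc2_sqr_le x1 x2 x3 x4 (w : 'I_n -> 'I_n -> 'I_n -> R) (f g h u : 'I_n -> R) :
  (forall i, 0 <= f i) -> (forall i, 0 <= g i) -> (forall i, 0 <= h i) ->
  (forall i, 0 <= u i) -> (forall i j k, 0 <= w i j k) ->
  (forall i j k l, distinct4 i j k l -> 0 <= em x3 k l * em x4 l i <= w i j k * u l) ->
  (forall i j k, i != j -> j != k ->
     ev x1 i j * ev x2 j k * w i j k ^+ 2 <= f i * g j * h k) ->
  E (fun A => cyc2 x1 x2 x3 x4 A ^+ 2)
  <= 27 * ((\sum_i f i) * (\sum_i g i) * (\sum_i h i) * (\sum_i u i) ^+ 2).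
Proof.
move=> f0 g0 h0 u0 w0 cw vw.
rewrite (@eq_E _ (fun A => (\sum_(t | distinct_triple t)
  (\sum_(l | distinct4 t.1.1 t.1.2 t.2 l) em x3 t.2 l * em x4 l t.1.1)
   * (xi x1 t.1.1 t.1.2 A * xi x2 t.1.2 t.2 A)) ^+ 2)); last first.
  by move=> A; rewrite /cyc2 (sum4_triple (fun i j k => xi x1 i j A * xi x2 j k A)
    (fun i j k l => em x3 k l * em x4 l i)).
apply: le_trans (@E_sqr_sum3 x1 x2 (fun t =>
  \sum_(l | distinct4 t.1.1 t.1.2 t.2 l) em x3 t.2 l * em x4 l t.1.1)) _.
rewrite ler_wpM2l//.
apply: (@le_trans _ _ (\sum_(t : 'I_n * 'I_n * 'I_n)
   f t.1.1 * g t.1.2 * h t.2 * (\sum_i u i) ^+ 2)).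
  rewrite big_mkcond; apply: ler_sum => -[[i j] k] _ /=; case: ifP => [/and3P[ij ik jk]|_];
    last by rewrite mulr_ge0 ?sqr_ge0// !mulr_ge0.
  apply: (@le_trans _ _ ((w i j k * (\sum_i u i)) ^+ 2 * (ev x1 i j * ev x2 j k))).
    rewrite ler_wpM2r//; first by rewrite mulr_ge0//; apply: E_ge0 => A; exact: sqr_ge0.
    have c0 : 0 <= \sum_(l | distinct4 i j k l) em x3 k l * em x4 l i.
      by apply: sumr_ge0 => l /= /cw/andP[].
    apply: lerXn2r; rewrite ?nnegrE//; first by rewrite !mulr_ge0// sumr_ge0.
    rewrite mulr_sumr big_mkcond; apply: ler_sum => l _ /=.
    by case: ifP => [/cw/andP[]//|_]; rewrite !mulr_ge0.
  rewrite exprMn mulrAC ler_wpM2r ?sqr_ge0// mulrC; exact: vw.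
rewrite -(pair_bigA _ (fun t k => f t.1 * g t.2 * h k * (\sum_i u i) ^+ 2)) /=.
rewrite -(pair_bigA _ (fun i j => \sum_k f i * g j * h k * (\sum_i u i) ^+ 2)) /=.
rewrite !mulr_suml; apply: ler_sum => i _; rewrite [f i * _]mulr_sumr !mulr_suml.
by apply: ler_sum => j _; rewrite [f i * g j * _]mulr_sumr mulr_suml.
Qed.

Definition indicator_edge (x : edge) := forall i j a b, x i j a b = 0 \/ x i j a b = 1.

Section Indicators.
Variables (x : edge) (xP : indicator_edge x).

Lemma loc_sqr i j A : loc x i j A ^+ 2 = loc x i j A.
Proof.
by rewrite /edge_val; case: (xP i j (A (i, j)) (A (j, i))) => ->; rewrite ?expr0n ?expr1n.
Qed.

Lemma loc_ge0 i j A : 0 <= loc x i j A.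
Proof. by rewrite -loc_sqr sqr_ge0. Qed.

Lemma emean_ge0 i j : 0 <= em x i j.
Proof. by apply: E_ge0 => A; exact: loc_ge0. Qed.

Lemma emean_le1 i j : em x i j <= 1.
Proof.
rewrite -(@E_cst 1); apply: le_E => A.
by rewrite /edge_val; case: (xP i j (A (i, j)) (A (j, i))) => ->.
Qed.

Lemma evarE i j : ev x i j = em x i j * (1 - em x i j).
Proof.
rewrite /evar (@eq_E _ (fun A => (1 - 2 * em x i j) * loc x i j A
   + em x i j ^+ 2)); last first.
  by move=> A; rewrite /ectr sqrrB loc_sqr; ring.
rewrite ED EZ E_cst /emean -/(em x i j); ring.
Qed.

Lemma evar_le i j : ev x i j <= em x i j.
Proof. by rewrite evarE mulrBr mulr1 gerBl mulr_ge0// emean_ge0. Qed.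

Lemma evar_ge0 i j : 0 <= ev x i j.
Proof. by apply: E_ge0 => A; exact: sqr_ge0. Qed.

Lemma evar_le1 i j : ev x i j <= 1.
Proof. exact: le_trans (evar_le _ _) (emean_le1 _ _). Qed.

End Indicators.

(** The factors 2 and 4 stay uncentered: as indicators they equal their squares, whose mean is the
    product of the two edge means by independence. *)
Lemma E_cyc3_sqr_le x1 x2 x3 x4 (f g h q : 'I_n -> R) :
  indicator_edge x2 -> indicator_edge x4 ->
  (forall i, 0 <= f i) -> (forall i, 0 <= g i) -> (forall i, 0 <= h i) ->
  (forall i, 0 <= q i) ->
  (forall i j k l, distinct4 i j k l ->
    ev x1 i j * ev x3 k l * (em x2 j k * em x4 l i) <= f i * g j * h k * q l) ->
  E (fun A => cyc3 x1 x2 x3 x4 A ^+ 2)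
  <= 256 * ((\sum_i f i) * (\sum_i g i) * (\sum_i h i) * (\sum_i q i)).
Proof.
move=> i2 i4 f0 g0 h0 q0 vw.
apply: le_trans (@E_sqr_sum4 x1 x3 (fun t A =>
   loc x2 t.1.1.2 t.1.2 A * loc x4 t.2 t.1.1.1 A) _) _.
  by move=> i j k l u v uv ? ? ? ?; apply: dyad_freeM; apply: dyad_free_edge => -[? ?];
    subst; intuition.
rewrite ler_wpM2l//; apply: (@sum4_le_prod (fun i j k l => ev x1 i j * ev x3 k l *
  E (fun A => (loc x2 j k A * loc x4 l i A) ^+ 2))) => // i j k l dd.
apply: le_trans (vw _ _ _ _ dd); rewrite ler_wpM2l//.
  by rewrite mulr_ge0//; apply: E_ge0 => A; exact: sqr_ge0.
under eq_E do rewrite exprMn !loc_sqr//.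
case/and5P: dd => /eqP ij /eqP ik /eqP il /eqP jk /andP[/eqP jl /eqP kl].
rewrite E_locM//; first exact/eqP.
by apply: dyad_free_edge => -[? ?]; subst; congruence.
Qed.

Lemma E_cyc4_sqr_le x1 x2 x3 x4 (f g h q : 'I_n -> R) :
  indicator_edge x2 -> indicator_edge x4 ->
  (forall i, 0 <= f i) -> (forall i, 0 <= g i) -> (forall i, 0 <= h i) ->
  (forall i, 0 <= q i) ->
  (forall i j k l, distinct4 i j k l ->
    ev x1 i j * ev x3 k l * (em x2 j k * em x4 l i) <= f i * g j * h k * q l) ->
  E (fun A => cyc4 x1 x2 x3 x4 A ^+ 2)
  <= 2304 * ((\sum_i f i) * (\sum_i g i) * (\sum_i h i) * (\sum_i q i)).
Proof.
move=> i2 i4 f0 g0 h0 q0 vw.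
apply: le_trans (@E_sqr_sum4 x1 x3 (fun t A =>
   em x2 t.1.1.2 t.1.2 * em x4 t.2 t.1.1.1 + xi x2 t.1.1.2 t.1.2 A * em x4 t.2 t.1.1.1
   + em x2 t.1.1.2 t.1.2 * xi x4 t.2 t.1.1.1 A) _) _.
  move=> i j k l u v uv ? ? ? ? /=.
  by apply: dyad_freeD; first apply: dyad_freeD; do ?apply: dyad_freeM => //;
    apply: dyad_free_ectr => -[? ?]; subst; intuition.
(* The 9 is 3 from (a + b + c)^2 <= 3 (a^2 + b^2 + c^2), times three terms each of mean square at
   most the product of the two edge means. *)
rewrite (_ : 2304 = 256 * 9)%R; last by rewrite -natrM.
rewrite -[256 * 9 * _]mulrA ler_wpM2l//.
have -> : 9 * ((\sum_i f i) * (\sum_i g i) * (\sum_i h i) * (\sum_i q i)) =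
    (\sum_i 9 * f i) * (\sum_i g i) * (\sum_i h i) * (\sum_i q i).
  by rewrite -mulr_sumr !mulrA.
apply: (@sum4_le_prod (fun i j k l => ev x1 i j * ev x3 k l *
  E (fun A => (em x2 j k * em x4 l i + xi x2 j k A * em x4 l i
     + em x2 j k * xi x4 l i A) ^+ 2))) => // [i|i j k l dd]; first by rewrite mulr_ge0.
rewrite -!mulrA; have := vw _ _ _ _ dd; rewrite -!mulrA => vw'.
apply: le_trans (_ : 9 * (ev x1 i j * (ev x3 k l * (em x2 j k * em x4 l i))) <= _); last first.
  by rewrite ler_wpM2l.
rewrite [9 * _]mulrCA ler_wpM2l//; first by apply: E_ge0 => A; exact: sqr_ge0.
rewrite [9 * _]mulrCA ler_wpM2l//; first by apply: E_ge0 => A; exact: sqr_ge0.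
apply: (@le_trans _ _ (E (fun A => 3 * (em x2 j k * em x4 l i) ^+ 2
   + (3 * em x4 l i ^+ 2 * xi x2 j k A ^+ 2 + 3 * em x2 j k ^+ 2 * xi x4 l i A ^+ 2)))).
  apply: le_E => A /=.
  set a := em x2 j k * em x4 l i; set b := xi x2 j k A * _; set c := _ * xi x4 l i A.
  have -> : 3 * em x4 l i ^+ 2 * xi x2 j k A ^+ 2 = 3 * b ^+ 2 by rewrite /b; ring.
  have -> : 3 * em x2 j k ^+ 2 * xi x4 l i A ^+ 2 = 3 * c ^+ 2 by rewrite /c; ring.
  have := sqr_ge0 (a - b); have := sqr_ge0 (a - c); have := sqr_ge0 (b - c); lra.
rewrite !ED E_cst !EZ -!/(ev _ _ _).
have a0 := emean_ge0 x2 i2 j k; have a1 := emean_le1 x2 i2 j k; have av := evar_le x2 i2 j k.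
have b0 := emean_ge0 x4 i4 l i; have b1 := emean_le1 x4 i4 l i; have bv := evar_le x4 i4 l i.
have v2 := evar_ge0 x2 j k; have v4 := evar_ge0 x4 l i.
set a := em x2 j k in a0 a1 av *; set b := em x4 l i in b0 b1 bv *.
have ab0 : 0 <= a * b by rewrite mulr_ge0.
have h1 : (a * b) ^+ 2 <= a * b by rewrite expr2 ler_piMl// mulr_ile1.
have h2 : b ^+ 2 * ev x2 j k <= a * b.
  by rewrite mulrC ler_pM ?sqr_ge0// expr2 ler_piMl.
have h3 : a ^+ 2 * ev x4 l i <= a * b.
  by rewrite ler_pM ?sqr_ge0// expr2 ler_piMl.
lra.
Qed.

(** * Stein's method for a sum over independent dyads *)

Section SteinCF.
Variables (z : 'I_n -> 'I_n -> adj n -> R) (dl : R).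
Hypothesis z_free : forall i j k l : 'I_n, ~ (k = i /\ l = j) -> ~ (k = j /\ l = i) ->
  dyad_free i j (z k l).
Hypothesis z_orth : forall i j Y, i != j -> dyad_free i j Y ->
  E (fun A => z i j A * Y A) = 0.
Hypothesis z_sqr : forall i j Y, i != j -> dyad_free i j Y ->
  E (fun A => z i j A ^+ 2 * Y A) = E (fun A => z i j A ^+ 2) * E Y.
Hypothesis z_le : forall i j A, i != j -> `|z i j A| <= dl.

Local Notation T := ('I_n * 'I_n)%type.
Definition zsum (A : adj n) : R := \sum_(e : T | (e.1 < e.2)%N) z e.1 e.2 A.

Hypothesis z_var : \sum_(e : T | (e.1 < e.2)%N) E (fun A => z e.1 e.2 A ^+ 2) = 1.

Lemma E_normB_le (F G : adj n -> R) (H : adj n -> R) :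
  (forall A, `|F A - G A| <= H A) -> `|E F - E G| <= E H.
Proof.
by move=> h; rewrite -EB; apply: le_trans (normE_le _) _; exact: le_E.
Qed.

(** Compare the sum with the same sum without the dyad [e], of which [z e] is
    independent, and use a second order Taylor expansion. *)
Lemma stein_zsum (g g' : R -> R) (B : R) : 0 <= B ->
  (forall x h, `|g (x + h) - g x - h * g' x| <= B * h ^+ 2) ->
  (forall x h, `|g' (x + h) - g' x| <= B * `|h|) ->
  `|E (fun A => zsum A * g (zsum A)) - E (fun A => g' (zsum A))| <= 2 * B * dl.
Proof.
move=> B0 g1 g2.
pose rest (e : T) A := \sum_(f : T | (f.1 < f.2)%N && (f != e)) z f.1 f.2 A.
have zsumE (e : T) A : (e.1 < e.2)%N -> zsum A = rest e A + z e.1 e.2 A.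
  by move=> lt; rewrite /zsum (bigD1 e)//= addrC.
have rest_free (e : T) : (e.1 < e.2)%N -> dyad_free e.1 e.2 (rest e).
  move=> lt; apply: dyad_free_sum => -[k l] /= /andP[kl /eqP ne].
  apply: z_free => -[? ?]; subst; first by apply: ne; rewrite -surjective_pairing.
  by move: (ltn_trans kl lt); rewrite ltnn.
have ne_lt (e : T) : (e.1 < e.2)%N -> e.1 != e.2.
  by move=> lt; rewrite -(inj_eq val_inj) neq_ltn lt.
have step (e : T) : (e.1 < e.2)%N ->
  `|E (fun A => z e.1 e.2 A * g (zsum A)) - E (fun A => z e.1 e.2 A ^+ 2) * E (fun A => g' (zsum A))|
   <= 2 * B * dl * E (fun A => z e.1 e.2 A ^+ 2).
  move=> lt; have ne := ne_lt e lt; set i := e.1 in lt ne *; set j := e.2 in lt ne *.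
  set s2 := E (fun A => z i j A ^+ 2).
  have dl0 : 0 <= dl by apply: le_trans (z_le i j [ffun=> false] ne).
  have s20 : 0 <= s2 by apply: E_ge0 => A; exact: sqr_ge0.
  have grest : dyad_free i j (fun A => g (rest e A)).
    by move=> A a b; congr g; exact: rest_free.
  have g'rest : dyad_free i j (fun A => g' (rest e A)).
    by move=> A a b; congr g'; exact: rest_free.
  have h1 : `|E (fun A => z i j A * g (zsum A)) - s2 * E (fun A => g' (rest e A))| <= B * dl * s2.
    (* The subtracted mean of z g(rest) is 0 by orthogonality; with it, what remains is z times a
       second order Taylor remainder. *)
    rewrite -[E (fun A => z i j A * g (zsum A))]subr0 -(z_orth i j _ ne grest) -EB -z_sqr//.
    apply: le_trans (E_normB_le _ _ (fun A => B * dl * z i j A ^+ 2) _) _; last by rewrite EZ.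
    move=> A; rewrite (zsumE e A lt) -/i -/j.
    set w := rest e A; set x := z i j A.
    rewrite [X in `|X|](_ : _ = x * (g (w + x) - g w - x * g' w)); last by ring.
    rewrite normrM; apply: (@le_trans _ _ (dl * (B * x ^+ 2))).
      by apply: ler_pM => //; exact: z_le.
    by rewrite mulrA [dl * B]mulrC.
  have h2 : `|E (fun A => g' (rest e A)) - E (fun A => g' (zsum A))| <= B * dl.
    apply: le_trans (E_normB_le _ _ (fun=> B * dl) _) _; last by rewrite E_cst.
    move=> A; rewrite (zsumE e A lt) distrC; apply: le_trans (g2 _ _) _.
    by apply: ler_wpM2l => //; exact: z_le.
  rewrite (_ : _ - _ = (E (fun A => z i j A * g (zsum A)) - s2 * E (fun A => g' (rest e A)))
    + s2 * (E (fun A => g' (rest e A)) - E (fun A => g' (zsum A)))); last by ring.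
  apply: le_trans (ler_normD _ _) _; rewrite [`|s2 * _|]normrM (ger0_norm s20).
  have := ler_wpM2l s20 h2; lra.
rewrite (@eq_E _ (fun A => \sum_(e : T | (e.1 < e.2)%N) z e.1 e.2 A * g (zsum A)));
  last by move=> A; rewrite {1}/zsum mulr_suml.
rewrite E_sum -[E (fun A => g' (zsum A))]mul1r -z_var mulr_suml -sumrB.
apply: le_trans (ler_norm_sum _ _ _) _.
apply: (@le_trans _ _ (\sum_(e : T | (e.1 < e.2)%N) 2 * B * dl * E (fun A => z e.1 e.2 A ^+ 2))).
  by apply: ler_sum => e; exact: step.
by rewrite -mulr_sumr z_var mulr1.
Qed.

Lemma sin_taylor_scaled (s x h : R) :
  `|sin (s * (x + h)) - sin (s * x) - h * (s * cos (s * x))| <= s ^+ 2 * h ^+ 2.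
Proof.
have := sin_taylor1 R (s * x) (s * h).
by rewrite -mulrDr exprMn [s * h]mulrC -mulrA.
Qed.

Lemma cos_taylor_scaled (s x h : R) :
  `|cos (s * (x + h)) - cos (s * x) + h * (s * sin (s * x))| <= s ^+ 2 * h ^+ 2.
Proof.
have := cos_taylor1 R (s * x) (s * h).
by rewrite -mulrDr exprMn [s * h]mulrC -mulrA.
Qed.

(** Stein's identity for g(x) = sin (s x), with B = s^2, says that the real part of the
    characteristic function solves F' = - s F up to 2 s^2 [dl]; [gaussian_ode] integrates this error
    from 0 to t. *)
Lemma E_cos_zsum t : 0 <= dl ->
  `|E (fun A => cos (t * zsum A)) - expR (- (t ^+ 2 / 2))| <= 2 * t ^+ 2 * dl * `|t|.
Proof.
move=> dl0.
pose D s := - E (fun A => zsum A * sin (s * zsum A)).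
have FD (s : R) : is_derive s 1 (fun s => E (fun A => cos (s * zsum A))) (D s).
  apply: (@is_derive_quadratic _ _ _ _ (E (fun A => zsum A ^+ 2))) => h.
  rewrite /D mulrN opprK -EB -EZ -ED mulrC -EZ.
  apply: le_trans (normE_le _) _; apply: le_E => A.
  have := cos_taylor1 R (s * zsum A) (h * zsum A).
  by rewrite -mulrDl exprMn mulrA.
have := gaussian_ode R _ D t (2 * t ^+ 2 * dl) FD.
rewrite (_ : E (fun A => cos (0 * zsum A)) = 1); last first.
  by rewrite -[RHS](@E_cst); apply: eq_E => A; rewrite mul0r cos0.
rewrite mul1r; apply => s st.
have := stein_zsum (fun x => sin (s * x)) (fun x => s * cos (s * x)) (s ^+ 2) (sqr_ge0 s)
  (sin_taylor_scaled s) _.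
rewrite EZ /D distrC addrC => h; apply: le_trans (h _) _.
  move=> x h'; rewrite -mulrBr normrM -[s ^+ 2]real_normK ?num_real// expr2 -mulrA.
  apply: ler_wpM2l => //; apply: le_trans (norm_cosB_le _ _ _) _.
  by rewrite -mulrBr addrC addKr normrM.
apply: ler_wpM2r => //; apply: ler_wpM2l => //.
by rewrite -[s ^+ 2]real_normK ?num_real// -[t ^+ 2]real_normK ?num_real// lerXn2r ?nnegrE.
Qed.

Lemma E_sin_zsum t : 0 <= dl -> `|E (fun A => sin (t * zsum A))| <= 2 * t ^+ 2 * dl * `|t|.
Proof.
move=> dl0.
pose D s := E (fun A => zsum A * cos (s * zsum A)).
have FD (s : R) : is_derive s 1 (fun s => E (fun A => sin (s * zsum A))) (D s).
  apply: (@is_derive_quadratic _ _ _ _ (E (fun A => zsum A ^+ 2))) => h.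
  rewrite /D -EB -EZ -EB mulrC -EZ.
  apply: le_trans (normE_le _) _; apply: le_E => A.
  have := sin_taylor1 R (s * zsum A) (h * zsum A).
  by rewrite -mulrDl exprMn mulrA.
have := gaussian_ode R _ D t (2 * t ^+ 2 * dl) FD.
rewrite (_ : E (fun A => sin (0 * zsum A)) = 0); last first.
  by rewrite -[RHS](@E_cst); apply: eq_E => A; rewrite mul0r sin0.
rewrite mul0r subr0; apply => s st.
have := stein_zsum (fun x => cos (s * x)) (fun x => - (s * sin (s * x))) (s ^+ 2) (sqr_ge0 s) _ _.
rewrite EN EZ opprK /D => h; apply: le_trans (h _ _) _.
- by move=> x h'; rewrite mulrN opprK; exact: cos_taylor_scaled.
- move=> x h'; rewrite opprK -normrN opprD opprK -mulrBr normrM.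
  rewrite -[s ^+ 2]real_normK ?num_real// expr2 -mulrA.
  apply: ler_wpM2l => //; apply: le_trans (norm_sinB_le _ _ _) _.
  by rewrite -mulrBr addrC addKr normrM.
apply: ler_wpM2r => //; apply: ler_wpM2l => //.
by rewrite -[s ^+ 2]real_normK ?num_real// -[t ^+ 2]real_normK ?num_real// lerXn2r ?nnegrE.
Qed.

End SteinCF.

(** * Moment bounds for the two cycle counts *)

Local Notation mu := (mu_ gamma alpha).
Local Notation nu := (nu_ gamma beta).
Local Notation eta := (eta_ gamma alpha beta).
Local Notation kap := (expR (rho / 2)).
(** [p1_pair true true i j] is [p1_K i j * (aeta i * aeta j)]: see [emean11]. *)
Definition aeta (i : 'I_n) : R := kap * eta i.
Local Notation a := aeta.
Local Notation K := (p1_K rho gamma alpha beta).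

Definition edge11 : edge := fun i j p q => b2R R [&& i != j, p & q].
Local Notation e11 := edge11.
Definition edge00 : edge := fun i j p q => b2R R [&& i != j, ~~ p & ~~ q].
Local Notation e00 := edge00.
Definition edge10 : edge := fun i j p q => b2R R [&& i != j, p & ~~ q].
Local Notation e10 := edge10.
Definition edge01 : edge := fun i j p q => e10 j i q p.
Local Notation e01 := edge01.

Lemma e11_ind : indicator_edge e11.
Proof. by move=> i j p q; rewrite /edge11; case: [&& _, _ & _]; [right|left]. Qed.
Lemma e00_ind : indicator_edge e00.
Proof. by move=> i j p q; rewrite /edge00; case: [&& _, _ & _]; [right|left]. Qed.
Lemma e10_ind : indicator_edge e10.
Proof. by move=> i j p q; rewrite /edge10; case: [&& _, _ & _]; [right|left]. Qed.
Lemma e01_ind : indicator_edge e01.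
Proof. by move=> i j p q; exact: e10_ind. Qed.

Lemma mu_gt0 i : 0 < mu i. Proof. exact: expR_gt0. Qed.
Lemma nu_gt0 i : 0 < nu i. Proof. exact: expR_gt0. Qed.
Lemma eta_gt0 i : 0 < eta i. Proof. exact: mulr_gt0 (mu_gt0 i) (nu_gt0 i). Qed.
Lemma aeta_gt0 i : 0 < a i. Proof. exact: mulr_gt0 (expR_gt0 _) (eta_gt0 i). Qed.
Lemma mu_ge0 i : 0 <= mu i. Proof. exact/ltW/mu_gt0. Qed.
Lemma nu_ge0 i : 0 <= nu i. Proof. exact/ltW/nu_gt0. Qed.
Lemma eta_ge0 i : 0 <= eta i. Proof. exact/ltW/eta_gt0. Qed.
Lemma aeta_ge0 i : 0 <= a i. Proof. exact/ltW/aeta_gt0. Qed.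

Lemma expR_lin i j : expR (p1_lin gamma alpha beta i j) = mu i * nu j.
Proof. by rewrite /mu_ /nu_ -expRD; congr expR; rewrite /p1_lin; field. Qed.

Lemma expR_recip i j :
  expR (p1_lin gamma alpha beta i j + p1_lin gamma alpha beta j i + rho) = a i * a j.
Proof.
rewrite 2!expRD !expR_lin /aeta /eta_ (_ : expR rho = kap * kap); first by ring.
by rewrite -expRD; congr expR; field.
Qed.

Lemma p1_KE i j : K i j = (1 + mu i * nu j + mu j * nu i + a i * a j)^-1.
Proof. by rewrite /p1_K !expR_lin expR_recip. Qed.

Lemma p1_K_le1 i j : K i j <= 1.
Proof.
have h1 := mulr_ge0 (mu_ge0 i) (nu_ge0 j); have h2 := mulr_ge0 (mu_ge0 j) (nu_ge0 i).
have h3 := mulr_ge0 (aeta_ge0 i) (aeta_ge0 j).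
by rewrite p1_KE invf_le1; lra.
Qed.

Lemma emean_dyad (x : edge) i j : i != j -> em x i j =
  p1_pair rho gamma alpha beta true true i j * x i j true true
  + p1_pair rho gamma alpha beta true false i j * x i j true false
  + p1_pair rho gamma alpha beta false true i j * x i j false true
  + p1_pair rho gamma alpha beta false false i j * x i j false false.
Proof.
move=> ij; have := @E_dyadM i j (x i j) (fun=> 1) ij (fun _ _ _ => erefl).
rewrite E_cst mulr1 => <-; apply: eq_E => A; by rewrite mulr1.
Qed.

Lemma emean11 i j : i != j -> em e11 i j = K i j * (a i * a j).
Proof.
move=> ij; rewrite emean_dyad// /edge11 ij /b2R /= !mulr0 !addr0 mulr1 /p1_pair /b2R.
by rewrite -expR_recip !mul1r.
Qed.

Lemma emean10 i j : i != j -> em e10 i j = K i j * (mu i * nu j).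
Proof.
move=> ij; rewrite emean_dyad// /edge10 ij /b2R /= !mulr0 !addr0 add0r mulr1 /p1_pair /b2R.
by rewrite -expR_lin !mul1r !mul0r !addr0.
Qed.

Lemma emean00 i j : i != j -> em e00 i j = K i j.
Proof.
move=> ij; rewrite emean_dyad// /edge00 ij /b2R /= !mulr0 !add0r mulr1 /p1_pair /b2R.
by rewrite !mul0r !addr0 expR0 mulr1.
Qed.

Lemma emean01 i j : em e01 i j = em e10 j i.
Proof. by []. Qed.

Lemma em_diag (x : edge) i : (forall p q, x i i p q = 0) -> em x i i = 0.
Proof.
by move=> h; rewrite /emean (@eq_E _ (fun=> 0)) ?E_cst// => A; exact: h.
Qed.

Lemma emean11_bounds i j : 0 <= em e11 i j <= a i * a j.
Proof.
rewrite emean_ge0//=; last exact: e11_ind.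
have [->|ij] := eqVneq i j.
  by rewrite em_diag; [exact: mulr_ge0 (aeta_ge0 j) (aeta_ge0 j)|move=> p q; rewrite /edge11 eqxx].
by rewrite emean11//; apply: ler_piMl (p1_K_le1 i j); exact: mulr_ge0 (aeta_ge0 i) (aeta_ge0 j).
Qed.

Lemma emean10_bounds i j : 0 <= em e10 i j <= mu i * nu j.
Proof.
rewrite emean_ge0//=; last exact: e10_ind.
have [->|ij] := eqVneq i j.
  by rewrite em_diag; [exact: mulr_ge0 (mu_ge0 j) (nu_ge0 j)|move=> p q; rewrite /edge10 eqxx].
by rewrite emean10//; apply: ler_piMl (p1_K_le1 i j); exact: mulr_ge0 (mu_ge0 i) (nu_ge0 j).
Qed.

Lemma emean01_bounds i j : 0 <= em e01 i j <= mu j * nu i.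
Proof. exact: emean10_bounds. Qed.

Lemma emean00_bounds i j : 0 <= em e00 i j <= 1.
Proof. by rewrite emean_ge0 ?emean_le1//; exact: e00_ind. Qed.

Lemma evar11_bounds i j : 0 <= ev e11 i j <= a i * a j.
Proof.
rewrite evar_ge0/=; have /andP[_] := emean11_bounds i j; apply: le_trans.
by apply: evar_le; exact: e11_ind.
Qed.

Lemma evar10_bounds i j : 0 <= ev e10 i j <= mu i * nu j.
Proof.
rewrite evar_ge0/=; have /andP[_] := emean10_bounds i j; apply: le_trans.
by apply: evar_le; exact: e10_ind.
Qed.

Lemma evar01_bounds i j : 0 <= ev e01 i j <= mu j * nu i.
Proof.
rewrite evar_ge0/=; have /andP[_] := emean01_bounds i j; apply: le_trans.
by apply: evar_le; exact: e01_ind.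
Qed.

Lemma evar00_bounds i j : 0 <= ev e00 i j <= 1.
Proof. by rewrite evar_ge0/= evar_le1//; exact: e00_ind. Qed.

Lemma bnd2 {x y X Y Z : R} : 0 <= x <= X -> 0 <= y <= Y -> X * Y = Z -> 0 <= x * y <= Z.
Proof. by move=> /andP[? ?] /andP[? ?] <-; rewrite mulr_ge0//= ler_pM. Qed.

Lemma bnd3 {x y z X Y Z W : R} : 0 <= x <= X -> 0 <= y <= Y -> 0 <= z <= Z ->
  X * Y * Z = W -> 0 <= x * y * z <= W.
Proof. by move=> hx hy hz <-; apply: bnd2 hz _ => //; apply: bnd2 hx hy _. Qed.

Lemma bndw {x w X Z : R} : 0 <= x <= X -> X * w ^+ 2 = Z -> x * w ^+ 2 <= Z.
Proof. by move=> /andP[? ?] <-; rewrite ler_wpM2r// sqr_ge0. Qed.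

Lemma bndw2 {x y w X Y Z : R} : 0 <= x <= X -> 0 <= y <= Y ->
  X * Y * w ^+ 2 = Z -> x * y * w ^+ 2 <= Z.
Proof. by move=> hx hy <-; apply: bndw => //; apply: bnd2 hx hy _. Qed.

Lemma bnd4 {x y z w X Y Z W T : R} : 0 <= x <= X -> 0 <= y <= Y -> 0 <= z <= Z ->
  0 <= w <= W -> X * Y * (Z * W) = T -> x * y * (z * w) <= T.
Proof.
move=> hx hy hz hw h.
have h1 := bnd2 hx hy erefl.
have h2 := bnd2 hz hw erefl.
by have /andP[_] := bnd2 h1 h2 h.
Qed.

Local Notation S f := (\sum_(i < n) f i).
Definition l1_mu := S mu.
Local Notation sM := l1_mu.
Definition l1_nu := S nu.
Local Notation sN := l1_nu.
Definition l1_eta := S eta.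
Local Notation sm := l1_eta.
Definition l1_aeta := S a.
Local Notation sa := l1_aeta.
Definition mu_eta := \sum_i mu i * eta i.
Local Notation smu := mu_eta.
Definition nu_eta := \sum_i nu i * eta i.
Local Notation snu := nu_eta.
Definition sqr_mu := \sum_i mu i ^+ 2.
Local Notation mu2 := sqr_mu.
Definition sqr_nu := \sum_i nu i ^+ 2.
Local Notation nu2 := sqr_nu.
Definition sqr_aeta := \sum_i a i ^+ 2.
Local Notation a2 := sqr_aeta.

Ltac pos := intros; repeat lazymatch goal with
  | |- is_true (_ <= _ * _) => apply: mulr_ge0
  | |- is_true (_ <= _ ^+ 2) => exact: sqr_ge0
  | |- is_true (_ <= mu_ _ _ _) => exact: mu_ge0
  | |- is_true (_ <= nu_ _ _ _) => exact: nu_ge0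
  | |- is_true (_ <= eta_ _ _ _ _) => exact: eta_ge0
  | |- is_true (_ <= aeta _) => exact: aeta_ge0
  | |- is_true (_ <= 1) => exact: ler01
  end.
Ltac fin := rewrite /aeta /eta_; ring.

Lemma E_Qa_cyc1_sqr_le1 : E (fun A => cyc1 e11 e00 e01 e00 A ^+ 2)
  <= 4 * (sa * sa * (sN * sM) ^+ 2).
Proof.
apply: (@E_cyc1_sqr_le e11 e00 e01 e00 (fun _ _ => 1) a a nu mu); try solve [pos].
  by move=> i j k l _; apply: bnd3 (emean00_bounds j k) (emean01_bounds k l) (emean00_bounds l i) _; fin.
by move=> i j _; apply: bndw (evar11_bounds i j) _; fin.
Qed.

(** A centered [edge00] has its variance bounded only by 1, so the weights of its endpoints come
    from squared means: sums of squares replace l1 norms, and this is what makes the term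
    negligible. *)
Lemma E_Qa_cyc1_sqr_le2 : E (fun A => cyc1 e00 e01 e00 e11 A ^+ 2)
  <= 4 * (a2 * nu2 * (sM * sa) ^+ 2).
Proof.
apply: (@E_cyc1_sqr_le e00 e01 e00 e11 (fun i j => a i * nu j)
   (fun i => a i ^+ 2) (fun i => nu i ^+ 2) mu a); try solve [pos].
  by move=> i j k l _; apply: bnd3 (emean01_bounds j k) (emean00_bounds k l) (emean11_bounds l i) _; fin.
by move=> i j _; apply: bndw (evar00_bounds i j) _; fin.
Qed.

Lemma E_Qa_cyc1_sqr_le3 : E (fun A => cyc1 e01 e00 e11 e00 A ^+ 2)
  <= 4 * (sN * sM * (sa * sa) ^+ 2).
Proof.
apply: (@E_cyc1_sqr_le e01 e00 e11 e00 (fun i j => 1) nu mu a a); try solve [pos].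
  by move=> i j k l _; apply: bnd3 (emean00_bounds j k) (emean11_bounds k l) (emean00_bounds l i) _; fin.
by move=> i j _; apply: bndw (evar01_bounds i j) _; fin.
Qed.

Lemma E_Qa_cyc1_sqr_le4 : E (fun A => cyc1 e00 e11 e00 e01 A ^+ 2)
  <= 4 * (mu2 * a2 * (sa * sN) ^+ 2).
Proof.
apply: (@E_cyc1_sqr_le e00 e11 e00 e01 (fun i j => mu i * a j)
   (fun i => mu i ^+ 2) (fun i => a i ^+ 2) a nu); try solve [pos].
  by move=> i j k l _; apply: bnd3 (emean11_bounds j k) (emean00_bounds k l) (emean01_bounds l i) _; fin.
by move=> i j _; apply: bndw (evar00_bounds i j) _; fin.
Qed.

Lemma E_Qa_cyc2_sqr_le1 : E (fun A => cyc2 e11 e00 e01 e00 A ^+ 2)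
  <= 27 * (sa * sa * nu2 * sM ^+ 2).
Proof.
apply: (@E_cyc2_sqr_le e11 e00 e01 e00 (fun i j k => nu k)
   a a (fun i => nu i ^+ 2) mu); try solve [pos].
  by move=> i j k l _; apply: bnd2 (emean01_bounds k l) (emean00_bounds l i) _; fin.
by move=> i j k _ _; apply: bndw2 (evar11_bounds i j) (evar00_bounds j k) _; fin.
Qed.

Lemma E_Qa_cyc2_sqr_le2 : E (fun A => cyc2 e00 e01 e00 e11 A ^+ 2)
  <= 27 * (a2 * sN * sM * sa ^+ 2).
Proof.
apply: (@E_cyc2_sqr_le e00 e01 e00 e11 (fun i j k => a i)
   (fun i => a i ^+ 2) nu mu a); try solve [pos].
  by move=> i j k l _; apply: bnd2 (emean00_bounds k l) (emean11_bounds l i) _; fin.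
by move=> i j k _ _; apply: bndw2 (evar00_bounds i j) (evar01_bounds j k) _; fin.
Qed.

Lemma E_Qa_cyc2_sqr_le3 : E (fun A => cyc2 e01 e00 e11 e00 A ^+ 2)
  <= 27 * (sN * sM * a2 * sa ^+ 2).
Proof.
apply: (@E_cyc2_sqr_le e01 e00 e11 e00 (fun i j k => a k)
   nu mu (fun i => a i ^+ 2) a); try solve [pos].
  by move=> i j k l _; apply: bnd2 (emean11_bounds k l) (emean00_bounds l i) _; fin.
by move=> i j k _ _; apply: bndw2 (evar01_bounds i j) (evar00_bounds j k) _; fin.
Qed.

Lemma E_Qa_cyc2_sqr_le4 : E (fun A => cyc2 e00 e11 e00 e01 A ^+ 2)
  <= 27 * (mu2 * sa * sa * sN ^+ 2).
Proof.
apply: (@E_cyc2_sqr_le e00 e11 e00 e01 (fun i j k => mu i)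
   (fun i => mu i ^+ 2) a a nu); try solve [pos].
  by move=> i j k l _; apply: bnd2 (emean00_bounds k l) (emean01_bounds l i) _; fin.
by move=> i j k _ _; apply: bndw2 (evar00_bounds i j) (evar11_bounds j k) _; fin.
Qed.

Lemma E_Qa_cyc3_sqr_le : E (fun A => cyc3 e11 e00 e01 e00 A ^+ 2) <= 256 * (sa * sa * sN * sM).
Proof.
apply: (@E_cyc3_sqr_le e11 e00 e01 e00 a a nu mu e00_ind e00_ind); try solve [pos].
by move=> i j k l _; apply: bnd4 (evar11_bounds i j) (evar01_bounds k l) (emean00_bounds j k) (emean00_bounds l i) _; fin.
Qed.

Lemma E_Qa_cyc4_sqr_le : E (fun A => cyc4 e00 e01 e00 e11 A ^+ 2) <= 2304 * (sa * sN * sM * sa).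
Proof.
apply: (@E_cyc4_sqr_le e00 e01 e00 e11 a nu mu a e01_ind e11_ind); try solve [pos].
by move=> i j k l _; apply: bnd4 (evar00_bounds i j) (evar00_bounds k l) (emean01_bounds j k) (emean11_bounds l i) _; fin.
Qed.

(** Along i -> j -> k and l -> i the vertex weights are eta_i, eta_j, nu_k, mu_l. Centering i -> j
    leaves nu_i mu_j in the means; squared and multiplied by the variance mu_i nu_j it gives nu_i
    eta_i and mu_j eta_j. *)
Lemma E_Qb_cyc1_sqr_le1 : E (fun A => cyc1 e10 e10 e00 e10 A ^+ 2)
  <= 4 * (snu * smu * (sN * sM) ^+ 2).
Proof.
apply: (@E_cyc1_sqr_le e10 e10 e00 e10 (fun i j => nu i * mu j)
   (fun i => nu i * eta i) (fun i => mu i * eta i) nu mu); try solve [pos].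
  by move=> i j k l _; apply: bnd3 (emean10_bounds j k) (emean00_bounds k l) (emean10_bounds l i) _; fin.
by move=> i j _; apply: bndw (evar10_bounds i j) _; fin.
Qed.

Lemma E_Qb_cyc1_sqr_le2 : E (fun A => cyc1 e10 e00 e10 e10 A ^+ 2)
  <= 4 * (snu * sN * (sM * sm) ^+ 2).
Proof.
apply: (@E_cyc1_sqr_le e10 e00 e10 e10 (fun i j => nu i)
   (fun i => nu i * eta i) nu mu eta); try solve [pos].
  by move=> i j k l _; apply: bnd3 (emean00_bounds j k) (emean10_bounds k l) (emean10_bounds l i) _; fin.
by move=> i j _; apply: bndw (evar10_bounds i j) _; fin.
Qed.

Lemma E_Qb_cyc1_sqr_le3 : E (fun A => cyc1 e00 e10 e10 e10 A ^+ 2)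
  <= 4 * (nu2 * mu2 * (sm * sm) ^+ 2).
Proof.
apply: (@E_cyc1_sqr_le e00 e10 e10 e10 (fun i j => nu i * mu j)
   (fun i => nu i ^+ 2) (fun i => mu i ^+ 2) eta eta); try solve [pos].
  by move=> i j k l _; apply: bnd3 (emean10_bounds j k) (emean10_bounds k l) (emean10_bounds l i) _; fin.
by move=> i j _; apply: bndw (evar00_bounds i j) _; fin.
Qed.

Lemma E_Qb_cyc1_sqr_le4 : E (fun A => cyc1 e10 e10 e10 e00 A ^+ 2)
  <= 4 * (sM * smu * (sm * sN) ^+ 2).
Proof.
apply: (@E_cyc1_sqr_le e10 e10 e10 e00 (fun i j => mu j)
   mu (fun i => mu i * eta i) eta nu); try solve [pos].
  by move=> i j k l _; apply: bnd3 (emean10_bounds j k) (emean10_bounds k l) (emean00_bounds l i) _; fin.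
by move=> i j _; apply: bndw (evar10_bounds i j) _; fin.
Qed.

Lemma E_Qb_cyc2_sqr_le1 : E (fun A => cyc2 e10 e10 e00 e10 A ^+ 2)
  <= 27 * (snu * sm * sN * sM ^+ 2).
Proof.
apply: (@E_cyc2_sqr_le e10 e10 e00 e10 (fun i j k => nu i)
   (fun i => nu i * eta i) eta nu mu); try solve [pos].
  by move=> i j k l _; apply: bnd2 (emean00_bounds k l) (emean10_bounds l i) _; fin.
by move=> i j k _ _; apply: bndw2 (evar10_bounds i j) (evar10_bounds j k) _; fin.
Qed.

Lemma E_Qb_cyc2_sqr_le2 : E (fun A => cyc2 e10 e00 e10 e10 A ^+ 2)
  <= 27 * (snu * sN * mu2 * sm ^+ 2).
Proof.
apply: (@E_cyc2_sqr_le e10 e00 e10 e10 (fun i j k => nu i * mu k)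
   (fun i => nu i * eta i) nu (fun i => mu i ^+ 2) eta); try solve [pos].
  by move=> i j k l _; apply: bnd2 (emean10_bounds k l) (emean10_bounds l i) _; fin.
by move=> i j k _ _; apply: bndw2 (evar10_bounds i j) (evar00_bounds j k) _; fin.
Qed.

Lemma E_Qb_cyc2_sqr_le3 : E (fun A => cyc2 e00 e10 e10 e10 A ^+ 2)
  <= 27 * (nu2 * sM * smu * sm ^+ 2).
Proof.
apply: (@E_cyc2_sqr_le e00 e10 e10 e10 (fun i j k => nu i * mu k)
   (fun i => nu i ^+ 2) mu (fun i => mu i * eta i) eta); try solve [pos].
  by move=> i j k l _; apply: bnd2 (emean10_bounds k l) (emean10_bounds l i) _; fin.
by move=> i j k _ _; apply: bndw2 (evar00_bounds i j) (evar10_bounds j k) _; fin.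
Qed.

Lemma E_Qb_cyc2_sqr_le4 : E (fun A => cyc2 e10 e10 e10 e00 A ^+ 2)
  <= 27 * (sM * sm * smu * sN ^+ 2).
Proof.
apply: (@E_cyc2_sqr_le e10 e10 e10 e00 (fun i j k => mu k)
   mu eta (fun i => mu i * eta i) nu); try solve [pos].
  by move=> i j k l _; apply: bnd2 (emean10_bounds k l) (emean00_bounds l i) _; fin.
by move=> i j k _ _; apply: bndw2 (evar10_bounds i j) (evar10_bounds j k) _; fin.
Qed.

Lemma E_Qb_cyc3_sqr_le : E (fun A => cyc3 e10 e10 e00 e10 A ^+ 2) <= 256 * (sm * sm * sN * sM).
Proof.
apply: (@E_cyc3_sqr_le e10 e10 e00 e10 eta eta nu mu e10_ind e10_ind); try solve [pos].
by move=> i j k l _; apply: bnd4 (evar10_bounds i j) (evar00_bounds k l) (emean10_bounds j k) (emean10_bounds l i) _; fin.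
Qed.

Lemma E_Qb_cyc4_sqr_le : E (fun A => cyc4 e10 e00 e10 e10 A ^+ 2) <= 2304 * (sm * sN * sM * sm).
Proof.
apply: (@E_cyc4_sqr_le e10 e00 e10 e10 eta nu mu eta e00_ind e10_ind); try solve [pos].
by move=> i j k l _; apply: bnd4 (evar10_bounds i j) (evar10_bounds k l) (emean00_bounds j k) (emean10_bounds l i) _; fin.
Qed.

(** * Linear part and remainder *)

Lemma QaE (A : adj n) : Qa R A = cyc e11 e00 e01 e00 A.
Proof. exact: sum4_nested. Qed.

Lemma QbE (A : adj n) : Qb R A = cyc e10 e10 e00 e10 A.
Proof. exact: sum4_nested. Qed.

Lemma expR_rho : expR rho = kap ^+ 2.
Proof. by rewrite expr2 -expRD; congr expR; field. Qed.

Lemma p1_KC i j : p1_K rho gamma alpha beta i j = p1_K rho gamma alpha beta j i.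
Proof. by rewrite !p1_KE; congr (_^-1); ring. Qed.

(** True cycle by cycle: both patterns use the same four dyads, hence the same factors [p1_K], and
    the same product of vertex weights; only the reciprocal edge brings e^rho. *)
Lemma cycE_balance : cycE e11 e00 e01 e00 = expR rho * cycE e10 e10 e00 e10.
Proof.
rewrite -sum4Z expR_rho; apply: eq_sum4 => i j k l /and5P[ij ik il jk /andP[jl kl]].
rewrite emean11// !emean00// ?[l == i]eq_sym// emean01 !emean10// ?[l == _]eq_sym//; try by rewrite eq_sym.
rewrite [p1_K _ _ _ _ l k]p1_KC /aeta /eta_; ring.
Qed.

Definition lin_part (A : adj n) : R :=
  cyc1 e11 e00 e01 e00 A + cyc1 e01 e00 e11 e00 A
  - expR rho * (cyc1 e10 e10 e00 e10 A + cyc1 e10 e00 e10 e10 A + cyc1 e10 e10 e10 e00 A).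
Local Notation Lin := lin_part.

Definition rem_a (A : adj n) : R :=
  cyc1 e00 e01 e00 e11 A + cyc1 e00 e11 e00 e01 A
  + (cyc2 e11 e00 e01 e00 A + cyc2 e00 e01 e00 e11 A + cyc2 e01 e00 e11 e00 A + cyc2 e00 e11 e00 e01 A)
  + (cyc3 e11 e00 e01 e00 A + cyc4 e00 e01 e00 e11 A).

Definition rem_b (A : adj n) : R :=
  cyc1 e00 e10 e10 e10 A
  + (cyc2 e10 e10 e00 e10 A + cyc2 e10 e00 e10 e10 A + cyc2 e00 e10 e10 e10 A + cyc2 e10 e10 e10 e00 A)
  + (cyc3 e10 e10 e00 e10 A + cyc4 e10 e00 e10 e10 A).

Lemma Ustat_decomp A : Ustat rho A = lin_part A + (rem_a A - expR rho * rem_b A).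
Proof.
rewrite /Ustat QaE QbE !(@cyc_decomp) cycE_balance.
rewrite /lin_part /rem_a /rem_b; ring.
Qed.

Lemma Qb_decomp A : Qb R A = cycE e10 e10 e00 e10 + (cyc1 e10 e10 e00 e10 A + cyc1 e10 e00 e10 e10 A
   + cyc1 e10 e10 e10 e00 A + rem_b A).
Proof. by rewrite QbE (@cyc_decomp) /rem_b; ring. Qed.

(** * Second moments of the remainder and of the linear part *)

Section Small.
Variable d : R.
Hypotheses (d_gt0 : 0 < d) (d_le1 : d <= 1).
Hypotheses (mu_le : forall i, mu i <= d) (nu_le : forall i, nu i <= d)
  (a_le : forall i, a i <= d) (sm_ge : 1 <= d * sm) (sa_ge : 1 <= d * sa).

Lemma saE : sa = kap * sm.
Proof. by rewrite /l1_aeta /l1_eta mulr_sumr. Qed.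

Lemma sM_ge0 : 0 <= sM. Proof. by apply: sumr_ge0 => i _; exact: mu_ge0. Qed.
Lemma sN_ge0 : 0 <= sN. Proof. by apply: sumr_ge0 => i _; exact: nu_ge0. Qed.
Lemma sm_ge0 : 0 <= sm. Proof. by apply: sumr_ge0 => i _; exact: eta_ge0. Qed.
Lemma sa_ge0 : 0 <= sa. Proof. by apply: sumr_ge0 => i _; exact: aeta_ge0. Qed.
Lemma smu_ge0 : 0 <= smu.
Proof. by apply: sumr_ge0 => i _; exact: mulr_ge0 (mu_ge0 i) (eta_ge0 i). Qed.
Lemma snu_ge0 : 0 <= snu.
Proof. by apply: sumr_ge0 => i _; exact: mulr_ge0 (nu_ge0 i) (eta_ge0 i). Qed.

Lemma sm_le_sN : sm <= d * sN.
Proof.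
rewrite mulr_sumr; apply: ler_sum => i _.
exact: ler_wpM2r (nu_ge0 i) _ _ (mu_le i).
Qed.

Lemma sm_le_sM : sm <= d * sM.
Proof.
rewrite mulr_sumr; apply: ler_sum => i _; rewrite [eta i]mulrC.
exact: ler_wpM2r (mu_ge0 i) _ _ (nu_le i).
Qed.

Lemma smu_le : smu <= d * sm.
Proof.
by rewrite mulr_sumr; apply: ler_sum => i _; exact: ler_wpM2r (eta_ge0 i) _ _ (mu_le i).
Qed.

Lemma snu_le : snu <= d * sm.
Proof.
by rewrite mulr_sumr; apply: ler_sum => i _; exact: ler_wpM2r (eta_ge0 i) _ _ (nu_le i).
Qed.

Lemma mu2_le : mu2 <= d * sM.
Proof.
by rewrite mulr_sumr; apply: ler_sum => i _; exact: ler_wpM2r (mu_ge0 i) _ _ (mu_le i).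
Qed.

Lemma nu2_le : nu2 <= d * sN.
Proof.
by rewrite mulr_sumr; apply: ler_sum => i _; exact: ler_wpM2r (nu_ge0 i) _ _ (nu_le i).
Qed.

Lemma a2_le : a2 <= d * sa.
Proof.
by rewrite mulr_sumr; apply: ler_sum => i _; exact: ler_wpM2r (aeta_ge0 i) _ _ (a_le i).
Qed.

Lemma a2_le_snu : a2 <= kap ^+ 2 * d * snu.
Proof.
rewrite mulr_sumr; apply: ler_sum => i _.
rewrite (_ : a i ^+ 2 = kap ^+ 2 * mu i * (nu i * eta i)); last by rewrite /aeta /eta_; ring.
apply: ler_wpM2r; first exact: mulr_ge0 (nu_ge0 i) (eta_ge0 i).
exact: ler_wpM2l (sqr_ge0 _) _ _ (mu_le i).
Qed.

Lemma a2_le_smu : a2 <= kap ^+ 2 * d * smu.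
Proof.
rewrite mulr_sumr; apply: ler_sum => i _.
rewrite (_ : a i ^+ 2 = kap ^+ 2 * nu i * (mu i * eta i)); last by rewrite /aeta /eta_; ring.
apply: ler_wpM2r; first exact: mulr_ge0 (mu_ge0 i) (eta_ge0 i).
exact: ler_wpM2l (sqr_ge0 _) _ _ (nu_le i).
Qed.

Lemma mu2_ge0 : 0 <= mu2. Proof. by apply: sumr_ge0 => i _; exact: sqr_ge0. Qed.
Lemma nu2_ge0 : 0 <= nu2. Proof. by apply: sumr_ge0 => i _; exact: sqr_ge0. Qed.
Lemma a2_ge0 : 0 <= a2. Proof. by apply: sumr_ge0 => i _; exact: sqr_ge0. Qed.

Lemma sm_ge1 : 1 <= sm.
Proof. by apply: le_trans sm_ge _; rewrite ler_piMl// sm_ge0. Qed.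
Lemma sa_ge1 : 1 <= sa.
Proof. by apply: le_trans sa_ge _; rewrite ler_piMl// sa_ge0. Qed.
Lemma sM_ge : 1 <= d * sM.
Proof. exact: le_trans sm_ge1 sm_le_sM. Qed.
Lemma sN_ge : 1 <= d * sN.
Proof. exact: le_trans sm_ge1 sm_le_sN. Qed.
Lemma sM_ge1 : 1 <= sM.
Proof. by apply: le_trans sM_ge _; rewrite ler_piMl// sM_ge0. Qed.
Lemma sN_ge1 : 1 <= sN.
Proof. by apply: le_trans sN_ge _; rewrite ler_piMl// sN_ge0. Qed.

Definition var_scale_b : R := v0b R sM sN sm smu snu.
Definition var_scale : R := v0 R sM sN sm sa kap smu snu.

Let kap_gt0 : 0 < kap. Proof. exact: expR_gt0. Qed.

Lemma var_scale_b_gt0 : 0 < var_scale_b.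
Proof. exact: (v0b_gt0 R d sM sN sm smu snu d_gt0 d_le1 sM_ge sN_ge sm_ge smu_ge0 snu_ge0). Qed.

Lemma var_scale_gt0 : 0 < var_scale.
Proof. by apply: (v0_gt0 R d); rewrite ?sM_ge ?sN_ge ?smu_ge0 ?snu_ge0. Qed.

Lemma sqr_add2_le (x y : R) : (x + y) ^+ 2 <= 2 * (x ^+ 2 + y ^+ 2).
Proof. by have := sqr_ge0 (x - y); lra. Qed.

Lemma sqr_add3_le (x y z : R) : (x + y + z) ^+ 2 <= 3 * (x ^+ 2 + y ^+ 2 + z ^+ 2).
Proof.
by have := sqr_ge0 (x - y); have := sqr_ge0 (x - z); have := sqr_ge0 (y - z); lra.
Qed.

Lemma sqr_add4_le (x y z t : R) :
  (x + y + z + t) ^+ 2 <= 4 * (x ^+ 2 + y ^+ 2 + z ^+ 2 + t ^+ 2).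
Proof.
by have := sqr_add2_le (x + y) (z + t); have := sqr_add2_le x y; have := sqr_add2_le z t; lra.
Qed.

Lemma E_add2_le X Y : E (fun A => (X A + Y A) ^+ 2) <=
  2 * (E (fun A => X A ^+ 2) + E (fun A => Y A ^+ 2)).
Proof. by rewrite -!ED -EZ; apply: le_E => A; exact: sqr_add2_le. Qed.

Lemma E_add3_le X Y Z : E (fun A => (X A + Y A + Z A) ^+ 2) <=
  3 * (E (fun A => X A ^+ 2) + E (fun A => Y A ^+ 2) + E (fun A => Z A ^+ 2)).
Proof. by rewrite -!ED -EZ; apply: le_E => A; exact: sqr_add3_le. Qed.

Lemma E_add4_le X Y Z T : E (fun A => (X A + Y A + Z A + T A) ^+ 2) <=
  4 * (E (fun A => X A ^+ 2) + E (fun A => Y A ^+ 2) + E (fun A => Z A ^+ 2)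
   + E (fun A => T A ^+ 2)).
Proof. by rewrite -!ED -EZ; apply: le_E => A; exact: sqr_add4_le. Qed.

(** 12 = 3 * 4: three groups of terms, each of at most four summands. *)
Lemma E_rem_a_sqr_le : E (fun A => rem_a A ^+ 2) <= 12 * (2676 * (d * var_scale)).
Proof.
have := remA_le R d sM sN sm sa kap smu snu mu2 nu2 a2 d_gt0 d_le1 kap_gt0 saE
  sM_ge sN_ge sm_ge sa_ge smu_ge0 snu_ge0 mu2_ge0 nu2_ge0 a2_ge0 mu2_le nu2_le a2_le
  a2_le_snu a2_le_smu.
have := E_Qa_cyc1_sqr_le2; have := E_Qa_cyc1_sqr_le4.
have := E_Qa_cyc2_sqr_le1; have := E_Qa_cyc2_sqr_le2.
have := E_Qa_cyc2_sqr_le3; have := E_Qa_cyc2_sqr_le4.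
have := E_Qa_cyc3_sqr_le; have := E_Qa_cyc4_sqr_le.
rewrite -/var_scale; move: (d * var_scale) => dV; rewrite /rem_a.
move: (_ * (a2 * nu2 * _)) (_ * (mu2 * a2 * _)) (_ * (sa * sa * nu2 * _)) (_ * (a2 * sN * _ * _))
  (_ * (sN * sM * a2 * _)) (_ * (mu2 * sa * sa * _)) (_ * (sa * sa * sN * _))
  (_ * (sa * sN * sM * sa)) => c1 c2 c3 c4 c5 c6 c7 c8 h8 h7 h6 h5 h4 h3 h2 h1 h.
apply: le_trans (E_add3_le _ _ _) _.
have := E_add2_le (cyc1 e00 e01 e00 e11) (cyc1 e00 e11 e00 e01).
have := E_add4_le (cyc2 e11 e00 e01 e00) (cyc2 e00 e01 e00 e11) (cyc2 e01 e00 e11 e00)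
  (cyc2 e00 e11 e00 e01).
have := E_add2_le (cyc3 e11 e00 e01 e00) (cyc4 e00 e01 e00 e11).
have p1 : 0 <= E (fun A => cyc1 e00 e01 e00 e11 A ^+ 2) by apply: E_ge0 => A; exact: sqr_ge0.
have p2 : 0 <= E (fun A => cyc1 e00 e11 e00 e01 A ^+ 2) by apply: E_ge0 => A; exact: sqr_ge0.
have p3 : 0 <= E (fun A => cyc3 e11 e00 e01 e00 A ^+ 2) by apply: E_ge0 => A; exact: sqr_ge0.
have p4 : 0 <= E (fun A => cyc4 e00 e01 e00 e11 A ^+ 2) by apply: E_ge0 => A; exact: sqr_ge0.
lra.
Qed.

Lemma E_rem_b_sqr_le : E (fun A => rem_b A ^+ 2) <= 12 * (2672 * (d * var_scale_b)).
Proof.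
have := remB_le R d sM sN sm smu snu mu2 nu2 d_gt0 d_le1
  sM_ge sN_ge sm_ge smu_ge0 snu_ge0 mu2_ge0 nu2_ge0 mu2_le nu2_le.
have := E_Qb_cyc1_sqr_le3.
have := E_Qb_cyc2_sqr_le1; have := E_Qb_cyc2_sqr_le2.
have := E_Qb_cyc2_sqr_le3; have := E_Qb_cyc2_sqr_le4.
have := E_Qb_cyc3_sqr_le; have := E_Qb_cyc4_sqr_le.
rewrite -/var_scale_b; move: (d * var_scale_b) => dV; rewrite /rem_b.
move: (_ * (nu2 * mu2 * _)) (_ * (snu * sm * sN * _)) (_ * (snu * sN * mu2 * _))
  (_ * (nu2 * sM * smu * _)) (_ * (sM * sm * smu * _)) (_ * (sm * sm * sN * _))
  (_ * (sm * sN * sM * sm)) => c1 c2 c3 c4 c5 c6 c7 h7 h6 h5 h4 h3 h2 h1 h.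
apply: le_trans (E_add3_le _ _ _) _.
have := E_add4_le (cyc2 e10 e10 e00 e10) (cyc2 e10 e00 e10 e10) (cyc2 e00 e10 e10 e10)
  (cyc2 e10 e10 e10 e00).
have := E_add2_le (cyc3 e10 e10 e00 e10) (cyc4 e10 e00 e10 e10).
have p1 : 0 <= E (fun A => cyc1 e00 e10 e10 e10 A ^+ 2) by apply: E_ge0 => A; exact: sqr_ge0.
have p3 : 0 <= E (fun A => cyc3 e10 e10 e00 e10 A ^+ 2) by apply: E_ge0 => A; exact: sqr_ge0.
have p4 : 0 <= E (fun A => cyc4 e10 e00 e10 e10 A ^+ 2) by apply: E_ge0 => A; exact: sqr_ge0.
lra.
Qed.

Definition rem_part (A : adj n) : R := rem_a A - expR rho * rem_b A.

Lemma var_scale_geb : kap ^+ 4 * var_scale_b <= var_scale.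
Proof. exact (v0_ge R sM sN sm sa kap smu snu). Qed.

(** The constant rounds up 2 * 12 * (2676 + 2672) = 128352; the factor e^(2 rho) in front of the
    second remainder is absorbed by [var_scale_geb]. *)
Lemma E_rem_part_sqr_le : E (fun A => rem_part A ^+ 2) <= 300 * 500 * (d * var_scale).
Proof.
rewrite /rem_part; apply: (@le_trans _ _ (E (fun A => 2 * rem_a A ^+ 2 + 2 * kap ^+ 4 * rem_b A ^+ 2))).
  apply: le_E => A.
  rewrite (_ : 2 * kap ^+ 4 * rem_b A ^+ 2 = 2 * (- (expR rho * rem_b A)) ^+ 2).
    by have := sqr_add2_le (rem_a A) (- (expR rho * rem_b A)); lra.
  by rewrite expR_rho; ring.
rewrite ED !EZ.
have k4 : 0 <= kap ^+ 4 by rewrite exprn_ge0// ltW.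
have h1 := E_rem_a_sqr_le; have h2 := ler_wpM2l k4 E_rem_b_sqr_le.
have h3 := ler_wpM2l (ltW d_gt0) var_scale_geb.
have dV0 : 0 <= d * var_scale by apply/ltW; exact: mulr_gt0 d_gt0 var_scale_gt0.
move: h1 h2 h3; move: (E _) (E _) (kap ^+ 4) => x y k h1 h2 h3.
lra.
Qed.

Let mainB := mainB_le R d sM sN sm smu snu d_gt0 d_le1 sM_ge sN_ge sm_ge.
Let mainA := mainA_le R d sM sN sm sa kap smu snu d_gt0 d_le1 kap_gt0 saE
  sM_ge sN_ge sm_ge smu_ge0 snu_ge0.

Lemma E_cyc1b_sqr_le : E (fun A => (cyc1 e10 e10 e00 e10 A + cyc1 e10 e00 e10 e10 A
   + cyc1 e10 e10 e10 e00 A) ^+ 2) <= 12 * var_scale_b.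
Proof.
apply: le_trans (E_add3_le (cyc1 e10 e10 e00 e10) (cyc1 e10 e00 e10 e10) (cyc1 e10 e10 e10 e00)) _.
move: mainB (E_Qb_cyc1_sqr_le1) (E_Qb_cyc1_sqr_le2)
  (E_Qb_cyc1_sqr_le4); rewrite -/var_scale_b.
move: (snu * smu * _) (snu * sN * _) (sM * smu * _) => x y z; lra.
Qed.

(** 40 = 2 * 2 * 4 + 2 * 12, from the two linear terms of Q_n(a) and the three of Q_n(b). *)
Lemma E_lin_part_sqr_le : E (fun A => lin_part A ^+ 2) <= 40 * var_scale.
Proof.
rewrite /lin_part; set b := fun A => cyc1 e10 e10 e00 e10 A + cyc1 e10 e00 e10 e10 A
   + cyc1 e10 e10 e10 e00 A.
apply: (@le_trans _ _ (E (fun A => 2 * (cyc1 e11 e00 e01 e00 A + cyc1 e01 e00 e11 e00 A) ^+ 2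
  + 2 * kap ^+ 4 * b A ^+ 2))).
  apply: le_E => A.
  rewrite (_ : 2 * kap ^+ 4 * b A ^+ 2 = 2 * (- (expR rho * b A)) ^+ 2).
    by have := sqr_add2_le (cyc1 e11 e00 e01 e00 A + cyc1 e01 e00 e11 e00 A)
      (- (expR rho * b A)); rewrite /b; lra.
  by rewrite expR_rho; ring.
rewrite ED !EZ.
have k4 : 0 <= kap ^+ 4 by rewrite exprn_ge0// ltW.
have h2 := ler_wpM2l k4 E_cyc1b_sqr_le; have h3 := var_scale_geb.
have h4 := E_add2_le (cyc1 e11 e00 e01 e00) (cyc1 e01 e00 e11 e00).
move: mainA (E_Qa_cyc1_sqr_le1) (E_Qa_cyc1_sqr_le3).
rewrite -/var_scale_b -[X in _ <= X -> _]/var_scale.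
move: h2 h3 h4; rewrite -/b; move: (sa * sa * _) (sN * sM * _) => x y.
move: (kap ^+ 4) => k; lra.
Qed.

Lemma E_Qb_var_le : E (fun A => (Qb R A - cycE e10 e10 e00 e10) ^+ 2) <= 300 * 300 * var_scale_b.
Proof.
rewrite (@eq_E _ (fun A => (cyc1 e10 e10 e00 e10 A + cyc1 e10 e00 e10 e10 A
   + cyc1 e10 e10 e10 e00 A + rem_b A) ^+ 2)); last first.
  by move=> A; rewrite Qb_decomp addrC addKr.
apply: le_trans (E_add2_le (fun A => cyc1 e10 e10 e00 e10 A + cyc1 e10 e00 e10 e10 A
   + cyc1 e10 e10 e10 e00 A) rem_b) _.
have := E_cyc1b_sqr_le; have := E_rem_b_sqr_le.
have := var_scale_b_gt0 => /ltW var_scale.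
have : d * var_scale_b <= var_scale_b by rewrite ler_piMl.
lra.
Qed.

End Small.

Local Notation V0 := var_scale.
Local Notation V0b := var_scale_b.
Local Notation Rem := rem_part.

(** * Coefficients of the linear part *)

Lemma sum_pair_prod (u w : 'I_n -> R) :
  \sum_(q : 'I_n * 'I_n) u q.1 * w q.2 = (\sum_i u i) * (\sum_i w i).
Proof.
rewrite -(pair_bigA _ (fun i j => u i * w j)) /= mulr_suml.
by apply: eq_bigr => i _; rewrite mulr_sumr.
Qed.

Lemma sum_at (f : 'I_n -> R) i : \sum_k (k == i)%:R * f k = f i.
Proof.
rewrite (bigD1 i)//= eqxx mul1r big1 ?addr0// => k /negPf ->.
by rewrite mul0r.
Qed.

(** A union bound over the five coincidences k = i, k = j, l = i, l = j, k = l; each removes at most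
    the share d of the full sum, since no vertex holds more than that share. *)
Lemma sum_distinct_ge (d : R) (i j : 'I_n) (u w : 'I_n -> R) :
  i != j -> 0 <= d ->
  (forall k, 0 <= u k <= d * (\sum_k u k)) -> (forall k, 0 <= w k <= d * (\sum_k w k)) ->
  (1 - 5 * d) * ((\sum_k u k) * (\sum_k w k)) <=
  \sum_(q : 'I_n * 'I_n | distinct4 i j q.1 q.2) u q.1 * w q.2.
Proof.
move=> ij d0 hu hw; set Su := \sum_k u k; set Sw := \sum_k w k.
have u0 k : 0 <= u k by have /andP[] := hu k.
have w0 k : 0 <= w k by have /andP[] := hw k.
have Su0 : 0 <= Su by apply: sumr_ge0.
have Sw0 : 0 <= Sw by apply: sumr_ge0.
have split : \sum_(q : 'I_n * 'I_n) u q.1 * w q.2 <=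
    \sum_(q : 'I_n * 'I_n | distinct4 i j q.1 q.2) u q.1 * w q.2
    + (u i * Sw + u j * Sw + Su * w i + Su * w j + \sum_k u k * w k).
  have -> : u i * Sw + u j * Sw + Su * w i + Su * w j + \sum_k u k * w k =
      \sum_k \sum_l (((k == i)%:R * u k * w l + (k == j)%:R * u k * w l)
       + (u k * ((l == i)%:R * w l) + u k * ((l == j)%:R * w l)) + (l == k)%:R * (u k * w l)).
    transitivity (\sum_k ((k == i)%:R * (u k * Sw) + (k == j)%:R * (u k * Sw)
        + (u k * w i + u k * w j) + u k * w k)).
      by rewrite !big_split /= -!mulr_suml !(sum_at (fun k => u k * Sw)) -/Su; ring.
    apply: eq_bigr => k _; rewrite !big_split /= -!mulr_sumr !sum_at.
    by rewrite !mulrA.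
  rewrite pair_bigA [in X in _ <= X + _]big_mkcond -big_split /=; apply: ler_sum => -[k l] _ /=.
  have uw := mulr_ge0 (u0 k) (w0 l).
  rewrite /distinct4 ij /= ![i == _]eq_sym ![j == _]eq_sym [k == l]eq_sym.
  by case: (k == i); case: (k == j); case: (l == i); case: (l == j); case: (l == k);
    rewrite /= ?(mul0r, mulr0, mul1r, mulr1, addr0, add0r) //; lra.
have duw : \sum_k u k * w k <= d * (Su * Sw).
  rewrite mulrCA mulr_suml; apply: ler_sum => k _.
  by apply: ler_wpM2l => //; have /andP[] := hw k.
have h1 : u i * Sw <= d * (Su * Sw).
  by rewrite mulrA ler_wpM2r//; have /andP[] := hu i.
have h2 : u j * Sw <= d * (Su * Sw).
  by rewrite mulrA ler_wpM2r//; have /andP[] := hu j.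
have h3 : Su * w i <= d * (Su * Sw).
  by rewrite mulrCA ler_wpM2l//; have /andP[] := hw i.
have h4 : Su * w j <= d * (Su * Sw).
  by rewrite mulrCA ler_wpM2l//; have /andP[] := hw j.
move: split; rewrite sum_pair_prod -/Su -/Sw; lra.
Qed.

(** [g] stands for the product of the factors [p1_K], within [e] of 1. The two relative losses add
    up because (1 - e)(1 - 5 d) >= 1 - e - 5 d. *)
Lemma sum_distinct_between (d e : R) (i j : 'I_n) (u w : 'I_n -> R)
    (g : 'I_n -> 'I_n -> R) (G : 'I_n -> 'I_n -> R) (c : R) :
  i != j -> 0 <= d -> 0 <= e -> e <= 1 -> 0 <= c ->
  (forall k, 0 <= u k <= d * (\sum_k u k)) -> (forall k, 0 <= w k <= d * (\sum_k w k)) ->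
  (forall k l, distinct4 i j k l -> 1 - e <= g k l <= 1) ->
  (forall k l, distinct4 i j k l -> G k l = g k l * (c * (u k * w l))) ->
  (1 - e - 5 * d) * (c * ((\sum_k u k) * (\sum_k w k))) <=
  \sum_(q : 'I_n * 'I_n | distinct4 i j q.1 q.2) G q.1 q.2 <=
  c * ((\sum_k u k) * (\sum_k w k)).
Proof.
move=> ij d0 e0 e1 c0 hu hw hg hG; set Su := \sum_k u k; set Sw := \sum_k w k.
have u0 k : 0 <= u k by have /andP[] := hu k.
have w0 k : 0 <= w k by have /andP[] := hw k.
have Su0 : 0 <= Su by apply: sumr_ge0.
have Sw0 : 0 <= Sw by apply: sumr_ge0.
have cs : 0 <= c * (Su * Sw) by rewrite !mulr_ge0.
apply/andP; split; last first.
  rewrite -sum_pair_prod mulr_sumr big_mkcond; apply: ler_sum => -[k l] _ /=.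
  case: ifP => [dd|_]; last by rewrite !mulr_ge0.
  by rewrite hG// ler_piMl ?mulr_ge0//; have /andP[] := hg _ _ dd.
apply: (@le_trans _ _ ((1 - e) * (c * ((1 - 5 * d) * (Su * Sw))))).
  have : 0 <= e * d * (c * (Su * Sw)) by apply: mulr_ge0 => //; exact: mulr_ge0.
  lra.
apply: (@le_trans _ _ ((1 - e) * (c *
   \sum_(q : 'I_n * 'I_n | distinct4 i j q.1 q.2) u q.1 * w q.2))).
  by rewrite ler_wpM2l ?subr_ge0// ler_wpM2l//; apply: sum_distinct_ge.
rewrite !mulr_sumr; apply: ler_sum => -[k l] /= dd.
by rewrite hG// ler_wpM2r ?mulr_ge0//; have /andP[] := hg _ _ dd.
Qed.

Definition dyad_coef (x2 x3 x4 : edge) (i j : 'I_n) : R :=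
  \sum_(q : 'I_n * 'I_n | distinct4 i j q.1 q.2) em x2 j q.1 * em x3 q.1 q.2 * em x4 q.2 i.
Local Notation coef := dyad_coef.

Lemma cyc1E x1 x2 x3 x4 A : cyc1 x1 x2 x3 x4 A =
  \sum_(e : 'I_n * 'I_n | e.1 != e.2) dyad_coef x2 x3 x4 e.1 e.2 * xi x1 e.1 e.2 A.
Proof.
exact: (sum4_pair (fun i j => xi x1 i j A)
  (fun i j k l => em x2 j k * em x3 k l * em x4 l i)).
Qed.

Definition dyad_coef11 i j := dyad_coef e00 e01 e00 i j.
Local Notation c11 := dyad_coef11.
(** As [A01 A i j] is [A10 A j i], the third factor of [Qa] contributes with its indices exchanged;
    the other three terms come from the three directed edges of [Qb]. *)
Definition dyad_coef10 i j := dyad_coef e00 e11 e00 j i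
  - expR rho * (dyad_coef e10 e00 e10 i j + dyad_coef e00 e10 e10 i j + dyad_coef e10 e10 e00 i j).
Local Notation c10 := dyad_coef10.

Lemma sum_neC (F : 'I_n -> 'I_n -> R) :
  \sum_(e : 'I_n * 'I_n | e.1 != e.2) F e.1 e.2 =
  \sum_(e : 'I_n * 'I_n | e.1 != e.2) F e.2 e.1.
Proof.
rewrite (reindex (fun e : 'I_n * 'I_n => (e.2, e.1))) /=.
  by apply: eq_bigl => e; rewrite eq_sym.
by exists (fun e => (e.2, e.1)) => -[].
Qed.

Lemma sum_ne_lt (F : 'I_n -> 'I_n -> R) :
  \sum_(e : 'I_n * 'I_n | e.1 != e.2) F e.1 e.2 =
  \sum_(e : 'I_n * 'I_n | (e.1 < e.2)%N) (F e.1 e.2 + F e.2 e.1).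
Proof.
rewrite big_split /= (bigID (fun e : 'I_n * 'I_n => (e.1 < e.2)%N)) /=.
congr (_ + _).
  apply: eq_bigl => e; rewrite andbC; case: ltnP => //= lt.
  by rewrite -(inj_eq val_inj) neq_ltn lt.
rewrite (reindex (fun e : 'I_n * 'I_n => (e.2, e.1))) /=.
  apply: eq_bigl => e; rewrite -leqNgt -(inj_eq val_inj) /= eq_sym.
  by rewrite [in RHS]ltn_neqAle.
by exists (fun e => (e.2, e.1)) => -[].
Qed.

Lemma lin_partE A : Lin A =
  \sum_(e : 'I_n * 'I_n | e.1 != e.2)
    (dyad_coef11 e.1 e.2 * xi e11 e.1 e.2 A + dyad_coef10 e.1 e.2 * xi e10 e.1 e.2 A).
Proof.
rewrite /lin_part !cyc1E.
rewrite (sum_neC (fun i j => dyad_coef e00 e11 e00 i j * xi e01 i j A)).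
rewrite -!big_split /= mulr_sumr -sumrB; apply: eq_bigr => -[i j] _ /=.
rewrite /dyad_coef11 /dyad_coef10 (_ : xi e01 j i A = xi e10 i j A)//; ring.
Qed.

Lemma ectr11C i j A : xi e11 j i A = xi e11 i j A.
Proof.
rewrite /ectr; have h B : edge_val e11 j i B = edge_val e11 i j B.
  by rewrite /edge_val /edge11 eq_sym; case: (B (i, j)); case: (B (j, i)); rewrite ?andbF.
by rewrite h; congr (_ - _); apply: eq_E.
Qed.

Definition dyad_part i j (A : adj n) : R :=
  (dyad_coef11 i j + dyad_coef11 j i) * xi e11 i j A + dyad_coef10 i j * xi e10 i j A + dyad_coef10 j i * xi e10 j i A.
Local Notation zeta := dyad_part.

Lemma lin_part_dyads A : Lin A = \sum_(e : 'I_n * 'I_n | (e.1 < e.2)%N) dyad_part e.1 e.2 A.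
Proof.
rewrite lin_partE (sum_ne_lt (fun i j => dyad_coef11 i j * xi e11 i j A + dyad_coef10 i j * xi e10 i j A)).
apply: eq_bigr => -[i j] _; rewrite /= [xi e11 j i A]ectr11C /dyad_part; ring.
Qed.

(** * Lower bound on the variance of the linear part *)

Section LowerBound.
Variable d : R.
Hypotheses (d_gt0 : 0 < d) (d_small : d <= 100^-1).
Hypotheses (mu_le : forall i, mu i <= d) (nu_le : forall i, nu i <= d)
  (a_le : forall i, a i <= d) (sm_ge : 1 <= d * sm) (sa_ge : 1 <= d * sa).
Hypothesis sp1 : forall i j, (mu i * nu j) ^+ 2 <= d ^+ 2 * (smu * snu).

Let d_ge0 : 0 <= d. Proof. exact: ltW. Qed.
Let d_le1 : d <= 1. Proof. apply: (le_trans d_small); lra. Qed.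
Let sM_ge0 := sM_ge0.
Let sN_ge0 := sN_ge0.
Let sm_ge0 := sm_ge0.
Let sa_ge0 := sa_ge0.
Let smu_ge0 := smu_ge0.
Let snu_ge0 := snu_ge0.
Let sm_ge1 : 1 <= sm. Proof. exact (sm_ge1 d d_le1 sm_ge). Qed.
Let sa_ge1 : 1 <= sa. Proof. exact (sa_ge1 d d_le1 sa_ge). Qed.
Let sM_ge : 1 <= d * sM. Proof. exact (sM_ge d d_le1 nu_le sm_ge). Qed.
Let sN_ge : 1 <= d * sN. Proof. exact (sN_ge d d_le1 mu_le sm_ge). Qed.
Let sM_ge1 : 1 <= sM. Proof. exact (sM_ge1 d d_le1 nu_le sm_ge). Qed.
Let sN_ge1 : 1 <= sN. Proof. exact (sN_ge1 d d_le1 mu_le sm_ge). Qed.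

Lemma mul_le_dd (x y : R) : 0 <= x <= d -> 0 <= y <= d -> x * y <= d.
Proof.
move=> /andP[x0 xd] /andP[y0 yd]; apply: (@le_trans _ _ (d * d)); first exact: ler_pM.
by rewrite ler_piMl.
Qed.

Lemma mu_bounds i : 0 <= mu i <= d. Proof. by rewrite mu_ge0 mu_le. Qed.
Lemma nu_bounds i : 0 <= nu i <= d. Proof. by rewrite nu_ge0 nu_le. Qed.
Lemma aeta_bounds i : 0 <= a i <= d. Proof. by rewrite aeta_ge0 a_le. Qed.

Lemma K_ge i j : 1 - 3 * d <= K i j.
Proof.
have h1 := mul_le_dd _ _ (mu_bounds i) (nu_bounds j); have h2 := mul_le_dd _ _ (mu_bounds j) (nu_bounds i).
have h3 := mul_le_dd _ _ (aeta_bounds i) (aeta_bounds j).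
have g1 := mulr_ge0 (mu_ge0 i) (nu_ge0 j); have g2 := mulr_ge0 (mu_ge0 j) (nu_ge0 i).
have g3 := mulr_ge0 (aeta_ge0 i) (aeta_ge0 j).
rewrite p1_KE.
set t := mu i * nu j + mu j * nu i + a i * a j.
have -> : 1 + mu i * nu j + mu j * nu i + a i * a j = 1 + t by rewrite /t; ring.
have t0 : 0 <= t by rewrite /t; lra.
have t1 : t <= 3 * d by rewrite /t; lra.
rewrite -[X in _ <= X]div1r ler_pdivlMr ?ltr_pwDl//.
apply: (@le_trans _ _ ((1 - t) * (1 + t))).
  by apply: ler_wpM2r; lra.
by have := sqr_ge0 t; lra.
Qed.

Let K_le1 i j : K i j <= 1 := p1_K_le1 i j.

Lemma K3_bounds i j k l u v : 1 - 9 * d <= K i j * K k l * K u v <= 1.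
Proof.
have kg : 0 <= 1 - 3 * d by have := d_small; lra.
have k0 i' j' : 0 <= K i' j' := le_trans kg (K_ge i' j').
apply/andP; split; last by apply: mulr_ile1 => //; [exact: mulr_ge0|exact: mulr_ile1].
apply: (@le_trans _ _ ((1 - 3 * d) * (1 - 3 * d) * (1 - 3 * d))); last first.
  apply: ler_pM; rewrite ?K_ge ?mulr_ge0 ?kg//.
  by apply: ler_pM; rewrite ?K_ge ?kg.
have : 0 <= d ^+ 2 * (1 - d) by rewrite mulr_ge0 ?sqr_ge0// subr_ge0.
lra.
Qed.

Lemma mu_share k : 0 <= mu k <= d * (\sum_k mu k).
Proof.
by rewrite mu_ge0; apply: (le_trans (mu_le k)); rewrite ler_peMr.
Qed.
Lemma nu_share k : 0 <= nu k <= d * (\sum_k nu k).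
Proof. by rewrite nu_ge0; apply: (le_trans (nu_le k)); rewrite ler_peMr. Qed.
Lemma ha k : 0 <= a k <= d * (\sum_k a k).
Proof. by rewrite aeta_ge0; apply: (le_trans (a_le k)); rewrite ler_peMr. Qed.
Lemma eta_share k : 0 <= eta k <= d * (\sum_k eta k).
Proof.
rewrite eta_ge0; apply: (@le_trans _ _ d); last by rewrite ler_peMr.
exact: mul_le_dd (mu_bounds k) (nu_bounds k).
Qed.

(** 14 = 9 + 5: three factors [p1_K], each at least 1 - 3 d, and five excluded coincidences. *)
Let t : R := 14 * d.

Let e0 : 0 <= 9 * d. Proof. by rewrite mulr_ge0. Qed.
Let e1 : 9 * d <= 1. Proof. by have := d_small; lra. Qed.

Ltac dist := move=> /and5P[/eqP ? /eqP ? /eqP ? /eqP ? /andP[/eqP ? /eqP ?]].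
Ltac neq := apply/eqP; congruence.

Lemma c11_between i j : i != j -> (1 - t) * (sN * sM) <= c11 i j <= sN * sM.
Proof.
move=> ij.
have := @sum_distinct_between d (9 * d) i j nu mu
  (fun k l => K j k * K l k * K l i)
  (fun k l => em e00 j k * em e01 k l * em e00 l i) 1 ij d_ge0 e0 e1 ler01 nu_share mu_share _ _.
rewrite mul1r (_ : 1 - 9 * d - 5 * d = 1 - t); last by rewrite /t; ring.
apply; first by move=> k l _; exact: K3_bounds.
by move=> k l; dist; rewrite emean01 emean10 ?emean00; [ring|neq..].
Qed.

Lemma coefa_between i j : i != j -> (1 - t) * (sa * sa) <= coef e00 e11 e00 i j <= sa * sa.
Proof.
move=> ij.
have := @sum_distinct_between d (9 * d) i j a a
  (fun k l => K j k * K k l * K l i)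
  (fun k l => em e00 j k * em e11 k l * em e00 l i) 1 ij d_ge0 e0 e1 ler01 ha ha _ _.
rewrite mul1r (_ : 1 - 9 * d - 5 * d = 1 - t); last by rewrite /t; ring.
apply; first by move=> k l _; exact: K3_bounds.
by move=> k l; dist; rewrite emean11 ?emean00; [ring|neq..].
Qed.

Lemma coefb1_between i j : i != j ->
  (1 - t) * (nu i * mu j * (sN * sM)) <= coef e10 e00 e10 i j <= nu i * mu j * (sN * sM).
Proof.
move=> ij.
have := @sum_distinct_between d (9 * d) i j nu mu
  (fun k l => K j k * K k l * K l i)
  (fun k l => em e10 j k * em e00 k l * em e10 l i) (nu i * mu j) ij d_ge0 e0 e1
  (mulr_ge0 (nu_ge0 i) (mu_ge0 j)) nu_share mu_share _ _.
rewrite (_ : 1 - 9 * d - 5 * d = 1 - t); last by rewrite /t; ring.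
apply; first by move=> k l _; exact: K3_bounds.
by move=> k l; dist; rewrite !emean10 ?emean00; [ring|neq..].
Qed.

Lemma coefb2_between i j : i != j ->
  (1 - t) * (nu i * (sM * sm)) <= coef e00 e10 e10 i j <= nu i * (sM * sm).
Proof.
move=> ij.
have := @sum_distinct_between d (9 * d) i j mu eta
  (fun k l => K j k * K k l * K l i)
  (fun k l => em e00 j k * em e10 k l * em e10 l i) (nu i) ij d_ge0 e0 e1
  (nu_ge0 i) mu_share eta_share _ _.
rewrite (_ : 1 - 9 * d - 5 * d = 1 - t); last by rewrite /t; ring.
apply; first by move=> k l _; exact: K3_bounds.
by move=> k l; dist; rewrite !emean10 ?emean00; [rewrite /eta_; ring|neq..].
Qed.

Lemma coefb4_between i j : i != j ->
  (1 - t) * (mu j * (sm * sN)) <= coef e10 e10 e00 i j <= mu j * (sm * sN).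
Proof.
move=> ij.
have := @sum_distinct_between d (9 * d) i j eta nu
  (fun k l => K j k * K k l * K l i)
  (fun k l => em e10 j k * em e10 k l * em e00 l i) (mu j) ij d_ge0 e0 e1
  (mu_ge0 j) eta_share nu_share _ _.
rewrite (_ : 1 - 9 * d - 5 * d = 1 - t); last by rewrite /t; ring.
apply; first by move=> k l _; exact: K3_bounds.
by move=> k l; dist; rewrite !emean10 ?emean00; [rewrite /eta_; ring|neq..].
Qed.

(** [cbar i j] is the value of [dyad_coef10 i j / kap ^+ 2] obtained by replacing every
    [p1_K] by 1 and the sums over distinct indices by unrestricted ones. *)
Definition XX i : R := nu i * sM.
Definition YY j : R := mu j * sN.
Definition cbar i j : R := sm ^+ 2 - XX i * YY j - XX i * sm - YY j * sm.
(** The four terms of [cbar] taken with plus signs, so that [cbar i j = 2 * sm ^+ 2 - WW i j];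
    unlike [cbar] it factors over i and j. *)
Definition WW i j : R := (sm + XX i) * (sm + YY j).

Let X_ge0 i : 0 <= XX i. Proof. exact: mulr_ge0 (nu_ge0 i) sM_ge0. Qed.
Let Y_ge0 i : 0 <= YY i. Proof. exact: mulr_ge0 (mu_ge0 i) sN_ge0. Qed.

(** Relative errors do not survive cancellation: the deviation is controlled by the sum of absolute
    values, hence later by [WW], and not by [cbar], which may vanish. *)
Lemma signed_sum_close (P Q Q' Q'' p q q' q'' u : R) :
  0 <= P -> 0 <= Q -> 0 <= Q' -> 0 <= Q'' -> u <= 1 ->
  (1 - u) * P <= p <= P -> (1 - u) * Q <= q <= Q ->
  (1 - u) * Q' <= q' <= Q' -> (1 - u) * Q'' <= q'' <= Q'' ->
  `|p - (q + q' + q'') - (P - Q - Q' - Q'')| <= u * (P + Q + Q' + Q'') /\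
  `|p - (q + q' + q'')| <= P + Q + Q' + Q''.
Proof.
move=> P0 Q0 Q0' Q0'' u1 /andP[p1 p2] /andP[q1 q2] /andP[r1 r2] /andP[s1 s2].
have g (x : R) : 0 <= x -> 0 <= (1 - u) * x by move=> x0; rewrite mulr_ge0// subr_ge0.
have := g _ P0; have := g _ Q0; have := g _ Q0'; have := g _ Q0''.
rewrite !ler_norml => g4 g3 g2 g1; split; apply/andP; split; lra.
Qed.

Lemma c10_cbar i j : i != j ->
  exists z, [/\ c10 i j = kap ^+ 2 * z, `|z - cbar i j| <= t * WW i j & `|z| <= WW i j].
Proof.
move=> ij; have ji : j != i by rewrite eq_sym.
have k0 : kap ^+ 2 != 0 by rewrite expf_neq0// gt_eqF// expR_gt0.
have kp : 0 < (kap ^+ 2)^-1 by rewrite invr_gt0 exprn_gt0// expR_gt0.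
exists ((kap ^+ 2)^-1 * coef e00 e11 e00 j i - (coef e10 e00 e10 i j + coef e00 e10 e10 i j
   + coef e10 e10 e00 i j)).
have /andP[p1 p2] := coefa_between _ _ ji; have /andP[q1 q2] := coefb1_between _ _ ij.
have /andP[r1 r2] := coefb2_between _ _ ij; have /andP[s1 s2] := coefb4_between _ _ ij.
have t0 : 0 <= t by rewrite /t mulr_ge0.
have t1 : t <= 1 by rewrite /t; have := d_small; lra.
have hs : sa * sa = kap ^+ 2 * sm ^+ 2 by rewrite saE; ring.
set p := (kap ^+ 2)^-1 * coef e00 e11 e00 j i.
have pE : coef e00 e11 e00 j i = kap ^+ 2 * p by rewrite /p mulrA divff// mul1r.
have {}p1 : (1 - t) * sm ^+ 2 <= p.
  by rewrite /p ler_pdivlMl ?exprn_gt0 ?expR_gt0// mulrCA -hs.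
have {}p2 : p <= sm ^+ 2 by rewrite /p ler_pdivrMl ?exprn_gt0 ?expR_gt0// -hs.
clearbody p.
have zE : c10 i j = kap ^+ 2 * (p - (coef e10 e00 e10 i j + coef e00 e10 e10 i j
   + coef e10 e10 e00 i j)).
  by rewrite /dyad_coef10 pE (expR_rho); ring.
have e4 : XX i * YY j = nu i * mu j * (sN * sM) by rewrite /XX /YY; ring.
have e2 : XX i * sm = nu i * (sM * sm) by rewrite /XX; ring.
have e3 : YY j * sm = mu j * (sm * sN) by rewrite /YY; ring.
move: q1 q2 r1 r2 s1 s2; rewrite -e4 -e3 -e2 => q1 q2 r1 r2 s1 s2.
have WE : WW i j = sm ^+ 2 + XX i * YY j + XX i * sm + YY j * sm by rewrite /WW; ring.
rewrite WE.
have [] := @signed_sum_close _ _ _ _ _ _ _ _ t (sqr_ge0 sm) (mulr_ge0 (X_ge0 i) (Y_ge0 j))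
  (mulr_ge0 (X_ge0 i) sm_ge0) (mulr_ge0 (Y_ge0 j) sm_ge0) t1
  (introT andP (conj p1 p2)) (introT andP (conj q1 q2)) (introT andP (conj r1 r2))
  (introT andP (conj s1 s2)).
by move=> h1 h2; split.
Qed.

Lemma sum_muX : \sum_i mu i * (sm + XX i) = 2 * (sM * sm).
Proof.
transitivity (\sum_i (mu i * sm + eta i * sM)).
  by apply: eq_bigr => i _; rewrite /XX /eta_; ring.
by rewrite big_split /= -!mulr_suml -/sm -/sM; ring.
Qed.

Lemma sum_nuY : \sum_i nu i * (sm + YY i) = 2 * (sN * sm).
Proof.
transitivity (\sum_i (nu i * sm + eta i * sN)).
  by apply: eq_bigr => i _; rewrite /YY /eta_; ring.
by rewrite big_split /= -!mulr_suml -/sm -/sN; ring.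
Qed.

Lemma sum_muX2 : \sum_i mu i * (sm + XX i) ^+ 2 = sM * (3 * sm ^+ 2 + sM * snu).
Proof.
transitivity (\sum_i (mu i * sm ^+ 2 + eta i * (2 * sm * sM) + nu i * eta i * sM ^+ 2)).
  by apply: eq_bigr => i _; rewrite /XX /eta_; ring.
by rewrite !big_split /= -!mulr_suml -/sm -/sM -/snu; ring.
Qed.

Lemma sum_nuY2 : \sum_i nu i * (sm + YY i) ^+ 2 = sN * (3 * sm ^+ 2 + sN * smu).
Proof.
transitivity (\sum_i (nu i * sm ^+ 2 + eta i * (2 * sm * sN) + mu i * eta i * sN ^+ 2)).
  by apply: eq_bigr => i _; rewrite /YY /eta_; ring.
by rewrite !big_split /= -!mulr_suml -/sm -/sN -/smu; ring.
Qed.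

(** Cauchy-Schwarz for the weights mu, obtained by expanding the nonnegative sum of mu_i (X_i -
    m)^2. *)
Lemma sm2_le_A : sm ^+ 2 <= sM * snu.
Proof.
have : 0 <= \sum_i mu i * (XX i - sm) ^+ 2.
  by apply: sumr_ge0 => i _; exact: mulr_ge0 (mu_ge0 i) (sqr_ge0 _).
have -> : \sum_i mu i * (XX i - sm) ^+ 2 = sM * (sM * snu - sm ^+ 2).
  transitivity (\sum_i (mu i * sm ^+ 2 - eta i * (2 * sm * sM) + nu i * eta i * sM ^+ 2)).
    by apply: eq_bigr => i _; rewrite /XX /eta_; ring.
  by rewrite !big_split /= sumrN -!mulr_suml -/sm -/sM -/snu; ring.
by rewrite pmulr_rge0 ?subr_ge0//; exact: lt_le_trans ltr01 sM_ge1.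
Qed.

Lemma sm2_le_B : sm ^+ 2 <= sN * smu.
Proof.
have : 0 <= \sum_i nu i * (YY i - sm) ^+ 2.
  by apply: sumr_ge0 => i _; exact: mulr_ge0 (nu_ge0 i) (sqr_ge0 _).
have -> : \sum_i nu i * (YY i - sm) ^+ 2 = sN * (sN * smu - sm ^+ 2).
  transitivity (\sum_i (nu i * sm ^+ 2 - eta i * (2 * sm * sN) + mu i * eta i * sN ^+ 2)).
    by apply: eq_bigr => i _; rewrite /YY /eta_; ring.
  by rewrite !big_split /= sumrN -!mulr_suml -/sm -/sN -/smu; ring.
by rewrite pmulr_rge0 ?subr_ge0//; exact: lt_le_trans ltr01 sN_ge1.
Qed.

Lemma sum_WW2 : \sum_(q : 'I_n * 'I_n) mu q.1 * nu q.2 * WW q.1 q.2 ^+ 2 =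
  sM * (3 * sm ^+ 2 + sM * snu) * (sN * (3 * sm ^+ 2 + sN * smu)).
Proof.
rewrite -sum_muX2 -sum_nuY2 -sum_pair_prod; apply: eq_bigr => q _; rewrite /WW; ring.
Qed.

Lemma sum_WW2_le : \sum_(q : 'I_n * 'I_n) mu q.1 * nu q.2 * WW q.1 q.2 ^+ 2 <= 9 * V0b.
Proof.
rewrite sum_WW2 /var_scale_b /v0b.
have A0 : 0 <= sM * snu by exact: mulr_ge0.
have B0 : 0 <= sN * smu by exact: mulr_ge0.
have m0 := sqr_ge0 sm.
set x := sM * snu in A0 *; set y := sN * smu in B0 *.
rewrite (_ : _ * _ = sM * sN * ((3 * sm ^+ 2 + x) * (3 * sm ^+ 2 + y))); last by ring.
rewrite (_ : 9 * _ = sM * sN * ((3 * (x + sm ^+ 2)) * (3 * (y + sm ^+ 2)))); last by ring.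
apply: ler_wpM2l; first exact: mulr_ge0.
by apply: ler_pM; lra.
Qed.

(** cbar^2 = 4 m^4 - 4 m^2 W + W^2, and the sums of W and W^2 factor. With A = M (nu, eta) and B = N
    (mu, eta) the sum is M N (A B + 3 m^2 (A + B) - 3 m^4); it exceeds [V0b] by 2 M N m^2 ((A - m^2)
    + (B - m^2)), which is nonnegative by the two Cauchy-Schwarz bounds. *)
Lemma sum_cbar2_ge : V0b <= \sum_(q : 'I_n * 'I_n) mu q.1 * nu q.2 * cbar q.1 q.2 ^+ 2.
Proof.
have -> : \sum_(q : 'I_n * 'I_n) mu q.1 * nu q.2 * cbar q.1 q.2 ^+ 2 =
  4 * sm ^+ 4 * (sM * sN) - 4 * sm ^+ 2 * (2 * (sM * sm) * (2 * (sN * sm))) +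
  sM * (3 * sm ^+ 2 + sM * snu) * (sN * (3 * sm ^+ 2 + sN * smu)).
  rewrite -sum_WW2 -sum_muX -sum_nuY -!sum_pair_prod !mulr_sumr -sumrB -big_split /=.
  by apply: eq_bigr => q _; rewrite /cbar /WW; ring.
have hA := sm2_le_A; have hB := sm2_le_B.
rewrite /var_scale_b /v0b; set x := sM * snu in hA *; set y := sN * smu in hB *.
have : 0 <= sM * sN * (2 * sm ^+ 2 * ((x - sm ^+ 2) + (y - sm ^+ 2))).
  have m0 := sqr_ge0 sm.
  apply: mulr_ge0; first exact: mulr_ge0.
  by apply: mulr_ge0; lra.
lra.
Qed.

(** eta_i^3 = x y with x = mu_i eta_i and y = nu_i eta_i. By (SP1) at i = j, x y <= (d smu)(d snu),
    so x <= d smu or y <= d snu; the factor so bounded is replaced. *)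
Lemma eta3_le i : eta i ^+ 3 <= d * (smu * (nu i * eta i) + snu * (mu i * eta i)).
Proof.
set x := mu i * eta i; set y := nu i * eta i.
have x0 : 0 <= x by exact: mulr_ge0 (mu_ge0 i) (eta_ge0 i).
have y0 : 0 <= y by exact: mulr_ge0 (nu_ge0 i) (eta_ge0 i).
have xy : eta i ^+ 3 = x * y by rewrite /x /y /eta_; ring.
have xy' : x * y <= (d * smu) * (d * snu).
  rewrite -xy; apply: (@le_trans _ _ (eta i ^+ 2)).
    rewrite exprS ler_piMl ?sqr_ge0//.
    by apply: le_trans d_le1; exact: mul_le_dd (mu_bounds i) (nu_bounds i).
  by have := sp1 i i; rewrite -/(eta i); lra.
have s0 : 0 <= d * smu by exact: mulr_ge0.
have s0' : 0 <= d * snu by exact: mulr_ge0.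
clearbody x y; rewrite xy mulrDr !mulrA; case: (leP x (d * smu)) => hx.
  apply: (@le_trans _ _ (d * smu * y)); first exact: ler_wpM2r.
  by rewrite lerDl mulr_ge0.
apply: (@le_trans _ _ (d * snu * x)); last by rewrite lerDr mulr_ge0.
rewrite [X in X <= _]mulrC; apply: ler_wpM2r => //.
case: (leP y (d * snu)) => // hy.
suff : d * smu * (d * snu) < x * y by rewrite ltNge xy'.
exact: ltr_pM.
Qed.

Lemma sum_eta3_le : \sum_i eta i ^+ 3 <= 2 * d * (smu * snu).
Proof.
apply: (@le_trans _ _ (\sum_i d * (smu * (nu i * eta i) + snu * (mu i * eta i)))).
  by apply: ler_sum => i _; exact: eta3_le.
by rewrite -mulr_sumr big_split /= -!mulr_sumr -/smu -/snu; lra.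
Qed.

(** The closed forms include i = j, where there is no dyad; this prices its removal. The worst term,
    X_i^2 Y_i^2, is a multiple of eta_i^3. *)
Lemma sum_WW2_diag : \sum_i mu i * nu i * WW i i ^+ 2 <= 8 * d * V0b.
Proof.
apply: (@le_trans _ _ (\sum_i (4 * (sm ^+ 4 * eta i + sm ^+ 2 * (sM ^+ 2 * (d * (nu i * eta i)))
   + sm ^+ 2 * (sN ^+ 2 * (d * (mu i * eta i))) + sM ^+ 2 * sN ^+ 2 * eta i ^+ 3)))).
  apply: ler_sum => i _.
  have h x : (sm + x) ^+ 2 <= 2 * (sm ^+ 2 + x ^+ 2) by have := sqr_ge0 (sm - x); lra.
  have h1 : WW i i ^+ 2 <= 4 * (sm ^+ 4 + sm ^+ 2 * XX i ^+ 2 + sm ^+ 2 * YY i ^+ 2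
     + XX i ^+ 2 * YY i ^+ 2).
    rewrite /WW exprMn (_ : 4 * _ = 2 * (sm ^+ 2 + XX i ^+ 2) * (2 * (sm ^+ 2 + YY i ^+ 2)));
      last by ring.
    by apply: ler_pM; rewrite ?sqr_ge0.
  have eta0 : 0 <= mu i * nu i := eta_ge0 i.
  apply: (le_trans (ler_wpM2l eta0 h1)).
  have n1 : sm ^+ 2 * (sM ^+ 2 * (nu i * (nu i * eta i))) <=
     sm ^+ 2 * (sM ^+ 2 * (d * (nu i * eta i))).
    do 2![apply: ler_wpM2l; first exact: sqr_ge0].
    by apply: ler_wpM2r (nu_le i); exact: mulr_ge0 (nu_ge0 i) (eta_ge0 i).
  have n2 : sm ^+ 2 * (sN ^+ 2 * (mu i * (mu i * eta i))) <=
     sm ^+ 2 * (sN ^+ 2 * (d * (mu i * eta i))).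
    do 2![apply: ler_wpM2l; first exact: sqr_ge0].
    by apply: ler_wpM2r (mu_le i); exact: mulr_ge0 (mu_ge0 i) (eta_ge0 i).
  rewrite [X in X <= _](_ : _ = 4 * (sm ^+ 4 * eta i + sm ^+ 2 * (sM ^+ 2 * (nu i * (nu i * eta i)))
   + sm ^+ 2 * (sN ^+ 2 * (mu i * (mu i * eta i))) + sM ^+ 2 * sN ^+ 2 * eta i ^+ 3)); last first.
    by rewrite /XX /YY /eta_; ring.
  lra.
rewrite -mulr_sumr !big_split /= -!mulr_sumr -/sm -/snu -/smu.
have h3 := sum_eta3_le; have MM : 0 <= sM ^+ 2 * sN ^+ 2 by rewrite mulr_ge0 ?sqr_ge0.
have {}h3 := ler_wpM2l MM h3.
have h4 : sm ^+ 4 * sm <= d * (sM * sN * sm ^+ 4).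
  have h5 : sm <= d * sM by exact (sm_le_sM d nu_le).
  rewrite [d * _](_ : _ = sm ^+ 4 * (d * sM * sN)); last by ring.
  apply: ler_wpM2l; first exact: exprn_ge0.
  by apply: (le_trans h5); rewrite ler_peMr// mulr_ge0.
have h6 : sm ^+ 2 * (sM ^+ 2 * (d * snu)) <= d * (sM * sN * (sM * snu) * sm ^+ 2).
  rewrite [d * (_ * _ ^+ 2)](_ : _ = sN * (sm ^+ 2 * (sM ^+ 2 * (d * snu)))); last by ring.
  by rewrite ler_peMl// !mulr_ge0.
have h7 : sm ^+ 2 * (sN ^+ 2 * (d * smu)) <= d * (sM * sN * (sN * smu) * sm ^+ 2).
  rewrite [d * (_ * _ ^+ 2)](_ : _ = sM * (sm ^+ 2 * (sN ^+ 2 * (d * smu)))); last by ring.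
  by rewrite ler_peMl// !mulr_ge0.
have g1 : 0 <= d * (sM * sN * (sM * snu) * sm ^+ 2) by rewrite !mulr_ge0.
have g2 : 0 <= d * (sM * sN * (sN * smu) * sm ^+ 2) by rewrite !mulr_ge0.
have g3 : 0 <= d * (sM * sN * sm ^+ 4) by apply: mulr_ge0 => //; rewrite !mulr_ge0// exprn_ge0.
rewrite /var_scale_b v0bE; move: h3 h4 h6 h7 g1 g2 g3.
rewrite (_ : sM ^+ 2 * sN ^+ 2 * (2 * d * (smu * snu)) =
  2 * (d * (sM * sN * (sM * snu) * (sN * smu)))); last by ring.
rewrite (_ : 8 * d * _ = 8 * (d * (sM * sN * (sM * snu) * sm ^+ 2)) +
   8 * (d * (sM * sN * (sN * smu) * sm ^+ 2)) + 8 * (d * (sM * sN * sm ^+ 4)) +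
   8 * (d * (sM * sN * (sM * snu) * (sN * smu)))); last by ring.
move: (d * (sM * sN * (sM * snu) * sm ^+ 2)) (d * (sM * sN * (sN * smu) * sm ^+ 2))
  (d * (sM * sN * sm ^+ 4)) (d * (sM * sN * (sM * snu) * (sN * smu))) => x1 x2 x3 x4.
lra.
Qed.

Lemma sum_split_diag (F : 'I_n -> 'I_n -> R) :
  \sum_(q : 'I_n * 'I_n) F q.1 q.2 =
  \sum_(q : 'I_n * 'I_n | q.1 != q.2) F q.1 q.2 + \sum_i F i i.
Proof.
rewrite (bigID (fun q : 'I_n * 'I_n => q.1 != q.2)) /=; congr (_ + _).
rewrite (reindex_onto (fun i : 'I_n => (i, i)) (fun q : 'I_n * 'I_n => q.1)) /=.
  by apply: eq_bigl => i; rewrite !eqxx.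
by move=> [i j] /=; rewrite negbK => /eqP ->.
Qed.

Lemma cbar_WW i j : cbar i j ^+ 2 <= WW i j ^+ 2.
Proof.
have y1 := mulr_ge0 (X_ge0 i) (Y_ge0 j); have y2 := mulr_ge0 (X_ge0 i) sm_ge0.
have y3 := mulr_ge0 (Y_ge0 j) sm_ge0; have y4 := sqr_ge0 sm.
have W0 : 0 <= WW i j by rewrite /WW mulr_ge0// addr_ge0.
rewrite -[X in X <= _]real_normK ?num_real// lerXn2r ?nnegrE//.
rewrite ler_norml /cbar /WW; apply/andP; split; lra.
Qed.

Lemma sum_c10_sqr_ge :
  4^-1 * (kap ^+ 4 * V0b) <=
  \sum_(e : 'I_n * 'I_n | e.1 != e.2) c10 e.1 e.2 ^+ 2 * em e10 e.1 e.2.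
Proof.
have k4 : 0 <= kap ^+ 4 by rewrite exprn_ge0// expR_ge0.
have distinct_triple : 0 <= 1 - 3 * d by have := d_small; lra.
apply: (@le_trans _ _ (\sum_(e : 'I_n * 'I_n | e.1 != e.2) (1 - 3 * d) * kap ^+ 4 *
  (2^-1 * (mu e.1 * nu e.2 * cbar e.1 e.2 ^+ 2) - t ^+ 2 * (mu e.1 * nu e.2 * WW e.1 e.2 ^+ 2)))); last first.
  apply: ler_sum => -[i j] /= ij.
  have [z [-> h1 _]] := c10_cbar _ _ ij; rewrite emean10//.
  have mn : 0 <= mu i * nu j := mulr_ge0 (mu_ge0 i) (nu_ge0 j).
  (* z^2 >= cbar^2 / 2 - (z - cbar)^2, which amounts to (2 z - cbar)^2 >= 0. *)
  have hz : 2^-1 * cbar i j ^+ 2 - t ^+ 2 * WW i j ^+ 2 <= z ^+ 2.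
    have : (z - cbar i j) ^+ 2 <= (t * WW i j) ^+ 2.
      by rewrite -[X in X <= _]real_normK ?num_real// lerXn2r ?nnegrE//; apply: le_trans h1.
    have := sqr_ge0 (2 * z - cbar i j); lra.
  apply: (@le_trans _ _ ((1 - 3 * d) * (kap ^+ 4 * (mu i * nu j) * z ^+ 2))).
    rewrite -[X in X <= _]mulrA; apply: ler_wpM2l => //; rewrite -[X in _ <= X]mulrA; apply: ler_wpM2l => //.
    have := ler_wpM2l mn hz; lra.
  rewrite [X in _ <= X](_ : _ = K i j * (kap ^+ 4 * (mu i * nu j) * z ^+ 2)); last by ring.
  apply: ler_wpM2r (K_ge i j).
  by apply: mulr_ge0 (sqr_ge0 _); exact: mulr_ge0.
rewrite -mulr_sumr sumrB -!mulr_sumr.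
have c1 : V0b - 8 * d * V0b <=
   \sum_(e : 'I_n * 'I_n | e.1 != e.2) mu e.1 * nu e.2 * cbar e.1 e.2 ^+ 2.
  have := sum_cbar2_ge; rewrite (sum_split_diag (fun i j => mu i * nu j * cbar i j ^+ 2)).
  have : \sum_i mu i * nu i * cbar i i ^+ 2 <= \sum_i mu i * nu i * WW i i ^+ 2.
    by apply: ler_sum => i _; apply: ler_wpM2l; [exact: eta_ge0|exact: cbar_WW].
  have := sum_WW2_diag; lra.
have c2 : \sum_(e : 'I_n * 'I_n | e.1 != e.2) mu e.1 * nu e.2 * WW e.1 e.2 ^+ 2 <= 9 * V0b.
  apply: le_trans sum_WW2_le.
  rewrite (sum_split_diag (fun i j => mu i * nu j * WW i j ^+ 2)) lerDl.
  by apply: sumr_ge0 => i _; exact: mulr_ge0 (eta_ge0 i) (sqr_ge0 _).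
have Vb : 0 <= V0b by apply/ltW; exact: (var_scale_b_gt0 d d_gt0 d_le1 mu_le nu_le sm_ge).
have t2 : t ^+ 2 <= 14 ^+ 2 * (100^-1 * 100^-1).
  rewrite /t exprMn; apply: ler_wpM2l => //.
  by rewrite expr2; apply: ler_pM.
have {}c2 := ler_pM (sqr_ge0 t) (sumr_ge0 _ (fun e _ => mulr_ge0 (mulr_ge0 (mu_ge0 e.1) (nu_ge0 e.2)) (sqr_ge0 (WW e.1 e.2)))) t2 c2.
have c3 : 2^-1 * (V0b - 8 * d * V0b) - 14 ^+ 2 * (100^-1 * 100^-1) * (9 * V0b) <=
  2^-1 * (\sum_(e : 'I_n * 'I_n | e.1 != e.2) mu e.1 * nu e.2 * cbar e.1 e.2 ^+ 2) -
  t ^+ 2 * (\sum_(e : 'I_n * 'I_n | e.1 != e.2) mu e.1 * nu e.2 * WW e.1 e.2 ^+ 2) by lra.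
have dV : d * V0b <= 100^-1 * V0b by exact: ler_wpM2r.
(* At d = 1/100 the right side is (0.46 - 0.1764) V0b. The extra hundredth on the left pays for the
   factor 1 - 3 d coming from [p1_K]. *)
have c4 : 4^-1 * V0b + 100^-1 * V0b <= 2^-1 * (V0b - 8 * d * V0b) - 14 ^+ 2 * (100^-1 * 100^-1) * (9 * V0b).
  lra.
rewrite [X in X <= _](_ : _ = kap ^+ 4 * (4^-1 * V0b)); last by ring.
rewrite [X in _ <= X]mulrAC [X in _ <= X]mulrC; apply: ler_wpM2l => //.
apply: (@le_trans _ _ ((1 - 3 * d) * (4^-1 * V0b + 100^-1 * V0b))).
  by have := d_small; lra.
by apply: ler_wpM2l => //; exact: le_trans c4 c3.
Qed.

Lemma sum_ne_aa : (1 - d) * sa ^+ 2 <= \sum_(e : 'I_n * 'I_n | e.1 != e.2) a e.1 * a e.2.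
Proof.
have := sum_pair_prod a a; rewrite (sum_split_diag (fun i j => a i * a j)) -/sa => h.
have : \sum_i a i * a i <= d * sa ^+ 2.
  apply: (@le_trans _ _ (d * sa)).
    by rewrite mulr_sumr; apply: ler_sum => i _; exact: ler_wpM2r (aeta_ge0 i) _ _ (a_le i).
  by apply: ler_wpM2l => //; rewrite expr2 ler_peMr.
lra.
Qed.

Lemma emean11_ge i j : i != j -> (1 - 3 * d) * (a i * a j) <= em e11 i j.
Proof.
by move=> ij; rewrite emean11//; apply: ler_wpM2r (K_ge i j); exact: mulr_ge0 (aeta_ge0 i) (aeta_ge0 j).
Qed.

Lemma emean11_ge0 i j : 0 <= em e11 i j.
Proof. by have /andP[] := emean11_bounds i j. Qed.

Lemma emean10_ge0 i j : 0 <= em e10 i j.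
Proof. by have /andP[] := emean10_bounds i j. Qed.

Lemma sum_emean11_ge : 9 / 10 * sa ^+ 2 <= \sum_(e : 'I_n * 'I_n | e.1 != e.2) em e11 e.1 e.2.
Proof.
apply: (@le_trans _ _ ((1 - 3 * d) * ((1 - d) * sa ^+ 2))).
  rewrite mulrA; apply: ler_wpM2r; first exact: sqr_ge0.
  have := d_small; have := sqr_ge0 d; lra.
apply: (@le_trans _ _ ((1 - 3 * d) * \sum_(e : 'I_n * 'I_n | e.1 != e.2) a e.1 * a e.2)).
  by apply: ler_wpM2l sum_ne_aa; have := d_small; lra.
by rewrite mulr_sumr; apply: ler_sum => -[i j] /= ij; exact: emean11_ge.
Qed.

Lemma c11_ge i j : i != j -> 86 / 100 * (sM * sN) <= c11 i j.
Proof.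
move=> ij; have /andP[h _] := c11_between _ _ ij; apply: le_trans h.
rewrite [sN * sM]mulrC; apply: ler_wpM2r; first exact: mulr_ge0.
by rewrite /t; have := d_small; lra.
Qed.

Lemma sum_c11_sqr_ge : 2 * (sM * sN * sa) ^+ 2 <=
  \sum_(e : 'I_n * 'I_n | e.1 != e.2) (c11 e.1 e.2 + c11 e.2 e.1) ^+ 2 * em e11 e.1 e.2.
Proof.
have MN : 0 <= sM * sN by exact: mulr_ge0.
apply: (@le_trans _ _ ((172 / 100 * (sM * sN)) ^+ 2 * (9 / 10 * sa ^+ 2))).
  rewrite [X in _ <= X](_ : _ = (172 / 100) ^+ 2 * (9 / 10) * (sM * sN * sa) ^+ 2); last by ring.
  apply: ler_wpM2r; [exact: sqr_ge0|lra].
apply: (@le_trans _ _ ((172 / 100 * (sM * sN)) ^+ 2 *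
   \sum_(e : 'I_n * 'I_n | e.1 != e.2) em e11 e.1 e.2)).
  by apply: ler_wpM2l sum_emean11_ge; exact: sqr_ge0.
rewrite mulr_sumr; apply: ler_sum => -[i j] /= ij; apply: ler_wpM2r; first exact: emean11_ge0.
have := c11_ge _ _ ij; rewrite eq_sym in ij; have := c11_ge _ _ ij => h1 h2.
by rewrite lerXn2r ?nnegrE; lra.
Qed.

Lemma cycE_ge : 3 / 4 * (sM * sN * sa ^+ 2) <= cycE e11 e00 e01 e00.
Proof.
rewrite /cyc_mean (@eq_sum4 _ (fun i j k l =>
  em e00 j k * em e01 k l * em e00 l i * em e11 i j)); last by move=> *; ring.
rewrite (sum4_pair (em e11) (fun i j k l => em e00 j k * em e01 k l * em e00 l i)).
apply: (@le_trans _ _ (\sum_(e : 'I_n * 'I_n | e.1 != e.2) 86 / 100 * (sM * sN) * em e11 e.1 e.2)); last first.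
  by apply: ler_sum => -[i j] /= ij; apply: ler_wpM2r (c11_ge _ _ ij); exact: emean11_ge0.
have MN : 0 <= sM * sN by exact: mulr_ge0.
have := sqr_ge0 sa; rewrite -mulr_sumr => s2.
apply: (@le_trans _ _ (86 / 100 * (sM * sN) * (9 / 10 * sa ^+ 2))).
  have := mulr_ge0 MN s2; lra.
by apply: ler_wpM2l sum_emean11_ge; lra.
Qed.

Lemma E_dyad_partM i j Y : i != j -> dyad_free i j Y -> E (fun A => zeta i j A * Y A) = 0.
Proof.
move=> ij Yf; have ji : j != i by rewrite eq_sym.
rewrite (@eq_E _ (fun A => (c11 i j + c11 j i) * (xi e11 i j A * Y A)
   + c10 i j * (xi e10 i j A * Y A) + c10 j i * (xi e10 j i A * Y A))); last first.
  by move=> A; rewrite /dyad_part; ring.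
rewrite !ED !EZ !E_ectrM//; first by rewrite !mulr0 !addr0.
exact: dyad_freeC.
Qed.

Lemma dyad_free_dyad_part i j k l : ~ (k = i /\ l = j) -> ~ (k = j /\ l = i) ->
  dyad_free i j (zeta k l).
Proof.
move=> h1 h2; apply: dyad_freeD; first apply: dyad_freeD;
  apply: dyad_freeM => //; apply: dyad_free_ectr => //.
  by case=> ? ?; apply: h2.
by case=> ? ?; apply: h1.
Qed.

Lemma sum_add_C (F : 'I_n -> 'I_n -> R) :
  \sum_(e : 'I_n * 'I_n | e.1 != e.2) F e.1 e.2 =
  2 * \sum_(e : 'I_n * 'I_n | (e.1 < e.2)%N) 2^-1 * (F e.1 e.2 + F e.2 e.1).
Proof. by rewrite sum_ne_lt -mulr_sumr mulrA divff// mul1r. Qed.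

Lemma emean11C i j : em e11 j i = em e11 i j.
Proof.
rewrite /emean; apply: eq_E => B.
by rewrite /edge_val /edge11 eq_sym; case: (B (i, j)); case: (B (j, i)); rewrite ?andbF.
Qed.

(** The states 11, 10 and 01 of a dyad exclude one another, so the second moment has no cross terms;
    by Cauchy-Schwarz the squared mean is at most p + q + r <= 3 d times it. *)
Lemma E_dyad_part_sqr_ge i j : i != j ->
  (1 - 3 * d) * ((c11 i j + c11 j i) ^+ 2 * em e11 i j + c10 i j ^+ 2 * em e10 i j
    + c10 j i ^+ 2 * em e10 j i) <= E (fun A => zeta i j A ^+ 2).
Proof.
move=> ij.
set x := c11 i j + c11 j i; set y := c10 i j; set z := c10 j i.
set p := em e11 i j; set q := em e10 i j; set r := em e10 j i.
pose g A := x * edge_val e11 i j A + y * edge_val e10 i j A + z * edge_val e10 j i A.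
have -> : E (fun A => zeta i j A ^+ 2) =
   (x ^+ 2 * p + y ^+ 2 * q + z ^+ 2 * r) - (x * p + y * q + z * r) ^+ 2.
  have Eg : E g = x * p + y * q + z * r by rewrite /g !ED !EZ.
  have Eg2 : E (fun A => g A ^+ 2) = x ^+ 2 * p + y ^+ 2 * q + z ^+ 2 * r.
    rewrite (@eq_E _ (fun A => x ^+ 2 * edge_val e11 i j A
       + y ^+ 2 * edge_val e10 i j A + z ^+ 2 * edge_val e10 j i A)); first by rewrite !ED !EZ.
    move=> A; rewrite /g /edge_val /edge11 /edge10 [j == i]eq_sym ij /=.
    by case: (A (i, j)); case: (A (j, i)); rewrite /b2R /=; ring.
  rewrite (@eq_E _ (fun A => g A ^+ 2 - 2 * (x * p + y * q + z * r) * g A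
     + (x * p + y * q + z * r) ^+ 2)); last first.
    by move=> A; rewrite /dyad_part /ectr /g -/x -/y -/z -/p -/q -/r; ring.
  by rewrite ED EB EZ E_cst Eg Eg2; ring.
have p0 : 0 <= p := emean11_ge0 i j; have q0 : 0 <= q := emean10_ge0 i j.
have r0 : 0 <= r := emean10_ge0 j i.
have s3 : p + q + r <= 3 * d.
  have /andP[_ h1] := emean11_bounds i j.
  have /andP[_ h2] := emean10_bounds i j.
  have /andP[_ h3] := emean10_bounds j i.
  have g1 := mul_le_dd _ _ (aeta_bounds i) (aeta_bounds j); have g2 := mul_le_dd _ _ (mu_bounds i) (nu_bounds j).
  have g3 := mul_le_dd _ _ (mu_bounds j) (nu_bounds i).
  have := le_trans h1 g1; have := le_trans h2 g2; have := le_trans h3 g3.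
  rewrite -/p -/q -/r; lra.
clearbody x y z p q r.
(* Lagrange's identity writes the difference as a weighted sum of squared differences. *)
have cs : (x * p + y * q + z * r) ^+ 2 <= (p + q + r) * (x ^+ 2 * p + y ^+ 2 * q + z ^+ 2 * r).
  rewrite -subr_ge0 [X in 0 <= X](_ : _ = p * q * (x - y) ^+ 2 + p * r * (x - z) ^+ 2
     + q * r * (y - z) ^+ 2); last by ring.
  by rewrite !addr_ge0// mulr_ge0 ?sqr_ge0// mulr_ge0.
have S0 : 0 <= x ^+ 2 * p + y ^+ 2 * q + z ^+ 2 * r.
  by rewrite !addr_ge0// mulr_ge0 ?sqr_ge0.
have := ler_wpM2r S0 s3; lra.
Qed.

Lemma E_lin_part_sqr : E (fun A => Lin A ^+ 2) =
  \sum_(e : 'I_n * 'I_n | (e.1 < e.2)%N) E (fun A => zeta e.1 e.2 A ^+ 2).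
Proof.
rewrite (@eq_E _ (fun A => \sum_(e : 'I_n * 'I_n | (e.1 < e.2)%N)
   \sum_(e' : 'I_n * 'I_n | (e'.1 < e'.2)%N) zeta e.1 e.2 A * zeta e'.1 e'.2 A)); last first.
  by move=> A; rewrite lin_part_dyads expr2 mulr_suml; apply: eq_bigr => e _; rewrite mulr_sumr.
rewrite E_sum; apply: eq_bigr => -[i j] /= ij; rewrite E_sum.
rewrite (bigD1 (i, j)) //= [X in _ + X]big1 ?addr0 // => -[k l] /= /andP[kl /eqP klij].
apply: E_dyad_partM; first by rewrite -(inj_eq val_inj) neq_ltn ij.
apply: dyad_free_dyad_part => -[? ?]; subst; first exact: klij.
by move: (ltn_trans kl ij); rewrite ltnn.
Qed.

Lemma E_lin_part_sqr_ge : 5^-1 * V0 <= E (fun A => Lin A ^+ 2).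
Proof.
have distinct_triple : 97 / 100 <= 1 - 3 * d by have := d_small; lra.
have d30 : 0 <= 1 - 3 * d by have := d_small; lra.
rewrite E_lin_part_sqr.
have h := sum_c11_sqr_ge; have h2 := sum_c10_sqr_ge.
(* The reciprocal term is symmetric and counted twice over ordered pairs; the factor 2 in
   [sum_c11_sqr_ge] compensates for this. *)
rewrite (sum_add_C (fun i j => (c11 i j + c11 j i) ^+ 2 * em e11 i j)) in h.
rewrite (sum_ne_lt (fun i j => c10 i j ^+ 2 * em e10 i j)) in h2.
apply: (@le_trans _ _ ((1 - 3 * d) * ((sM * sN * sa) ^+ 2 + 4^-1 * (kap ^+ 4 * V0b)))).
  have k4 : 0 <= kap ^+ 4 by rewrite exprn_ge0// expR_ge0.
  have Vb : 0 <= V0b by apply/ltW; exact: (var_scale_b_gt0 d d_gt0 d_le1 mu_le nu_le sm_ge).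
  have g1 := mulr_ge0 k4 Vb; have g2 := sqr_ge0 (sM * sN * sa).
  apply: (@le_trans _ _ (97 / 100 * ((sM * sN * sa) ^+ 2 + 4^-1 * (kap ^+ 4 * V0b)))).
    rewrite /var_scale /v0 -[v0b R sM sN sm smu snu]/V0b; lra.
  apply: ler_wpM2r => //; lra.
apply: (@le_trans _ _ ((1 - 3 * d) * (\sum_(e : 'I_n * 'I_n | (e.1 < e.2)%N)
   ((c11 e.1 e.2 + c11 e.2 e.1) ^+ 2 * em e11 e.1 e.2 + (c10 e.1 e.2 ^+ 2 * em e10 e.1 e.2
    + c10 e.2 e.1 ^+ 2 * em e10 e.2 e.1))))).
  apply: ler_wpM2l => //; rewrite big_split /=; apply: lerD => //.
  move: h; rewrite (eq_bigr (fun e : 'I_n * 'I_n =>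
     (c11 e.1 e.2 + c11 e.2 e.1) ^+ 2 * em e11 e.1 e.2)); first lra.
  by move=> [i j] _ /=; rewrite emean11C; field.
rewrite mulr_sumr; apply: ler_sum => -[i j] /= ij.
rewrite addrA; apply: E_dyad_part_sqr_ge.
by rewrite -(inj_eq val_inj) neq_ltn ij.
Qed.

(** * Negligibility of a single dyad *)

Lemma ectr_norm_le1 x i j A : indicator_edge x -> `|xi x i j A| <= 1.
Proof.
move=> xP; rewrite /ectr ler_norml.
have := emean_ge0 x xP i j.
have := emean_le1 x xP i j.
by rewrite /edge_val; case: (xP i j (A (i, j)) (A (j, i))) => -> ? ?; apply/andP; split; lra.
Qed.

Lemma smu_gt0 : 0 < smu.
Proof.
have := sm2_le_B; have m1 := exprn_ege1 2 sm_ge1; have N0 := lt_le_trans ltr01 sN_ge1.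
by move=> h; rewrite -(pmulr_rgt0 _ N0); apply: lt_le_trans h; apply: lt_le_trans m1.
Qed.

Lemma snu_gt0 : 0 < snu.
Proof.
have := sm2_le_A; have m1 := exprn_ege1 2 sm_ge1; have M0 := lt_le_trans ltr01 sM_ge1.
by move=> h; rewrite -(pmulr_rgt0 _ M0); apply: lt_le_trans h; apply: lt_le_trans m1.
Qed.

(** (SP1) at (j, i) averaged over j with weights nu_j: since mu_j^2 nu_j = mu_j eta_j, the left side
    sums to nu_i^2 (mu, eta), and the positive factor (mu, eta) cancels. *)
Lemma nu_sqr_le i : nu i ^+ 2 <= d ^+ 2 * (sN * snu).
Proof.
rewrite -(ler_pM2r smu_gt0) /mu_eta mulr_sumr.
apply: (@le_trans _ _ (\sum_j d ^+ 2 * (smu * snu) * nu j)).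
  apply: ler_sum => j _.
  rewrite (_ : nu i ^+ 2 * _ = (mu j * nu i) ^+ 2 * nu j); last by rewrite /eta_; ring.
  exact: ler_wpM2r (nu_ge0 j) _ _ (sp1 j i).
by rewrite -mulr_sumr -/sN -/smu le_eqVlt; apply/orP; left; apply/eqP; ring.
Qed.

Lemma mu_sqr_le i : mu i ^+ 2 <= d ^+ 2 * (sM * smu).
Proof.
rewrite -(ler_pM2r snu_gt0) /nu_eta mulr_sumr.
apply: (@le_trans _ _ (\sum_j d ^+ 2 * (smu * snu) * mu j)).
  apply: ler_sum => j _.
  rewrite (_ : mu i ^+ 2 * _ = (mu i * nu j) ^+ 2 * mu j); last by rewrite /eta_; ring.
  exact: ler_wpM2r (mu_ge0 j) _ _ (sp1 i j).
by rewrite -mulr_sumr -/sM -/snu le_eqVlt; apply/orP; left; apply/eqP; ring.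
Qed.

(** Expanding both factors gives four terms, matched one by one with the four products in [v0bE];
    the mixed ones use [nu_sqr_le] and [mu_sqr_le], the last one (SP1) itself. *)
Lemma WW_sqr_le i j : WW i j ^+ 2 <= 4 * (d ^+ 2 * V0b).
Proof.
have h x : (sm + x) ^+ 2 <= 2 * (sm ^+ 2 + x ^+ 2) by have := sqr_ge0 (sm - x); lra.
have h1 : WW i j ^+ 2 <= 4 * (sm ^+ 4 + sm ^+ 2 * XX i ^+ 2 + sm ^+ 2 * YY j ^+ 2
   + XX i ^+ 2 * YY j ^+ 2).
  rewrite /WW exprMn (_ : 4 * _ = 2 * (sm ^+ 2 + XX i ^+ 2) * (2 * (sm ^+ 2 + YY j ^+ 2)));
    last by ring.
  by apply: ler_pM; rewrite ?sqr_ge0.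
apply: (le_trans h1); apply: ler_wpM2l => //.
have g1 : sm ^+ 4 <= d ^+ 2 * (sM * sN * sm ^+ 4).
  rewrite (_ : d ^+ 2 * _ = (d * sM) * (d * sN) * sm ^+ 4); last by ring.
  by rewrite ler_peMl ?exprn_ge0// mulr_ege1.
have g2 : sm ^+ 2 * XX i ^+ 2 <= d ^+ 2 * (sM * sN * (sM * snu) * sm ^+ 2).
  rewrite (_ : sm ^+ 2 * _ = sm ^+ 2 * sM ^+ 2 * nu i ^+ 2); last by rewrite /XX; ring.
  rewrite (_ : d ^+ 2 * _ = sm ^+ 2 * sM ^+ 2 * (d ^+ 2 * (sN * snu))); last by ring.
  by apply: ler_wpM2l (nu_sqr_le i); rewrite mulr_ge0 ?sqr_ge0.
have g3 : sm ^+ 2 * YY j ^+ 2 <= d ^+ 2 * (sM * sN * (sN * smu) * sm ^+ 2).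
  rewrite (_ : sm ^+ 2 * _ = sm ^+ 2 * sN ^+ 2 * mu j ^+ 2); last by rewrite /YY; ring.
  rewrite (_ : d ^+ 2 * _ = sm ^+ 2 * sN ^+ 2 * (d ^+ 2 * (sM * smu))); last by ring.
  by apply: ler_wpM2l (mu_sqr_le j); rewrite mulr_ge0 ?sqr_ge0.
have g4 : XX i ^+ 2 * YY j ^+ 2 <= d ^+ 2 * (sM * sN * (sM * snu) * (sN * smu)).
  rewrite (_ : XX i ^+ 2 * _ = sM ^+ 2 * sN ^+ 2 * (mu j * nu i) ^+ 2); last by rewrite /XX /YY; ring.
  rewrite (_ : d ^+ 2 * _ = sM ^+ 2 * sN ^+ 2 * (d ^+ 2 * (smu * snu))); last by ring.
  by apply: ler_wpM2l (sp1 j i); rewrite mulr_ge0 ?sqr_ge0.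
rewrite /var_scale_b v0bE !mulrDr; lra.
Qed.

Lemma c10_sqr_le i j : i != j -> c10 i j ^+ 2 <= 4 * (d ^+ 2 * V0).
Proof.
move=> ij; have [z [-> _ zW]] := c10_cbar _ _ ij.
have k4 : 0 <= kap ^+ 4 by rewrite exprn_ge0// expR_ge0.
rewrite (_ : _ ^+ 2 = kap ^+ 4 * z ^+ 2); last by ring.
apply: (@le_trans _ _ (kap ^+ 4 * (4 * (d ^+ 2 * V0b)))).
  apply: ler_wpM2l => //; apply: le_trans (WW_sqr_le i j).
  rewrite -[X in X <= _]real_normK ?num_real// lerXn2r ?nnegrE//.
  exact: le_trans zW.
rewrite (_ : kap ^+ 4 * _ = 4 * (d ^+ 2 * (kap ^+ 4 * V0b))); last by ring.
by do 2!apply: ler_wpM2l => //; [rewrite sqr_ge0|exact: var_scale_geb].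
Qed.

Lemma c11_sqr_le i j : i != j -> (c11 i j + c11 j i) ^+ 2 <= 4 * (d ^+ 2 * V0).
Proof.
move=> ij; have /andP[l1 h1] := c11_between _ _ ij.
have ji : j != i by rewrite eq_sym.
have /andP[l2 h2] := c11_between _ _ ji.
have MN : 0 <= sM * sN by exact: mulr_ge0.
have t1 : 0 <= 1 - t by rewrite /t; have := d_small; lra.
rewrite [sN * sM]mulrC in l1 h1 l2 h2; have g := mulr_ge0 t1 MN.
apply: (@le_trans _ _ ((2 * (sM * sN)) ^+ 2)).
  by rewrite lerXn2r ?nnegrE; lra.
apply: (@le_trans _ _ (4 * (d ^+ 2 * (sM * sN * sa) ^+ 2))).
  rewrite (_ : _ ^+ 2 = 4 * (sM * sN) ^+ 2); last by ring.
  rewrite (_ : d ^+ 2 * _ = (d * sa) ^+ 2 * (sM * sN) ^+ 2); last by ring.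
  by apply: ler_wpM2l => //; rewrite ler_peMl ?sqr_ge0// exprn_ege1.
do 2![apply: ler_wpM2l; first by rewrite ?sqr_ge0].
exact (v0_ge11 R d sM sN sm sa kap smu snu d_gt0 d_le1 (expR_gt0 _) sM_ge sN_ge sm_ge smu_ge0 snu_ge0).
Qed.

Lemma dyad_part_sqr_le i j A : i != j -> zeta i j A ^+ 2 <= 36 * (d ^+ 2 * V0).
Proof.
move=> ij; have ji : j != i by rewrite eq_sym.
have h (c x : R) : `|x| <= 1 -> (c * x) ^+ 2 <= c ^+ 2.
  move=> x1; rewrite exprMn ler_piMr ?sqr_ge0// -[X in X <= _]real_normK ?num_real//.
  by rewrite exprn_ile1.
have h1 := h (c11 i j + c11 j i) _ (ectr_norm_le1 _ i j A (e11_ind)).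
have h2 := h (c10 i j) _ (ectr_norm_le1 _ i j A (e10_ind)).
have h3 := h (c10 j i) _ (ectr_norm_le1 _ j i A (e10_ind)).
have g1 := c11_sqr_le _ _ ij; have g2 := c10_sqr_le _ _ ij; have g3 := c10_sqr_le _ _ ji.
apply: (le_trans (sqr_add3_le _ _ _)); lra.
Qed.

End LowerBound.

(** * The normalized statistics *)

Definition small_params (d : R) : Prop :=
  [/\ forall i, mu i <= d, forall i, nu i <= d, forall i, a i <= d &
   [/\ 1 <= d * sm, 1 <= d * sa & forall i j, (mu i * nu j) ^+ 2 <= d ^+ 2 * (smu * snu)]].

Lemma E_cyc x1 x2 x3 x4 : E (cyc x1 x2 x3 x4) = cycE x1 x2 x3 x4.
Proof.
rewrite /cyc /cyc_mean /sum4 E_sum; apply: eq_bigr => -[[[i j] k] l] /=.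
move=> /and5P[/eqP ij /eqP ik /eqP il /eqP jk /andP[/eqP jl /eqP kl]].
rewrite (@eq_E _ (fun A => edge_val x1 i j A * (edge_val x2 j k A *
  (edge_val x3 k l A * edge_val x4 l i A)))); last by move=> A; rewrite -!mulrA.
rewrite E_locM; [|exact/eqP|]; last first.
  by do 2?apply: dyad_freeM; apply: dyad_free_edge => -[? ?]; subst; congruence.
rewrite E_locM; [|exact/eqP|]; last first.
  by apply: dyad_freeM; apply: dyad_free_edge => -[? ?]; subst; congruence.
rewrite E_locM; [|exact/eqP|]; last first.
  by apply: dyad_free_edge => -[? ?]; subst; congruence.
by rewrite !mulrA.
Qed.

Local Notation qa := (cycE e11 e00 e01 e00).
Local Notation qb := (cycE e10 e10 e00 e10).

Lemma E_Qa : E (@Qa R n) = qa.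
Proof. by rewrite -E_cyc; apply: eq_E => A; rewrite QaE. Qed.

Lemma E_Qb : E (@Qb R n) = qb.
Proof. by rewrite -E_cyc; apply: eq_E => A; rewrite QbE. Qed.

Lemma E_Ustat : E (Ustat rho) = 0.
Proof. by rewrite /Ustat EB EZ E_Qa E_Qb cycE_balance subrr. Qed.

Definition sg2 : R := E (fun A => Lin A ^+ 2).
Definition sd2 : R := p1_Var rho gamma alpha beta (Ustat rho).
Local Notation sg := (Num.sqrt sg2).
Local Notation sd := (Num.sqrt sd2).

Lemma UstatE A : Ustat rho A = Lin A + Rem A.
Proof. exact: (Ustat_decomp). Qed.

Lemma sd2E : sd2 = E (fun A => (Lin A + Rem A) ^+ 2).
Proof.
rewrite /sd2 /p1_Var E_Ustat expr0n subr0; apply: eq_E => A.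
by rewrite UstatE.
Qed.

Section Normalized.
(** With this scaling the bounds by an explicit constant times [d] become bounds by a
    small multiple of [k ^+ 2]. *)
Variables k d : R.
Hypotheses (k_gt0 : 0 < k) (k_small : k <= 10^-1) (dk : 100 * 100 * 100 * d = k ^+ 2).
Hypothesis dsmall : small_params d.

Let mu_le : forall i, mu i <= d. Proof. by case: dsmall. Qed.
Let nu_le : forall i, nu i <= d. Proof. by case: dsmall. Qed.
Let a_le : forall i, a i <= d. Proof. by case: dsmall. Qed.
Let sm_ge : 1 <= d * sm. Proof. by case: dsmall => _ _ _ []. Qed.
Let sa_ge : 1 <= d * sa. Proof. by case: dsmall => _ _ _ []. Qed.
Let sp1 : forall i j, (mu i * nu j) ^+ 2 <= d ^+ 2 * (smu * snu).
Proof. by case: dsmall => _ _ _ []. Qed.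
Let d_gt0 : 0 < d. Proof. by have := exprn_gt0 2 k_gt0; rewrite -dk; lra. Qed.
Let d_small : d <= 100^-1.
Proof.
have : k ^+ 2 <= 10^-1 * 10^-1 by rewrite expr2; apply: ler_pM => //; exact: ltW.
by rewrite -dk; lra.
Qed.
Let d_le1 : d <= 1. Proof. apply: (le_trans d_small); lra. Qed.

Let var_scale_gt0 : 0 < V0. Proof. by apply: (var_scale_gt0 d). Qed.

Lemma V0_le_sg2 : V0 <= 5 * sg2.
Proof.
have : 5^-1 * V0 <= sg2 by apply: (E_lin_part_sqr_ge d).
lra.
Qed.

Lemma sg2_gt0 : 0 < sg2.
Proof. by have := V0_le_sg2; move: var_scale_gt0; lra. Qed.

Lemma sg_gt0 : 0 < sg.
Proof. by rewrite sqrtr_gt0; exact: sg2_gt0. Qed.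

Lemma E_Rem_le : E (fun A => Rem A ^+ 2) <= k ^+ 2 * sg2.
Proof.
have h : E (fun A => Rem A ^+ 2) <= 300 * 500 * (d * V0).
  by apply: (E_rem_part_sqr_le d).
apply: (le_trans h); rewrite -dk.
(* 300 * 500 * 5 = 750000 stays below the 10^6 relating d to k^2. *)
have := ler_wpM2l (ltW d_gt0) V0_le_sg2.
have := mulr_gt0 d_gt0 sg2_gt0; lra.
Qed.

(** The cross term is split as 2 x y <= k x^2 + y^2 / k, and the remainder has second moment at most
    k^2 [sg2]: each part costs about k. *)
Lemma sd2_close : `|sd2 - sg2| <= 3 * k * sg2.
Proof.
have k2 : k ^+ 2 <= 10^-1 * k by rewrite expr2; apply: ler_wpM2r k_small; exact: ltW.
have rk := E_Rem_le; have r0 : 0 <= E (fun A => Rem A ^+ 2) by apply: E_ge0 => A; exact: sqr_ge0.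
have s0 := sg2_gt0.
rewrite sd2E (@eq_E _ (fun A => Lin A ^+ 2 + (2 * (Lin A * Rem A) + Rem A ^+ 2)));
  last by move=> A; ring.
rewrite !ED -/sg2 EZ addrC addKr.
have h : `|2 * E (fun A => Lin A * Rem A)| <= k * sg2 + k^-1 * E (fun A => Rem A ^+ 2).
  rewrite -EZ; apply: le_trans (normE_le _) _.
  rewrite /sg2 -!EZ -ED; apply: le_E => A; set x := Lin A; set y := Rem A.
  rewrite ler_norml; have e1 : k * x ^+ 2 + k^-1 * y ^+ 2 - 2 * (x * y) = k^-1 * (k * x - y) ^+ 2.
    by field; rewrite gt_eqF.
  have e2 : k * x ^+ 2 + k^-1 * y ^+ 2 + 2 * (x * y) = k^-1 * (k * x + y) ^+ 2.
    by field; rewrite gt_eqF.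
  have ki : 0 <= k^-1 by rewrite invr_ge0 ltW.
  have := mulr_ge0 ki (sqr_ge0 (k * x - y)); have := mulr_ge0 ki (sqr_ge0 (k * x + y)).
  by rewrite -e1 -e2 => ? ?; apply/andP; split; lra.
have h2 : k^-1 * E (fun A => Rem A ^+ 2) <= k * sg2.
  by rewrite ler_pdivrMl// mulrA -expr2.
have h3 : k ^+ 2 * sg2 <= 10^-1 * k * sg2 by apply: ler_wpM2r k2; exact: ltW.
have ks : 0 <= k * sg2 by rewrite mulr_ge0// ltW.
apply: le_trans (ler_normD _ _) _; rewrite [`|E _|]ger0_norm//; lra.
Qed.

Lemma sd2_ge : 7 / 10 * sg2 <= sd2.
Proof.
have := sd2_close; rewrite ler_norml => /andP[h _].
have : k * sg2 <= 10^-1 * sg2 by apply: ler_wpM2r k_small; exact/ltW/sg2_gt0.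
lra.
Qed.

Lemma sd2_le : sd2 <= 13 / 10 * sg2.
Proof.
have := sd2_close; rewrite ler_norml => /andP[_ h].
have : k * sg2 <= 10^-1 * sg2 by apply: ler_wpM2r k_small; exact/ltW/sg2_gt0.
lra.
Qed.

Lemma sd2_gt0 : 0 < sd2.
Proof. by have := sd2_ge; have := sg2_gt0; lra. Qed.

Lemma sd_gt0 : 0 < sd.
Proof. by rewrite sqrtr_gt0; exact: sd2_gt0. Qed.

Lemma sd_sg_close : (sg - sd) ^+ 2 <= 9 * k ^+ 2 * sg2.
Proof.
have h0 := sg_gt0; have h1 := sd_gt0.
have e1 : sg ^+ 2 = sg2 by rewrite sqr_sqrtr// ltW// sg2_gt0.
have e2 : sd ^+ 2 = sd2 by rewrite sqr_sqrtr// ltW// sd2_gt0.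
have h : `|sg - sd| * (sg + sd) <= 3 * k * sg * sg.
  rewrite -{1}(gtr0_norm (addr_gt0 h0 h1)) -normrM -mulrA -expr2 e1.
  rewrite (_ : (sg - sd) * (sg + sd) = - (sd ^+ 2 - sg ^+ 2)); last by ring.
  by rewrite normrN e1 e2; exact: sd2_close.
have h2 : `|sg - sd| <= 3 * k * sg.
  rewrite -(ler_pM2r h0); apply: le_trans h.
  by apply: ler_wpM2l => //; rewrite lerDl ltW.
rewrite -[X in X <= _]real_normK ?num_real// (_ : 9 * _ * _ = (3 * k * sg) ^+ 2).
  apply: lerXn2r => //; rewrite ?nnegrE.
  by apply: mulr_ge0; [apply: mulr_ge0 => //; exact: ltW|exact: ltW].
by rewrite !exprMn e1; ring.
Qed.

Definition W0 (A : adj n) : R := Lin A / sg.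
Definition W1 (A : adj n) : R := Ustat rho A / sd.

Lemma E_W0_sqr : E (fun A => W0 A ^+ 2) = 1.
Proof.
rewrite (@eq_E _ (fun A => sg2^-1 * Lin A ^+ 2)).
  by rewrite EZ -/sg2 mulVf// gt_eqF// sg2_gt0.
by move=> A; rewrite /W0 expr_div_n sqr_sqrtr ?(ltW sg2_gt0)// mulrC.
Qed.

(** The difference is the remainder over [sd] plus the change of normalization; 30 rounds up (2 + 2
    * 9) / (7 / 10). *)
Lemma E_W10_sqr : E (fun A => (W1 A - W0 A) ^+ 2) <= 30 * k ^+ 2.
Proof.
have h0 := sg_gt0; have h1 := sd_gt0.
have e1 : sg ^+ 2 = sg2 by rewrite sqr_sqrtr// ltW// sg2_gt0.
have e2 : sd ^+ 2 = sd2 by rewrite sqr_sqrtr// ltW// sd2_gt0.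
have c0 : 0 <= 2 / sd2 by rewrite divr_ge0// ltW// sd2_gt0.
apply: (@le_trans _ _ (E (fun A => 2 / sd2 * Rem A ^+ 2 +
   2 * (sg - sd) ^+ 2 / sd2 * W0 A ^+ 2))).
  apply: le_E => A; rewrite /W1 UstatE.
  have -> : (Lin A + Rem A) / sd - W0 A
     = Rem A / sd + (sg - sd) / sd * W0 A.
    by rewrite /W0; field; rewrite !gt_eqF.
  rewrite (_ : 2 / sd2 * _ = 2 * (Rem A / sd) ^+ 2); last first.
    by rewrite -[in LHS]e2; field; rewrite gt_eqF.
  rewrite (_ : 2 * (sg - sd) ^+ 2 / sd2 * _ = 2 * ((sg - sd) / sd * W0 A) ^+ 2); last first.
    by rewrite -[X in _ / X * _]e2; field; rewrite gt_eqF.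
  have := sqr_ge0 (Rem A / sd - (sg - sd) / sd * W0 A); lra.
rewrite ED !EZ E_W0_sqr mulr1.
rewrite [X in X <= _](_ : _ = (2 * E (fun A => Rem A ^+ 2) + 2 * (sg - sd) ^+ 2) / sd2);
  last by ring.
rewrite ler_pdivrMr ?sd2_gt0//.
have := E_Rem_le; have := sd_sg_close; have := sd2_ge.
have k0 : 0 <= k ^+ 2 := sqr_ge0 k.
move=> hs hc hr; have := ler_wpM2l k0 hs.
have := mulr_ge0 k0 (ltW sg2_gt0); lra.
Qed.

Lemma E_W0_cos t :
  `|E (fun A => cos (t * W0 A)) - expR (- (t ^+ 2 / 2))| <= 2 * t ^+ 2 * (14 * d) * `|t|
  /\ `|E (fun A => sin (t * W0 A))| <= 2 * t ^+ 2 * (14 * d) * `|t|.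
Proof.
pose z i j A := zeta i j A / sg.
have h0 := sg_gt0.
have e1 : sg ^+ 2 = sg2 by rewrite sqr_sqrtr// ltW// sg2_gt0.
have z_free (i j k' l : 'I_n) : ~ (k' = i /\ l = j) -> ~ (k' = j /\ l = i) ->
    dyad_free i j (z k' l).
  by move=> h1 h2; apply: dyad_freeM => //; exact: dyad_free_dyad_part.
have z_orth i j Y : i != j -> dyad_free i j Y -> E (fun A => z i j A * Y A) = 0.
  move=> ij Yf; rewrite (@eq_E _ (fun A => sg^-1 * (zeta i j A * Y A))).
    by rewrite EZ E_dyad_partM ?mulr0.
  by move=> A; rewrite /z; ring.
have z_sqr i j Y : i != j -> dyad_free i j Y ->
    E (fun A => z i j A ^+ 2 * Y A) = E (fun A => z i j A ^+ 2) * E Y.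
  move=> ij Yf.
  pose f p q := (((dyad_coef11 i j + dyad_coef11 j i)
     * (e11 i j p q - em e11 i j) + dyad_coef10 i j * (e10 i j p q - em e10 i j)
     + dyad_coef10 j i * (e10 j i q p - em e10 j i)) / sg) ^+ 2.
  have := @E_dyadM i j f (fun=> 1) ij (fun _ _ _ => erefl).
  have := @E_dyadM i j f Y ij Yf.
  rewrite E_cst mulr1 => hY h1.
  have zE A : z i j A ^+ 2 = f (A (i, j)) (A (j, i)) by [].
  rewrite (@eq_E (fun A => z i j A ^+ 2) (fun A => f (A (i, j)) (A (j, i)) * 1)).
    by rewrite h1 -hY.
  by move=> A; rewrite zE mulr1.
have z_le i j A : i != j -> `|z i j A| <= 14 * d.
  move=> ij; have hz : zeta i j A ^+ 2 <= 36 * (d ^+ 2 * V0).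
    by apply: dyad_part_sqr_le.
  have d14 : 0 <= 14 * d by rewrite mulr_ge0// ltW.
  rewrite -(@ler_pXn2r _ 2)// ?nnegrE// real_normK ?num_real// /z expr_div_n e1.
  (* The 14 comes from 36 * 5 = 180 <= 14^2. *)
  rewrite ler_pdivrMr ?sg2_gt0//; apply: (le_trans hz).
  have := ler_wpM2l (sqr_ge0 d) V0_le_sg2; have := mulr_ge0 (sqr_ge0 d) (ltW sg2_gt0).
  rewrite exprMn; lra.
have z_var : \sum_(e : 'I_n * 'I_n | (e.1 < e.2)%N) E (fun A => z e.1 e.2 A ^+ 2) = 1.
  transitivity (sg2^-1 * \sum_(e : 'I_n * 'I_n | (e.1 < e.2)%N) E (fun A => zeta e.1 e.2 A ^+ 2)).
    rewrite mulr_sumr; apply: eq_bigr => e _; rewrite -EZ; apply: eq_E => A.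
    by rewrite /z expr_div_n e1 mulrC.
  by rewrite -E_lin_part_sqr -/sg2 mulVf// gt_eqF// sg2_gt0.
have WE A : W0 A = zsum z A.
  by rewrite /W0 lin_part_dyads mulr_suml.
have d14 : 0 <= 14 * d by rewrite mulr_ge0// ltW.
under eq_E do rewrite WE.
split; last first.
  rewrite (@eq_E _ (fun A => sin (t * zsum z A))).
    exact: (E_sin_zsum z (14 * d) z_free z_orth z_sqr z_le z_var t d14).
  by move=> A; rewrite WE.
exact: (E_cos_zsum z (14 * d) z_free z_orth z_sqr z_le z_var t d14).
Qed.

Lemma qa_ge : 3 / 4 * (sM * sN * sa ^+ 2) <= qa.
Proof. by apply: (cycE_ge d). Qed.

Let sM_ge1 : 1 <= sM. Proof. by apply: (sM_ge1 d). Qed.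
Let sN_ge1 : 1 <= sN. Proof. by apply: (sN_ge1 d). Qed.
Let sa_ge1 : 1 <= sa. Proof. by apply: (sa_ge1 d). Qed.
Let sm_ge1 : 1 <= sm. Proof. by apply: (sm_ge1 d). Qed.
Let kap_gt0 : 0 < kap. Proof. exact: expR_gt0. Qed.

Lemma MNs_gt0 : 0 < sM * sN * sa ^+ 2.
Proof.
apply: mulr_gt0; first by apply: mulr_gt0; exact: lt_le_trans ltr01 _.
by apply: exprn_gt0; exact: lt_le_trans ltr01 _.
Qed.

Lemma qa_gt0 : 0 < qa.
Proof. by apply: lt_le_trans qa_ge; have := MNs_gt0; lra. Qed.

Lemma sd2_le_qa : sd2 <= 500 * d * qa ^+ 2.
Proof.
have h1 : sg2 <= 40 * V0 by apply: (E_lin_part_sqr_le d).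
have h2 : V0 <= 5 * d * (sM * sN * sa ^+ 2) ^+ 2.
  apply: (v0_le R d sM sN sm sa kap smu snu) => //; try exact: saE.
  - by apply: (sM_ge d).
  - by apply: (sN_ge d).
  - exact: smu_ge0.
  - exact: snu_ge0.
  - by apply: (sm_le_sM d).
  - by apply: (sm_le_sN d).
  - by apply: (smu_le d).
  - by apply: (snu_le d).
have h3 : (3 / 4 * (sM * sN * sa ^+ 2)) ^+ 2 <= qa ^+ 2.
  by apply: lerXn2r qa_ge; rewrite nnegrE ltW// ?qa_gt0// mulr_gt0 ?MNs_gt0.
(* 500 rounds up (13 / 10) * 40 * 5 * (4 / 3)^2. *)
have := ler_wpM2l (ltW d_gt0) h3; have := sd2_le; rewrite exprMn.
have := mulr_ge0 (ltW d_gt0) (sqr_ge0 qa).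
move: h1 h2; move: (sM * sN * sa ^+ 2) => X; lra.
Qed.

Lemma qa_qb : qa = kap ^+ 2 * qb.
Proof. by rewrite cycE_balance expR_rho. Qed.

Lemma qb_gt0 : 0 < qb.
Proof. by have := qa_gt0; rewrite qa_qb pmulr_rgt0// exprn_gt0. Qed.

Lemma E_Qb_close : E (fun A => (Qb R A / qb - 1) ^+ 2) <= k ^+ 2.
Proof.
have b0 := qb_gt0.
rewrite (@eq_E _ (fun A => (qb ^+ 2)^-1 * (Qb R A - qb) ^+ 2)); last first.
  by move=> A; field; rewrite gt_eqF.
rewrite EZ ler_pdivrMl ?exprn_gt0// -dk.
have h1 : E (fun A => (Qb R A - qb) ^+ 2) <= 300 * 300 * V0b.
  by apply: (E_Qb_var_le d).
have h2 : V0b <= 4 * d * (sM * sN * sm ^+ 2) ^+ 2.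
  apply: (v0b_le R d sM sN sm smu snu) => //.
  - by apply: (sM_ge d).
  - by apply: (sN_ge d).
  - exact: smu_ge0.
  - exact: snu_ge0.
  - by apply: (sm_le_sM d).
  - by apply: (sm_le_sN d).
  - by apply: (smu_le d).
  - by apply: (snu_le d).
have h3 : 3 / 4 * (sM * sN * sm ^+ 2) <= qb.
  rewrite -(ler_pM2l (exprn_gt0 2 kap_gt0)) -qa_qb; apply: le_trans qa_ge.
  by rewrite saE le_eqVlt; apply/orP; left; apply/eqP; ring.
have h4 : (3 / 4 * (sM * sN * sm ^+ 2)) ^+ 2 <= qb ^+ 2.
  apply: lerXn2r h3; rewrite nnegrE; last exact: ltW.
  by rewrite !mulr_ge0// ?sqr_ge0// (le_trans ler01).
have := ler_wpM2l (ltW d_gt0) h4; rewrite exprMn.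
have := mulr_ge0 (ltW d_gt0) (sqr_ge0 qb).
move: h1 h2; move: (sM * sN * sm ^+ 2) => X; lra.
Qed.

(** Keeps e^(rho/2) well inside (1/n, n), so the truncation at 2 log n is inactive. The sums over n
    vertices are at most n times the largest entry, while d ||eta||_1 and its multiple by e^(rho/2)
    are at least 1. *)
Lemma kap_n : kap <= d ^+ 2 * n%:R /\ 1 <= d ^+ 3 * n%:R * kap.
Proof.
have n0 : 0 <= n%:R :> R by [].
have san : sa <= d * n%:R.
  rewrite /l1_aeta; apply: (@le_trans _ _ (\sum_(i < n) d)).
    by apply: ler_sum => i _; exact: a_le.
  by rewrite sumr_const card_ord mulr_natr.
have smn : sm <= d ^+ 2 * n%:R.
  rewrite /l1_eta; apply: (@le_trans _ _ (\sum_(i < n) d ^+ 2)).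
    apply: ler_sum => i _; rewrite expr2.
    exact: ler_pM (mu_ge0 i) (nu_ge0 i) (mu_le i) (nu_le i).
  by rewrite sumr_const card_ord mulr_natr.
have k0 := ltW kap_gt0; have d0 := ltW d_gt0.
split.
  apply: (@le_trans _ _ (kap * (d * sm))); first by rewrite ler_peMr.
  by rewrite mulrCA -saE expr2 -mulrA; apply: ler_wpM2l.
apply: (le_trans sa_ge); rewrite saE.
rewrite (_ : d ^+ 3 * n%:R * kap = d * (kap * (d ^+ 2 * n%:R))); last by ring.
by do 2!apply: ler_wpM2l => //.
Qed.

Definition W2 (A : adj n) : R := qa / sd * (rho_hat_star R A - rho).

(** With r = sd / qa, b = Qb / qb and y = W1 r / b one has Qa = e^rho Qb (1 + y), hence W2 = ln (1 +
    y) / r. The two errors come from replacing ln (1 + y) by y and b by 1. *)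
Lemma W2_W1_close (T e A : _) : 1 <= T -> 0 < e -> e <= 2^-1 -> 4 * T * (sd / qa) <= 1 ->
  `|W1 A| <= T -> `|Qb R A / qb - 1| <= e ->
  `|W2 A - W1 A| <= 2 * e * T + 8 * T ^+ 2 * (sd / qa).
Proof.
move=> T1 e0 e2; have [r rE] : {r | r = sd / qa} by exists (sd / qa).
rewrite -rE => Tr wT.
have [w wE0] : {w | w = W1 A} by exists (W1 A).
have [b bE] : {b | b = Qb R A / qb} by exists (Qb R A / qb).
rewrite -bE -wE0 ler_norml => /andP[b1 b2]; rewrite -wE0 in wT.
have b0 : 0 < b by lra.
have qa0 := qa_gt0; have qb0 := qb_gt0; have sd0 := sd_gt0.
have r0 : 0 < r by rewrite rE divr_gt0.
pose y := w * r / b.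
have bV : b^-1 <= 2 by rewrite -[2]invrK lef_pV2 ?posrE//; lra.
have bV0 : 0 < b^-1 by rewrite invr_gt0.
have yle : `|y| <= 2^-1.
  rewrite /y !normrM (gtr0_norm r0) (gtr0_norm bV0).
  apply: (@le_trans _ _ (T * r * 2)); last by lra.
  apply: ler_pM => //; [by rewrite mulr_ge0// ltW|exact: ltW|].
  by apply: ler_wpM2r wT; exact: ltW.
have QbE' : Qb R A = qb * b by rewrite bE mulrC divfK// gt_eqF.
have UE : Ustat rho A = w * sd by rewrite wE0 /W1 divfK// gt_eqF.
have QaE' : Qa R A = kap ^+ 2 * Qb R A * (1 + y).
  have : Qa R A = Ustat rho A + expR rho * Qb R A by rewrite /Ustat subrK.
  rewrite UE expR_rho => ->; rewrite QbE' /y rE qa_qb.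
  by field; rewrite !gt_eqF.
have Qb0 : 0 < Qb R A by rewrite QbE' mulr_gt0.
have y12 : 2^-1 <= 1 + y by move: yle; rewrite ler_norml => /andP[]; lra.
have y32 : 1 + y <= 3 / 2 by move: yle; rewrite ler_norml => /andP[]; lra.
have y0 : 0 < 1 + y by lra.
have k20 : 0 < kap ^+ 2 by rewrite exprn_gt0.
have Qa0 : 0 < Qa R A by rewrite QaE' !mulr_gt0.
have ratio : Qa R A / Qb R A = kap ^+ 2 * (1 + y).
  by rewrite QaE'; field; rewrite gt_eqF.
have lnr : ln (Qa R A / Qb R A) = rho + ln (1 + y).
  by rewrite ratio -expR_rho lnM ?posrE ?expR_gt0// expRK.
have [kn1 kn2] := kap_n.
have d0 := ltW d_gt0.
have n0 : 0 < n%:R :> R.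
  rewrite ltr0n lt0n; apply: contraTneq kn1 => ->; rewrite mulr0 -ltNge; exact: kap_gt0.
have small4 : d ^+ 2 <= 10^-1.
  by rewrite expr2; have := ler_pM d0 d0 d_small d_small; lra.
have small6 : d ^+ 3 <= 10^-1.
  by rewrite exprS; have := ler_pM d0 (sqr_ge0 d) d_small small4; lra.
have kn : kap <= 10^-1 * n%:R by apply: (le_trans kn1); apply: ler_wpM2r => //; exact: ltW.
have kn' : 1 <= 10^-1 * n%:R * kap.
  apply: (le_trans kn2); apply: ler_wpM2r; first exact: ltW.
  by apply: ler_wpM2r => //; exact: ltW.
(* The ratio is e^rho (1 + y) with 1 + y in [1/2, 3/2]; the factor 10 gained in [kn] and [kn']
   absorbs this. *)
have hH : Htrunc (ln (Qa R A / Qb R A)) (2 * ln n%:R) = ln (Qa R A / Qb R A).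
  have up : Qa R A / Qb R A <= n%:R ^+ 2.
    rewrite ratio; apply: (@le_trans _ _ ((10^-1 * n%:R) ^+ 2 * (3 / 2))).
      apply: (ler_pM (ltW k20) (ltW y0) _ y32).
      by apply: lerXn2r kn; rewrite nnegrE ltW// mulr_gt0.
    by rewrite exprMn; have := sqr_ge0 (n%:R : R); lra.
  have lo : 1 <= Qa R A / Qb R A * n%:R ^+ 2.
    rewrite ratio; have h : 1 <= (10^-1 * n%:R * kap) ^+ 2 by rewrite exprn_ege1.
    apply: (le_trans h); rewrite !exprMn.
    have g := mulr_ge0 (ltW k20) (sqr_ge0 (n%:R : R)).
    have := ler_wpM2l g y12; lra.
  have rp : 0 < Qa R A / Qb R A by rewrite divr_gt0.
  rewrite /Htrunc ifT// ler_norml (_ : 2 * ln n%:R = ln (n%:R ^+ 2)); last first.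
    by rewrite lnXn// mulr_natl.
  rewrite ler_ln ?posrE ?exprn_gt0// up andbT.
  rewrite -subr_ge0 opprK -lnM ?posrE ?exprn_gt0//; exact: ln_ge0.
have W2E : W2 A = r^-1 * ln (1 + y).
  rewrite /W2 /rho_hat_star (gt_eqF Qa0) (gt_eqF Qb0) /= hH lnr.
  by rewrite addrC addKr rE invf_div.
have wE : w = r^-1 * (y * b) by rewrite /y; field; rewrite !gt_eqF.
have yb : r^-1 * y = w / b by rewrite /y; field; rewrite !gt_eqF.
rewrite W2E (_ : _ - _ = r^-1 * (ln (1 + y) - y) + w * (b^-1 - 1)); last first.
  by rewrite mulrBr yb; ring.
apply: le_trans (ler_normD _ _) _; rewrite addrC; apply: lerD.
  rewrite normrM (_ : b^-1 - 1 = b^-1 * (1 - b)); last by field; rewrite gt_eqF.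
  rewrite [`|b^-1 * _|]normrM (gtr0_norm bV0).
  rewrite [X in _ <= X](_ : _ = T * (2 * e)); last by ring.
  apply: ler_pM => //; first by rewrite mulr_ge0// ltW.
  apply: ler_pM => //; first exact: ltW.
  by rewrite ler_norml; apply/andP; split; lra.
rewrite normrM (gtr0_norm (_ : 0 < r^-1)) ?invr_gt0//.
rewrite ler_pdivrMl//; apply: le_trans (ln1D_close _ _ yle) _.
rewrite (_ : y ^+ 2 = w ^+ 2 * r ^+ 2 * b^-1 ^+ 2); last by rewrite /y; field; rewrite gt_eqF.
rewrite (_ : r * (8 * T ^+ 2 * r) = 2 * (T ^+ 2 * r ^+ 2 * 2 ^+ 2)); last by ring.
have wT2 : w ^+ 2 <= T ^+ 2.
  by rewrite -[X in X <= _]real_normK ?num_real// lerXn2r ?nnegrE//; lra.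
have bV2 : b^-1 ^+ 2 <= 2 ^+ 2 by apply: lerXn2r bV; rewrite nnegrE// ltW.
apply: ler_wpM2l => //; apply: (ler_pM _ (sqr_ge0 _) _ bV2).
  by apply: mulr_ge0; exact: sqr_ge0.
by apply: ler_wpM2r wT2; exact: sqr_ge0.
Qed.

Lemma sd_le_qa : sd / qa <= k.
Proof.
have q0 := qa_gt0; have k0 := ltW k_gt0.
have sE : sd ^+ 2 = sd2 by rewrite sqr_sqrtr// ltW// sd2_gt0.
have kq : 0 <= k * qa by rewrite mulr_ge0// ltW.
rewrite ler_pdivrMr// -(@ler_pXn2r _ 2)// ?nnegrE ?sqrtr_ge0// sE.
apply: (le_trans sd2_le_qa); rewrite exprMn -dk.
apply: ler_wpM2r; first exact: sqr_ge0.
by apply: ler_wpM2r; [exact: ltW|lra].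
Qed.

Lemma E_W1_tail (e : R) : 0 < e ->
  E (fun A => b2R R (e < `|W1 A - W0 A|)) <= 30 * k ^+ 2 / e ^+ 2.
Proof.
move=> e0; apply: (@le_trans _ _ (E (fun A => (e ^+ 2)^-1 * (W1 A - W0 A) ^+ 2))).
  by apply: le_E => A; rewrite mulrC; exact: b2R_lt_norm.
by rewrite EZ mulrC ler_wpM2r ?invr_ge0 ?sqr_ge0// E_W10_sqr.
Qed.

(** A union bound over three bad events: [W1] far from [W0], [W0] large, or Q_n(b) far from its
    mean. Off them [W2_W1_close] applies, and each is handled by Chebyshev. *)
Lemma E_W2_tail (T e1 e : R) : 1 <= T -> 0 < e1 -> e1 <= 2^-1 -> 4 * T * k <= 1 ->
  2 * e1 * T + 8 * T ^+ 2 * k <= e / 2 -> 0 < e -> e <= 1 ->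
  E (fun A => b2R R (e < `|W2 A - W0 A|)) <=
  30 * k ^+ 2 / (e / 2) ^+ 2 + (T / 2) ^- 2 + k ^+ 2 / e1 ^+ 2.
Proof.
move=> T1 e10 e12 Tk eT e0 e_le1.
have T0 : 0 < T by lra.
have e20 : 0 < e / 2 by lra.
have T20 : 0 < T / 2 by lra.
have rk := sd_le_qa.
apply: (@le_trans _ _ (E (fun A => (b2R R (e / 2 < `|W1 A - W0 A|)
  + ((T / 2) ^+ 2)^-1 * W0 A ^+ 2) + (e1 ^+ 2)^-1 * (Qb R A / qb - 1) ^+ 2))); last first.
  rewrite !ED !EZ E_W0_sqr mulr1; apply: lerD.
    by rewrite lerD2r; exact: E_W1_tail.
  by rewrite [X in _ <= X]mulrC; apply: ler_wpM2l; [rewrite invr_ge0 sqr_ge0|exact: E_Qb_close].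
apply: le_E => A.
have h2 := b2R_lt_norm R (W0 A) _ T20; have h3 := b2R_lt_norm R (Qb R A / qb - 1) _ e10.
rewrite [X in _ <= X]mulrC in h2; rewrite [X in _ <= X]mulrC in h3.
apply: le_trans (lerD (lerD (lexx _) h2) h3).
have b2R01 (b : bool) : 0 <= b2R R b <= 1 by case: b; rewrite /b2R /= ?lexx ?ler01.
have /andP[p0 p1] := b2R01 (e < `|W2 A - W0 A|).
have /andP[p2 _] := b2R01 (e / 2 < `|W1 A - W0 A|).
have /andP[p3 _] := b2R01 (T / 2 < `|W0 A|).
have /andP[p4 _] := b2R01 (e1 < `|Qb R A / qb - 1|).
have /andP[pf _] := b2R01 false.
have [g1|g1] := ltP (e / 2) `|W1 A - W0 A|.
  by rewrite [b2R R true]/b2R; lra.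
have [g2|g2] := ltP (T / 2) `|W0 A|.
  by rewrite [b2R R true]/b2R; lra.
have [g3|g3] := ltP e1 `|Qb R A / qb - 1|.
  by rewrite [b2R R true]/b2R; lra.
have n1 : `|W1 A| <= T.
  by rewrite -(subrK (W0 A) (W1 A)); apply: le_trans (ler_normD _ _) _; lra.
have r1 : 4 * T * (sd / qa) <= 1.
  by apply: le_trans Tk; apply: ler_wpM2l rk; rewrite mulr_ge0// ltW.
have close := W2_W1_close T e1 A T1 e10 e12 r1 n1 g3.
have r2 : 8 * T ^+ 2 * (sd / qa) <= 8 * T ^+ 2 * k.
  by apply: ler_wpM2l rk; rewrite mulr_ge0// sqr_ge0.
have : `|W2 A - W0 A| <= e.
  rewrite (_ : W2 A - W0 A = (W2 A - W1 A) + (W1 A - W0 A)); last by ring.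
  by apply: le_trans (ler_normD _ _) _; lra.
by rewrite leNgt => /negbTE ->; rewrite /b2R; lra.
Qed.

End Normalized.

End Model.

(** * Asymptotics *)

Section Asymptotics.
Variables (R : realType) (rho gamma : nat -> R) (alpha beta : forall n : nat, 'I_n -> R).

Local Notation mu n := (mu_ (gamma n) (alpha n)).
Local Notation nu n := (nu_ (gamma n) (beta n)).
Local Notation eta n := (eta_ (gamma n) (alpha n) (beta n)).

Hypothesis mu0 : (fun n => vmax (mu n)) @ \oo --> (0 : R).
Hypothesis nu0 : (fun n => vmax (nu n)) @ \oo --> (0 : R).
Hypothesis eta0 : (fun n => expR (rho n / 2) * vmax (eta n)) @ \oo --> (0 : R).
Hypothesis keta_oo : (fun n => expR (rho n / 2) * l1norm (eta n)) @ \oo --> +oo.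
Hypothesis eta_oo : (fun n => l1norm (eta n)) @ \oo --> +oo.
Hypothesis sp1 : (fun n => vmax (mu n) ^+ 2 * vmax (nu n) ^+ 2
  / (inner (mu n) (eta n) * inner (nu n) (eta n))) @ \oo --> (0 : R).

Local Notation small n d := (small_params R n (rho n) (gamma n) (alpha n) (beta n) d).

Lemma near_le_of_cvg0 (u : nat -> R) (e : R) : 0 < e -> u @ \oo --> (0 : R) ->
  \forall n \near \oo, u n <= e.
Proof.
move=> e0 /cvgrPdist_le /(_ _ e0); apply: filterS => n.
by rewrite sub0r normrN => /(le_trans (ler_norm _)).
Qed.

Lemma le_vmax n (x : 'I_n -> R) i : x i <= vmax x.
Proof. by rewrite /vmax; exact: le_bigmax. Qed.

Lemma l1norm_eta n : l1norm (eta n) = l1_eta R n (gamma n) (alpha n) (beta n).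
Proof.
by apply: eq_bigr => i _; rewrite ger0_norm// mulr_ge0// expR_ge0.
Qed.

Lemma small_params_near d : 0 < d -> \forall n \near \oo, small n d.
Proof.
move=> d0; have di : 0 < d^-1 by rewrite invr_gt0.
have d20 : 0 < d ^+ 2 by rewrite exprn_gt0.
have h1 := near_le_of_cvg0 _ _ d0 mu0.
have h2 := near_le_of_cvg0 _ _ d0 nu0.
have h3 := near_le_of_cvg0 _ _ d0 eta0.
have h4 := near_le_of_cvg0 _ _ d20 sp1.
have h5 : \forall n \near \oo, d^-1 <= l1norm (eta n) by move/cvgryPge: eta_oo; exact.
have h6 : \forall n \near \oo, d^-1 <= expR (rho n / 2) * l1norm (eta n).
  by move/cvgryPge: keta_oo; exact.
near=> n.
have g1 : vmax (mu n) <= d by near: n; exact: h1.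
have g2 : vmax (nu n) <= d by near: n; exact: h2.
have g3 : expR (rho n / 2) * vmax (eta n) <= d by near: n; exact: h3.
have g4 : vmax (mu n) ^+ 2 * vmax (nu n) ^+ 2
  / (inner (mu n) (eta n) * inner (nu n) (eta n)) <= d ^+ 2 by near: n; exact: h4.
have g5 : d^-1 <= l1norm (eta n) by near: n; exact: h5.
have g6 : d^-1 <= expR (rho n / 2) * l1norm (eta n) by near: n; exact: h6.
(* For n = 0 the l1 norm would be 0. A vertex is needed for the inner products to be positive, so
   that the quotient in (SP1) is a genuine one. *)
have n_gt0 : (0 < n)%N.
  rewrite lt0n; apply: contraTneq g5 => n0.
  rewrite -ltNge; apply: le_lt_trans di; rewrite /l1norm big1// => i _.
  by exfalso; case: i; rewrite n0.
have pos (x y : 'I_n -> R) : (forall i, 0 < x i) -> (forall i, 0 < y i) -> 0 < inner x y.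
  move=> x0 y0; rewrite /inner (bigD1 (Ordinal n_gt0))//=; apply: ltr_pwDl.
    exact: mulr_gt0.
  by apply: sumr_ge0 => i _; rewrite mulr_ge0// ltW.
have e0 i : 0 < eta n i by rewrite mulr_gt0 ?expR_gt0.
have s0 : 0 < inner (mu n) (eta n) * inner (nu n) (eta n).
  by apply: mulr_gt0; apply: pos => // i; exact: expR_gt0.
split.
- by move=> i; apply: le_trans g1; exact: le_vmax.
- by move=> i; apply: le_trans g2; exact: le_vmax.
- by move=> i; apply: le_trans g3; apply: ler_wpM2l; [exact: expR_ge0|exact: le_vmax].
split.
- by rewrite -l1norm_eta -ler_pdivrMl// mulr1.
- by rewrite /l1_aeta -mulr_sumr -[\sum_i _]l1norm_eta -ler_pdivrMl// mulr1.
- move=> i j; rewrite ler_pdivrMr// in g4; apply: le_trans g4.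
  rewrite exprMn; apply: ler_pM; rewrite ?sqr_ge0//.
    by rewrite lerXn2r ?nnegrE ?expR_ge0 ?le_vmax//; apply: le_trans (le_vmax _ _ i); exact: expR_ge0.
  by rewrite lerXn2r ?nnegrE ?expR_ge0 ?le_vmax//; apply: le_trans (le_vmax _ _ j); exact: expR_ge0.
Unshelve. all: by end_near. Qed.

Local Notation pmf := (fun n => p1_pmf (rho n) (gamma n) (alpha n) (beta n)).
Local Notation W0 n := (W0 R n (rho n) (gamma n) (alpha n) (beta n)).
Local Notation W1 n := (W1 R n (rho n) (gamma n) (alpha n) (beta n)).
Local Notation W2 n := (W2 R n (rho n) (gamma n) (alpha n) (beta n)).

Let pmf_ge0 n A : 0 <= pmf n A. Proof. exact: p1_pmf_ge0. Qed.
Let pmf_sum1 n : \sum_(A : adj n) pmf n A = 1. Proof. exact: p1_pmf_sum1. Qed.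

Lemma near_small (k : R) : 0 < k -> \forall n \near \oo,
  exists2 d, 100 * 100 * 100 * d = k ^+ 2 & small n d.
Proof.
move=> k0; have d0 : 0 < k ^+ 2 / (100 * 100 * 100) by rewrite divr_gt0 ?exprn_gt0// !mulr_gt0.
apply: filterS (small_params_near _ d0) => n sn.
exists (k ^+ 2 / (100 * 100 * 100)) => //; lra.
Qed.

Lemma W0_sqr_near : \forall n \near \oo, Ex R pmf n (fun A => W0 n A ^+ 2) <= 2.
Proof.
have k0 : (0 : R) < 10^-1 by lra.
apply: filterS (near_small _ k0) => n [d dk sn].
have := E_W0_sqr R n _ _ _ _ _ _ k0 (lexx _) dk sn; rewrite /Ex /p1_E => ->.
by lra.
Qed.

Lemma W0_cf_near t e : 0 < e -> \forall n \near \oo,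
  `|Ex R pmf n (fun A => cos (t * W0 n A)) - expR (- (t ^+ 2 / 2))| <= e /\
  `|Ex R pmf n (fun A => sin (t * W0 n A))| <= e.
Proof.
move=> e0; pose s := t ^+ 2 * `|t|.
have s0 : 0 <= s by rewrite mulr_ge0 ?sqr_ge0.
pose k := Num.min 10^-1 (e / (1 + s)).
have s1 : 0 < 1 + s by lra.
have k1 : k <= 10^-1 by rewrite /k ge_min lexx.
have k0 : 0 < k by rewrite /k lt_min divr_gt0// andbT; lra.
have ks : k * s <= e.
  have k2 : k <= e / (1 + s) by rewrite /k ge_min lexx orbT.
  rewrite ler_pdivlMr// in k2; apply: le_trans k2; nra.
apply: filterS (near_small _ k0) => n [d dk sn].
have [c1 c2] := E_W0_cos R n _ _ _ _ _ _ k0 k1 dk sn t.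
have dk2 : 28 * d <= k by nra.
have b : 2 * t ^+ 2 * (14 * d) * `|t| <= e.
  rewrite (_ : _ * `|t| = 28 * d * s); last by rewrite /s; ring.
  by apply: le_trans ks; exact: ler_wpM2r.
by split; apply: le_trans b.
Qed.

Lemma conv_law_W0 : conv_law_std_normal pmf (fun n A => W0 n A).
Proof.
apply: (conv_law_of_cf R _ pmf_ge0 pmf_sum1); last exact: W0_sqr_near.
- by move=> t e e0; apply: filterS (W0_cf_near t e e0) => n [].
- by move=> t e e0; apply: filterS (W0_cf_near t e e0) => n [].
Qed.

Lemma conv_law_W1 : conv_law_std_normal pmf (fun n A => W1 n A).
Proof.
apply: (slutsky R _ pmf_ge0 pmf_sum1 _ _ conv_law_W0 W0_sqr_near) => e e0.
(* Capping at 1 makes the powers of u decrease; with this k the bound 30 k^2 / e^2 is well below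
   e. *)
pose u := Num.min e 1; pose k := u ^+ 3 / (10 * 10 * 10).
have u0 : 0 < u by rewrite lt_min e0 ltr01.
have u1 : u <= 1 by rewrite ge_min lexx orbT.
have ue : u <= e by rewrite ge_min lexx.
have u2 : u ^+ 2 <= u by rewrite expr2 ler_piMl// ltW.
have u20 : 0 < u ^+ 2 by rewrite exprn_gt0.
have u3 : u ^+ 3 <= u ^+ 2 by rewrite exprS ler_piMl// ltW.
have k0 : 0 < k by rewrite divr_gt0 ?exprn_gt0// !mulr_gt0.
have ku : k <= u ^+ 2 / (10 * 10 * 10) by rewrite /k; lra.
have k1 : k <= 10^-1 by move: ku; lra.
apply: filterS (near_small _ k0) => n [d dk sn].
apply: le_trans (E_W1_tail R n _ _ _ _ _ _ k0 k1 dk sn e e0) _.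
rewrite ler_pdivrMr ?exprn_gt0//.
have e2 : u ^+ 2 <= e ^+ 2 by rewrite lerXn2r ?nnegrE// ltW.
have := ler_pM (ltW u0) (ltW u20) ue e2.
have := ler_pM (ltW k0) (ltW k0) ku k1; rewrite -expr2.
rewrite -exprS; rewrite /k in ku *; have := exprn_gt0 3 u0; nra.
Qed.

Lemma conv_law_W2 : conv_law_std_normal pmf (fun n A => W2 n A).
Proof.
apply: (slutsky R _ pmf_ge0 pmf_sum1 _ _ conv_law_W0 W0_sqr_near) => e e0.
pose u := Num.min e 1; pose k := u ^+ 3 / (10 * 10 * 10).
have u0 : 0 < u by rewrite lt_min e0 ltr01.
have u1 : u <= 1 by rewrite ge_min lexx orbT.
have ue : u <= e by rewrite ge_min lexx.
have u2 : u ^+ 2 <= u by rewrite expr2 ler_piMl// ltW.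
have u20 : 0 < u ^+ 2 by rewrite exprn_gt0.
have u3 : u ^+ 3 <= u ^+ 2 by rewrite exprS ler_piMl// ltW.
have u30 : 0 < u ^+ 3 by rewrite exprn_gt0.
have k0 : 0 < k by rewrite divr_gt0// !mulr_gt0.
have ku : k <= u ^+ 2 / (10 * 10 * 10) by rewrite /k; lra.
have k1 : k <= 10^-1 by move: ku; lra.
(* T makes the tail of [W0] equal to u^2 / 4, and e1 makes 2 e1 T = u / 4; the cubic k then renders
   8 T^2 k and k^2 / e1^2 small against u. *)
pose T := 4 / u; pose e1 := u ^+ 2 / 32.
have un0 : u != 0 by rewrite gt_eqF.
have T1 : 1 <= T by rewrite /T ler_pdivlMr//; lra.
have e10 : 0 < e1 by rewrite /e1 divr_gt0.
have e12 : e1 <= 2^-1 by rewrite /e1; lra.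
have Tk : 4 * T * k <= 1.
  by rewrite (_ : 4 * T * k = 16 * u ^+ 2 / (10 * 10 * 10)); [lra|rewrite /T /k; field].
have eT : 2 * e1 * T + 8 * T ^+ 2 * k <= u / 2.
  rewrite (_ : _ + _ = (4^-1 + 128 / (10 * 10 * 10)) * u); [lra|rewrite /T /k /e1; field => //].
apply: filterS (near_small _ k0) => n [d dk sn].
apply: (@le_trans _ _ (Ex R pmf n (fun A => b2R R (u < `|W2 n A - W0 n A|)))).
  apply: (le_E R n) => A; rewrite /b2R; case: ifP => h1; case: ifP => h2 //.
  by move: (le_lt_trans ue h1); rewrite h2.
apply: le_trans (E_W2_tail R n _ _ _ _ _ _ k0 k1 dk sn T e1 u T1 e10 e12 Tk eT u0 u1) _.
apply: le_trans ue.
have u4 : u ^+ 4 <= u by rewrite exprS; apply: ler_piMr; [exact: ltW|move: u3 u2; lra].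
rewrite (_ : _ + _ = 120 * u ^+ 4 / (10 * 10 * 10) / (10 * 10 * 10) + u ^+ 2 / 4
  + 32 * 32 * u ^+ 2 / (10 * 10 * 10) / (10 * 10 * 10)); last first.
  by rewrite /T /k /e1; field.
lra.
Qed.

End Asymptotics.
Theorem theorem5 (R : realType) (rho gamma : nat -> R)
  (alpha beta : forall n : nat, 'I_n -> R) :
  (forall n, \sum_(i < n) alpha n i = 0) ->
  (forall n, \sum_(i < n) beta n i = 0) ->
  (* (G1) *)
  (fun n => vmax (mu_ (gamma n) (alpha n))) @ \oo --> (0 : R) ->
  (fun n => vmax (nu_ (gamma n) (beta n))) @ \oo --> (0 : R) ->
  (fun n => expR (rho n / 2) * vmax (eta_ (gamma n) (alpha n) (beta n))) @ \oo --> (0 : R) ->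
  (* (G2) *)
  (fun n => expR (rho n / 2) * l1norm (eta_ (gamma n) (alpha n) (beta n))) @ \oo --> +oo ->
  (fun n => l1norm (eta_ (gamma n) (alpha n) (beta n))) @ \oo --> +oo ->
  (* (SP1) *)
  (fun n => vmax (mu_ (gamma n) (alpha n)) ^+ 2 * vmax (nu_ (gamma n) (beta n)) ^+ 2
     / (inner (mu_ (gamma n) (alpha n)) (eta_ (gamma n) (alpha n) (beta n))
        * inner (nu_ (gamma n) (beta n)) (eta_ (gamma n) (alpha n) (beta n))))
     @ \oo --> (0 : R) ->
  (* (SP2): in Case (L), ||mu||_1 ≍ ||nu||_1 *)
  ((exists C : R, 0 < C /\ \forall n \near \oo,
       C * expR (rho_tilde (gamma n) (alpha n) (beta n)) <= expR (rho n)) ->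
   asymp_eq (fun n => l1norm (mu_ (gamma n) (alpha n)))
            (fun n => l1norm (nu_ (gamma n) (beta n)))) ->
  conv_law_std_normal (fun n => p1_pmf (rho n) (gamma n) (alpha n) (beta n))
    (fun n A => Ustat (rho n) A
       / Num.sqrt (p1_Var (rho n) (gamma n) (alpha n) (beta n) (Ustat (rho n))))
  /\
  conv_law_std_normal (fun n => p1_pmf (rho n) (gamma n) (alpha n) (beta n))
    (fun n A => p1_E (rho n) (gamma n) (alpha n) (beta n) (@Qa R n)
       / Num.sqrt (p1_Var (rho n) (gamma n) (alpha n) (beta n) (Ustat (rho n)))
       * (rho_hat_star R A - rho n)).

Proof.
move=> _ _ mu0 nu0 eta0 keta_oo eta_oo sp1 _; split.
  exact: (conv_law_W1 R rho gamma alpha beta mu0 nu0 eta0 keta_oo eta_oo sp1).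
(* [W2] is normalized by the explicit mean over cycles, which [E_Qa] identifies with the expectation
   of Q_n(a). *)
rewrite [X in conv_law_std_normal _ X](_ : _ =
  fun n A => W2 R n (rho n) (gamma n) (alpha n) (beta n) A).
  exact: (conv_law_W2 R rho gamma alpha beta mu0 nu0 eta0 keta_oo eta_oo sp1).
by apply: functional_extensionality_dep => n; apply/funext => A; rewrite /W2 -E_Qa.
Qed.
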